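(* Let $n>2$ and let $M_t$ be an isoparametric foliation on $(S^{n-1}(1),g^{\mathrm{st}})$ with $d$ principal curvatures. Then the restriction to any normal plane $\mathbf{V}$ for $M_t$ and the identification between $\mathbf{V}$ and $\mathbb{R}^2$ provide a one-to-one correspondence between the set of Legendre transformations of Minkowski norms on $\mathbb{R}^n$ induced by $M_t$, and the set of Legendre transformations of $D_{2d}$-invariant Minkowski norms on $\mathbb{R}^2$.
   Context: $g^{\mathrm{st}}$ is the standard flat metric of $\mathbb{R}^n$ (also its restriction to submanifolds). An isoparametric function on a Riemannian manifold $(M,g)$ is a smooth $p:M\to\mathbb{R}$, regular almost everywhere, with $g(\mathrm{grad}\,p,\mathrm{grad}\,p)=a\circ p$ and $\Delta p=b\circ p$ for some one-variable functions $a,b$; the family of its non-empty level sets is called an isoparametric foliation. An isoparametric foliation on $(S^{n-1}(1),g^{\mathrm{st}})$ with $d\in\{1,2,3,4,6\}$ principal curvatures is given by the level sets of an isoparametric function $p:S^{n-1}(1)\to[-1,1]$ which is the restriction of a homogeneous polynomial of degree $d$ on $\mathbb{R}^n$ and has $\pm1$ as its only critical values; each $p^{-1}(s)$, $-1<s<1$, is a closed connected hypersurface with exactly $d$ distinct principal curvatures, and $p^{-1}(\pm1)$ are the two focal submanifolds. It is parametrized as $M_t$, $t\in[0,\tfrac{\pi}d]$, so that $\mathrm{dist}_{S^{n-1}(1)}(x,M_0)=t$ for all $x\in M_t$, where $M_0$ and $M_{\pi/d}$ are the focal submanifolds. A geodesic of $(S^{n-1}(1),g^{\mathrm{st}})$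 is normal for $M_t$ if it meets each $M_t$ orthogonally; maximal normal geodesics are great circles $\mathbf{V}\cap S^{n-1}(1)$, and the planes $\mathbf{V}$ are called normal planes for $M_t$. Identification of $\mathbf{V}$ with $\mathbb{R}^2$: parametrize $\gamma=\mathbf{V}\cap S^{n-1}(1)$ by arc length as $\gamma(t)$ with $\gamma(0)\in M_0$, and map the orthonormal basis $\gamma(0),\gamma(\tfrac{\pi}{2})$ of $\mathbf{V}$ to $(1,0),(0,1)$. A Minkowski norm on $\mathbb{R}^m$ ($m\ge2$) is a continuous function $F:\mathbb{R}^m\to\mathbb{R}_{\ge0}$, positive and smooth on $\mathbb{R}^m\setminus\{0\}$, with $F(\lambda x)=\lambda F(x)$ for all $\lambda\ge0$, and such that the Hessian matrix of $E=\tfrac12F^2$ is positive definite at every $x\neq0$. A Minkowski norm on $\mathbb{R}^n$ is induced by $M_t$ if it is constant on each $M_t$. The Legendre transformation of $F$ is the diffeomorphism of $\mathbb{R}^m\setminus\{0\}$ given in orthonormal coordinates by $(x_1,\dots,x_m)\mapsto(\tfrac{\partial E}{\partial x_1},\dots,\tfrac{\partial E}{\partial x_m})$. $D_{2d}$ is the finite group ($\mathbb{Z}_2$ if $d=1$, dihedral of order $2d$ if $d>1$) of linear isometries of $\mathbb{R}^2$ generated by $(x_1,x_2)\mapsto(x_1,-x_2)$ and the rotation by angle $\tfrac{2\pi}{d}$. *)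

(* Defs.v *)
From HB Require Import structures.
From mathcomp Require Import all_boot all_order all_algebra.
From mathcomp Require Import all_classical all_reals all_analysis.
From mathcomp Require mpoly.

Set Implicit Arguments.
Unset Strict Implicit.
Unset Printing Implicit Defensive.

Import Order.TTheory GRing.Theory Num.Theory.
Import numFieldNormedType.Exports.

Local Open Scope classical_set_scope.
Local Open Scope ring_scope.

(* The norm `|x| that the library puts on 'rV[R]_n is the sup norm: it only
   serves for the topology, all the metric geometry goes through dot. *)
Definition dot {R : realType} {n : nat} (x y : 'rV[R]_n) : R :=
  \sum_(i < n) x 0 i * y 0 i.

Definition enorm {R : realType} {n : nat} (x : 'rV[R]_n) : R :=
  Num.sqrt (dot x x).

Definition sphere {R : realType} {n : nat} : set 'rV[R]_n :=
  [set x | enorm x = 1].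

Definition basis_vec {R : realType} {n : nat} (i : 'I_n) : 'rV[R]_n :=
  delta_mx 0 i.

Definition partial {R : realType} {n : nat} (i : 'I_n) (f : 'rV[R]_n -> R) :
    'rV[R]_n -> R :=
  fun x => 'D_(basis_vec i) f x.

Definition iter_partial {R : realType} {n : nat} (s : seq 'I_n)
    (f : 'rV[R]_n -> R) : 'rV[R]_n -> R :=
  foldr partial f s.

Definition smooth_on {R : realType} {n : nat} (U : set 'rV[R]_n)
    (f : 'rV[R]_n -> R) : Prop :=
  forall (s : seq 'I_n) (x : 'rV[R]_n), U x ->
    {for x, continuous (iter_partial s f)} /\
    (forall i : 'I_n, derivable (iter_partial s f) x (basis_vec i)).

Definition grad {R : realType} {n : nat} (f : 'rV[R]_n -> R) (x : 'rV[R]_n) :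
    'rV[R]_n :=
  \row_i partial i f x.

Definition hessian {R : realType} {n : nat} (f : 'rV[R]_n -> R)
    (x : 'rV[R]_n) : 'M[R]_n :=
  \matrix_(i, j) partial i (partial j f) x.

(* Functions and vector fields on the sphere are represented by functions
   defined on all of R^n, of which only the values on the sphere matter. *)

Definition radial_ext {R : realType} {n : nat} (p : 'rV[R]_n -> R) :
    'rV[R]_n -> R :=
  fun x => p ((enorm x)^-1 *: x).

Definition smooth_on_sphere {R : realType} {n : nat} (p : 'rV[R]_n -> R) :
    Prop :=
  smooth_on [set x | x != 0] (radial_ext p).

(* For a unit vector x, the orthogonal projection onto T_x S^(n-1). *)
Definition tproj {R : realType} {n : nat} (x w : 'rV[R]_n) : 'rV[R]_n :=
  w - dot w x *: x.

Definition sgrad {R : realType} {n : nat} (p : 'rV[R]_n -> R)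
    (x : 'rV[R]_n) : 'rV[R]_n :=
  tproj x (grad (radial_ext p) x).

(* The Levi-Civita connection of a submanifold of R^n is the tangential part of
   the ambient derivative; v is meant to be tangent at x, and the result then
   depends only on the values of X on the sphere. *)
Definition scovd {R : realType} {n : nat} (X : 'rV[R]_n -> 'rV[R]_n)
    (v x : 'rV[R]_n) : 'rV[R]_n :=
  tproj x ('D_v X x).

(* The trace of v |-> scovd X v x over T_x S^(n-1), computed over R^n after
   precomposition with the projection onto T_x S^(n-1). *)
Definition sdiv {R : realType} {n : nat} (X : 'rV[R]_n -> 'rV[R]_n)
    (x : 'rV[R]_n) : R :=
  \sum_(i < n) dot (scovd X (tproj x (basis_vec i)) x) (basis_vec i).

Definition slaplacian {R : realType} {n : nat} (p : 'rV[R]_n -> R)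
    (x : 'rV[R]_n) : R :=
  sdiv (sgrad p) x.

Definition sphere_dist {R : realType} {n : nat} (x y : 'rV[R]_n) : R :=
  acos (dot x y).

Definition sphere_dist_set {R : realType} {n : nat} (x : 'rV[R]_n)
    (A : set 'rV[R]_n) : R :=
  inf [set sphere_dist x y | y in A].

(* Zero (n-1)-dimensional Hausdorff measure, which for subsets of S^(n-1) is
   the same as zero Riemannian measure. *)
Definition sphere_null {R : realType} {n : nat} (A : set 'rV[R]_n) : Prop :=
  forall e : R, 0 < e ->
    exists (c : nat -> 'rV[R]_n) (r : nat -> R),
      [/\ forall k, 0 < r k,
          A `<=` \bigcup_k [set x | enorm (x - c k) < r k]
        & (\sum_(0 <= k <oo) (r k ^+ n.-1)%:E <= e%:E)%E].

Definition critical_point {R : realType} {n : nat} (p : 'rV[R]_n -> R) :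
    set 'rV[R]_n :=
  [set x | sphere x /\ sgrad p x = 0].

Definition level {R : realType} {n : nat} (p : 'rV[R]_n -> R) (s : R) :
    set 'rV[R]_n :=
  [set x | sphere x /\ p x = s].

Definition isoparametric_function {R : realType} {n : nat}
    (p : 'rV[R]_n -> R) : Prop :=
  [/\ smooth_on_sphere p,
      sphere_null (critical_point p),
      exists a : R -> R,
        forall x, sphere x -> dot (sgrad p x) (sgrad p x) = a (p x)
    & exists b : R -> R, forall x, sphere x -> slaplacian p x = b (p x)].

Definition unit_normal {R : realType} {n : nat} (p : 'rV[R]_n -> R)
    (x : 'rV[R]_n) : 'rV[R]_n :=
  (enorm (sgrad p x))^-1 *: sgrad p x.

(* The eigenvalues, at the regular point x of p, of the shape operator
   v |-> - nabla_v N of the level set of p through x. *)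
Definition principal_curvatures {R : realType} {n : nat} (p : 'rV[R]_n -> R)
    (x : 'rV[R]_n) : set R :=
  [set k | exists v : 'rV[R]_n,
     [/\ v != 0, dot v x = 0, dot v (sgrad p x) = 0
       & - scovd (unit_normal p) v x = k *: v]].

Definition homogeneous_polynomial_on_sphere {R : realType} {n : nat} (d : nat)
    (p : 'rV[R]_n -> R) : Prop :=
  exists P : mpoly.dhomog n R d, forall x, sphere x ->
    p x = mpoly.meval (fun i => x 0 i) (mpoly.mpoly_of_dhomog P).

(* The leaves are M t for t in [0, pi / d]; other values of M are irrelevant. *)
Definition isoparametric_foliation {R : realType} {n : nat} (d : nat)
    (M : R -> set 'rV[R]_n) : Prop :=
  d \in [:: 1; 2; 3; 4; 6]%N /\
  exists p : 'rV[R]_n -> R,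
    [/\ isoparametric_function p,
        homogeneous_polynomial_on_sphere d p,
        forall x, sphere x -> -1 <= p x <= 1
      & p @` critical_point p = [set 1; -1]] /\
    [/\ forall s : R, -1 < s < 1 -> connected (level p s),
        forall (s : R) x, -1 < s < 1 -> level p s x ->
          (principal_curvatures p x #= `I_d)%card,
        M @` `[0, pi / d%:R] = [set L | L !=set0 /\ exists s, L = level p s],
        [set M 0; M (pi / d%:R)] = [set level p 1; level p (-1)]
      & forall (t : R) x, t \in `[0, pi / d%:R] -> M t x ->
          sphere_dist_set x (M 0) = t].

(* Velocities at x of curves lying in A; when A is an embedded submanifold
   (here, a leaf, possibly a focal one) this is T_x A. *)
Definition tangent_vector {R : realType} {n : nat} (A : set 'rV[R]_n)
    (x : 'rV[R]_n) : set 'rV[R]_n :=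
  [set w | exists c : R -> 'rV[R]_n,
     [/\ c 0 = x, \forall s \near (0 : R), A (c s) & is_derive (0 : R) 1 c w]].

(* Maximal geodesics of the sphere, parametrized by arc length. *)
Definition sphere_geodesic {R : realType} {n : nat} (g : R -> 'rV[R]_n) :
    Prop :=
  exists u v : 'rV[R]_n,
    [/\ sphere u, sphere v, dot u v = 0
      & forall s, g s = cos s *: u + sin s *: v].

Definition normal_geodesic {R : realType} {n : nat} (d : nat)
    (M : R -> set 'rV[R]_n) (g : R -> 'rV[R]_n) : Prop :=
  sphere_geodesic g /\
  forall t : R, t \in `[0, pi / d%:R] ->
    (exists s, M t (g s)) /\
    (forall s w, M t (g s) -> tangent_vector (M t) (g s) w ->
       dot (derive1 g s) w = 0).

Definition parametrizes_great_circle {R : realType} {n : nat}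
    (V : {vspace 'rV[R]_n}) (g : R -> 'rV[R]_n) : Prop :=
  sphere_geodesic g /\ range g = [set x | x \in V] `&` sphere.

Definition normal_plane {R : realType} {n : nat} (d : nat)
    (M : R -> set 'rV[R]_n) (V : {vspace 'rV[R]_n}) : Prop :=
  \dim V = 2%N /\
  exists g, normal_geodesic d M g /\ parametrizes_great_circle V g.

Definition energy {R : realType} {m : nat} (F : 'rV[R]_m -> R) :
    'rV[R]_m -> R :=
  fun x => 2^-1 * F x ^+ 2.

Definition positive_definite {R : realType} {m : nat} (A : 'M[R]_m) : Prop :=
  forall v : 'rV[R]_m, v != 0 -> 0 < (v *m A *m v^T) 0 0.

Definition minkowski_norm {R : realType} {m : nat} (F : 'rV[R]_m -> R) :
    Prop :=
  [/\ continuous F /\ forall x, 0 <= F x,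
      forall x, x != 0 -> 0 < F x,
      smooth_on [set x | x != 0] F,
      forall (l : R) (x : 'rV[R]_m), 0 <= l -> F (l *: x) = l * F x
    & forall x, x != 0 -> positive_definite (hessian (energy F) x)].

Definition induced_by {R : realType} {n : nat} (d : nat)
    (M : R -> set 'rV[R]_n) (F : 'rV[R]_n -> R) : Prop :=
  forall t : R, t \in `[0, pi / d%:R] -> forall x y, M t x -> M t y -> F x = F y.

(* As a map on R^m \ {0}; on all of R^m it takes the value 0 at 0 whenever F is
   a Minkowski norm, so the value at 0 carries no information. *)
Definition legendre {R : realType} {m : nat} (F : 'rV[R]_m -> R) :
    'rV[R]_m -> 'rV[R]_m :=
  fun x => grad (energy F) x.

Definition induced_legendre {R : realType} {n : nat} (d : nat)
    (M : R -> set 'rV[R]_n) : set ('rV[R]_n -> 'rV[R]_n) :=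
  [set legendre F | F in [set F | minkowski_norm F /\ induced_by d M F]].

(* Matrices act on row vectors by right multiplication. *)
Definition reflection_mx {R : realType} : 'M[R]_2 :=
  diag_mx (\row_j (if j == 0 then 1 else -1)).

Definition rotation_mx {R : realType} (a : R) : 'M[R]_2 :=
  \matrix_(i, j) (if i == j then cos a else if i == 0 then sin a else - sin a).

Inductive dihedral {R : realType} (d : nat) : 'M[R]_2 -> Prop :=
| dihedral_one : dihedral d 1%:M
| dihedral_reflection : dihedral d reflection_mx
| dihedral_rotation : dihedral d (rotation_mx (2 * pi / d%:R))
| dihedral_mul A B : dihedral d A -> dihedral d B -> dihedral d (A *m B)
| dihedral_inv A : dihedral d A -> dihedral d (invmx A).

Definition dihedral_invariant {R : realType} (d : nat) (F : 'rV[R]_2 -> R) :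
    Prop :=
  forall A, dihedral d A -> forall x, F (x *m A) = F x.

Definition dihedral_legendre {R : realType} (d : nat) :
    set ('rV[R]_2 -> 'rV[R]_2) :=
  [set legendre F | F in [set F | minkowski_norm F /\ dihedral_invariant d F]].

(* g 0, g (pi / 2) is an orthonormal basis of the plane spanned by the great
   circle g; plane_point g and plane_coord g are the mutually inverse
   identifications of R^2 with that plane. *)
Definition plane_point {R : realType} {n : nat} (g : R -> 'rV[R]_n)
    (y : 'rV[R]_2) : 'rV[R]_n :=
  y 0 0 *: g 0 + y 0 1 *: g (pi / 2).

Definition plane_coord {R : realType} {n : nat} (g : R -> 'rV[R]_n)
    (x : 'rV[R]_n) : 'rV[R]_2 :=
  \row_j dot x (if j == 0 then g 0 else g (pi / 2)).

Definition plane_restriction {R : realType} {n : nat} (g : R -> 'rV[R]_n)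
    (Psi : 'rV[R]_n -> 'rV[R]_n) : 'rV[R]_2 -> 'rV[R]_2 :=
  fun y => plane_coord g (Psi (plane_point g y)).

(* Main.v *)
Require Import Defs.
From HB Require Import structures.
From mathcomp Require Import all_boot all_order all_algebra.
From mathcomp Require Import all_classical all_reals all_analysis.
From mathcomp Require mpoly.
From mathcomp Require Import ring lra.

Set Implicit Arguments.
Unset Strict Implicit.
Unset Printing Implicit Defensive.

Import Order.TTheory GRing.Theory Num.Theory.
Import numFieldNormedType.Exports.

Local Open Scope classical_set_scope.
Local Open Scope ring_scope.

(** The leaves are M t = p^-1(cos (d t)), and p (g s) = cos (d s) on the great
    circle g of a normal plane V. Indeed |grad p|^2 = a o p makes p a solution of
    y'^2 = a y on every great circle orthogonal to the leaves, in particular on g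
    and on a geodesic that realises the distance from M 0 to the other focal leaf
    ([min_geodesic], [profile_ode]). Restricted to a great circle p is also a
    homogeneous form of degree d in cos s and sin s, so it is determined by its
    germ at 0. Although the equation is degenerate at the initial value 1, this
    leads to uniqueness ([eikonal_trig_form]); uniqueness applied to reflected
    solutions shows that the solution is even about 0 and pi / d, and counting
    zeros of forms leaves only cos (d s) ([chebyshev_cos],
    [normal_circle_leaves]). It follows that the points of g on one leaf form an
    orbit of the dihedral group and that g meets every leaf.

    Let F be a Minkowski norm constant on the leaves, with energy E. Its
    restriction f to V is a dihedral-invariant Minkowski norm. The vectors
    orthogonal to V are tangent to the leaves at the regular points of g, so grad E
    is in V there, and at the focal points by continuity ([legendre_plane]).
    Therefore the Legendre transformation of F maps V to V and restricts to that
    of f ([restriction_legendre]). By Euler's identity <grad E, x> = 2 E x the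
    latter determines f, and f determines F since g meets every leaf
    ([restriction_injective]).

    Conversely a dihedral-invariant f has to be extended by
    F x = |x| f (pol (acos (p x) / d)) for unit vectors x, homogeneously, and two
    things have to be proved about this F. It is smooth across the focal leaves:
    f (pol (s / d)) is a smooth function of s that is even about 0 and pi, thus a
    smooth function of cos s up to the endpoints, by repeated division by sin
    ([smooth_divX], [Ck_acos]). And its energy has a positive definite Hessian.
    By compactness the energy e of f is convex even after subtraction of some
    c |y|^2 with c > 0 ([uniform_convexity], [strong_convexity]). The gradient xi
    of e - c |y|^2 at a point of the sector 0 < angle < pi / d lies in the closed
    sector, as comparison with the mirror images of the point shows
    ([chamber_gradient]). As the distance between two leaves is at least the
    difference of their angles ([dot_leaves]), <xi, y> is largest, among the points
    y of one leaf, at the point of the sector; so the affine function supporting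
    e - c |y|^2 in the plane supports E - c |x|^2 in the whole space
    ([extension_support]). Hence the Hessian of E is at least 2 c at regular points,
    and everywhere by continuity ([extension_hess]). *)

(** * Functions of class C^k *)

(** Total differentiability and all directional derivatives, rather than the
    coordinate ones: in this form stability under products and composition
    follows by induction on k, in any normed space. The reading by iterated
    partial derivatives is recovered by [smooth_on_Ck] and [Ck_smooth_on]. *)
Fixpoint Ck {R : realType} {V : normedModType R} (k : nat) (U : set V)
    (f : V -> R) : Prop :=
  if k is k'.+1 then
    (forall x, U x -> differentiable f x) /\ forall v, Ck k' U ('D_v f)
  else forall x, U x -> {for x, continuous f}.

Section Ck_theory.
Context {R : realType} {V : normedModType R}.

Lemma Ck_cont k (U : set V) (f : V -> R) :
  Ck k U f -> forall x, U x -> {for x, continuous f}.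
Proof.
by case: k => [//|k] [df _] x Ux; apply: differentiable_continuous; exact: df x Ux.
Qed.

Lemma CkS k (U : set V) (f : V -> R) :
  Ck k.+1 U f -> Ck k U f.
Proof.
elim: k f => [|k IH] f [df Df].
  by move=> x Ux; apply: differentiable_continuous; exact: df x Ux.
by split=> // v; exact: IH.
Qed.

Lemma sub_Ck k (U W : set V) (f : V -> R) :
  U `<=` W -> Ck k W f -> Ck k U f.
Proof.
move=> UW; elim: k f => [|k IH] f; first by move=> cf x /UW; exact: cf.
by move=> [df Df]; split=> [x /UW /df//|v]; exact: IH (Df v).
Qed.

Lemma Ck_local k (U : set V) (f : V -> R) :
  (forall x, U x -> exists2 W : set V, W x & Ck k W f) -> Ck k U f.
Proof.
elim: k f => [|k IH] f h; first by move=> x /h[W Wx]; apply.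
split=> [x /h[W Wx [df _]]|v]; first exact: df x Wx.
by apply: IH => x /h[W Wx [_ Df]]; exists W; last exact: Df.
Qed.

(** The first-order expansion of f at x is also one of g, since the two
    functions have the same germ. *)
Lemma near_eq_differentiable {W : normedModType R}
    (f g : V -> W) (x : V) :
  {near x, f =1 g} -> differentiable f x -> differentiable g x.
Proof.
move=> fg df.
have E : g \o shift x = cst (g x) + 'd f x +o_ 0 id.
  apply/eqaddoP => _/posnumP[e].
  have /eqaddoP/(_ e%:num) := diff_locally df.
  move=> /(_ [gt0 of e%:num]); apply: filter_app.
  have : \forall y \near (0:V), f (y + x) = g (y + x).
    rewrite (near_shift x); near do rewrite /= sub0r addrNK.
    exact: fg.
  apply: filter_app; near=> y => /= fgy.
by rewrite !fctE /= fgy (nbhs_singleton fg : f x = g x).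
have cd : continuous ('d f x) by exact: diff_continuous.
by apply/diff_locallyP; rewrite (diff_unique cd E).
Unshelve. all: by end_near. Qed.

Lemma eq_Ck k (U : set V) (f g : V -> R) :
  open U -> (forall x, U x -> f x = g x) -> Ck k U f -> Ck k U g.
Proof.
move=> oU; elim: k f g => [|k IH] f g fg.
  move=> cf x Ux.
  have nfg : {near x, f =1 g}.
    by near=> y; apply: fg; near: y; apply: open_nbhs_nbhs.
  have /cvg_trans : g @ x `=>` f @ x by exact: near_eq_cvg.
  by move=> /(_ _ (cf x Ux)); rewrite fg.
have nfg x : U x -> {near x, f =1 g}.
  by move=> Ux; near=> y; apply: fg; near: y; apply: open_nbhs_nbhs.
move=> [df Df]; split=> [x Ux|v].
  by apply: (near_eq_differentiable (nfg _ Ux)); exact: df x Ux.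
apply: IH (Df v) => x Ux; apply: near_eq_derive; exact: nfg.
Unshelve. all: by end_near. Qed.

Lemma Ck_cst k (U : set V) (c : R) :
  Ck k U (cst c).
Proof.
elim: k c => [|k IH] c; first by move=> x _; exact: cst_continuous.
split=> [x _|v]; first exact: differentiable_cst.
have -> : 'D_v (cst c : V -> R) = cst 0 by apply/funext => x; exact: derive_cst.
exact: IH.
Qed.

Lemma CkD k (U : set V) (f g : V -> R) :
  open U -> Ck k U f -> Ck k U g -> Ck k U (fun x => f x + g x).
Proof.
move=> oU; elim: k f g => [|k IH] f g.
  by move=> cf cg x Ux; apply: cvgD; [exact: cf|exact: cg].
move=> [df Df] [dg Dg]; split=> [x Ux|v].
  by apply: differentiableD; [exact: df x Ux|exact: dg x Ux].
apply: eq_Ck (IH _ _ (Df v) (Dg v)) => // x Ux /=.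
by rewrite -deriveD//; apply: diff_derivable; [exact: df x Ux|exact: dg x Ux].
Qed.

Lemma CkM k (U : set V) (f g : V -> R) :
  open U -> Ck k U f -> Ck k U g -> Ck k U (fun x => f x * g x).
Proof.
move=> oU; elim: k f g => [|k IH] f g.
  by move=> cf cg x Ux; apply: cvgM; [exact: cf|exact: cg].
move=> hf hg; have [df Df] := hf; have [dg Dg] := hg; split=> [x Ux|v].
  by apply: differentiableM; [exact: df x Ux|exact: dg x Ux].
have := CkD oU (IH _ _ (CkS hf) (Dg v)) (IH _ _ (CkS hg) (Df v)).
apply: eq_Ck => // x Ux /=.
by rewrite -[LHS]deriveM//; apply: diff_derivable; [exact: df x Ux|exact: dg x Ux].
Qed.

Lemma CkMl k (U : set V) (c : R) (f : V -> R) :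
  open U -> Ck k U f -> Ck k U (fun x => c * f x).
Proof. by move=> oU hf; apply: CkM => //; exact: Ck_cst. Qed.

Lemma CkN k (U : set V) (f : V -> R) :
  open U -> Ck k U f -> Ck k U (fun x => - f x).
Proof.
by move=> oU hf; apply: eq_Ck (CkMl (-1) oU hf) => // x _; rewrite mulN1r.
Qed.

Lemma Ck_sum k (U : set V) m
    (f : 'I_m -> V -> R) :
  open U -> (forall i, Ck k U (f i)) -> Ck k U (fun x => \sum_i f i x).
Proof.
move=> oU hf; elim: m f hf => [|m IH] f hf.
  by apply: eq_Ck (Ck_cst _ _ 0) => // x _; rewrite big_ord0.
have := CkD oU (hf ord0) (IH (fun i => f (lift ord0 i)) (fun i => hf _)).
by apply: eq_Ck => // x _; rewrite big_ord_recl.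
Qed.

Lemma Ck_comp k (U : set V) (W : set R)
    (phi : R -> R) (f : V -> R) :
  open U -> open W -> (forall x, U x -> W (f x)) ->
  Ck k W phi -> Ck k U f -> Ck k U (phi \o f).
Proof.
move=> oU oW UW; elim: k phi f UW => [|k IH] phi f UW.
  by move=> cp cf x Ux; apply: continuous_comp; [exact: cf|exact/cp/UW].
move=> [dp Dp] hf; have [df Df] := hf; split=> [x Ux|v].
  by apply: differentiable_comp; [exact: df x Ux|exact: dp _ (UW _ Ux)].
have := CkM oU (IH _ f UW (Dp 1) (CkS hf)) (Df v).
apply: eq_Ck => // x Ux /=; have dfx := df _ Ux; have dpx := dp _ (UW _ Ux).
rewrite [RHS]deriveE; last exact: differentiable_comp.
by rewrite diff_comp//= diff1E// -deriveE// derive1E mulrC.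
Qed.

End Ck_theory.

(** On the line 'D_v is v times the ordinary derivative, so it suffices to know
    the latter, in whatever form it has been computed. *)
Lemma Ck_R {R : realType} k (U : set R) (f f' : R -> R) :
  open U -> (forall x, U x -> is_derive x 1 f (f' x)) -> Ck k U f' ->
  Ck k.+1 U f.
Proof.
move=> oU df cf'; have dif x : U x -> differentiable f x.
  by move=> Ux; apply/derivable1_diffP; have [] := df _ Ux.
split=> // v; apply: eq_Ck (CkMl v oU cf') => // x Ux.
have dx := dif _ Ux; rewrite deriveE// diff1E// derive1E.
by have := df _ Ux => dfx; rewrite derive_val.
Qed.

Lemma Ck_RE {R : realType} k (U : set R) (f f' : R -> R) :
  open U -> (forall x, U x -> is_derive x 1 f (f' x)) -> Ck k.+1 U f ->
  Ck k U f'.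
Proof.
move=> oU df [_ /(_ 1)]; apply: eq_Ck => // x Ux.
by have := df _ Ux => dfx; rewrite derive_val.
Qed.

Lemma Ck_id {R : realType} k (U : set R) : open U -> Ck k U id.
Proof.
case: k => [|k] oU; first by move=> x _; exact: cvg_id.
by apply: (@Ck_R _ _ _ _ (cst 1)) => //; exact: Ck_cst.
Qed.

Lemma Ck_inv {R : realType} k : Ck k [set x : R | x != 0] GRing.inv.
Proof.
have oU : open [set x : R | x != 0] by exact: open_neq.
elim: k => [|k IH]; first by move=> x /= x0; exact: inv_continuous.
apply: (@Ck_R _ _ _ _ (fun x => - (x^-1 * x^-1))) => //.
  move=> x /= x0; apply: DeriveDef.
    exact/derivable1_diffP/differentiable_Rinv.
  rewrite deriveE; last exact: differentiable_Rinv.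
  by rewrite diff_Rinv//= [_ *: _]mulr1 -expr2 exprVn.
by apply: CkN => //; apply: CkM.
Qed.

Lemma CkV {R : realType} {V : normedModType R} k (U : set V) (f : V -> R) :
  open U -> (forall x, U x -> f x != 0) -> Ck k U f ->
  Ck k U (fun x => (f x)^-1).
Proof.
by move=> oU f0 hf; apply: (Ck_comp oU _ f0 (Ck_inv k) hf); exact: open_neq.
Qed.

Lemma Ck_sqrt {R : realType} k : Ck k [set x : R | 0 < x] Num.sqrt.
Proof.
have oU : open [set x : R | 0 < x] by exact: open_gt.
elim: k => [|k IH]; first by move=> x _; exact: sqrt_continuous.
apply: (@Ck_R _ _ _ _ (fun x => (2 * Num.sqrt x)^-1)) => //.
apply: (@CkV _ _ _ _ (fun x => 2 * Num.sqrt x)) => //; last exact: CkMl.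
by move=> x /= x0; rewrite mulf_neq0// gt_eqF// sqrtr_gt0.
Qed.

Lemma Ck_trig {R : realType} k : Ck k setT (@cos R) /\ Ck k setT (@sin R).
Proof.
have oT : open [set: R] by exact: openT.
elim: k => [|k [IHc IHs]].
  by split=> x _; [exact: continuous_cos|exact: continuous_sin].
split; last exact: (@Ck_R _ _ _ _ cos).
by apply: (@Ck_R _ _ _ _ (fun x => - sin x)) => //; exact: CkN.
Qed.

Lemma Ck_lin {R : realType} {V W : normedModType R} k (U : set W)
    (L : {linear V -> W}) (f : W -> R) :
  continuous L -> Ck k U f -> Ck k (L @^-1` U) (f \o L).
Proof.
move=> cL; elim: k f => [|k IH] f.
  by move=> cf x Ux; apply: continuous_comp; [exact: cL|exact: cf].
move=> [df Df]; split=> [x Ux|v].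
  by apply: differentiable_comp; [exact: linear_differentiable|exact: df _ Ux].
suff -> : 'D_v (f \o L) = 'D_(L v) f \o L by exact: IH (Df _).
by apply/funext => x; rewrite /derive /=; under eq_fun do rewrite linearP.
Qed.

(** * Differential calculus in coordinates and along lines *)

Lemma open_between {R : realType} (a b : R) : open [set x | a < x < b].
Proof.
have -> : [set x | a < x < b] = `]a, b[%classic.
  by apply/seteqP; split => x /=; rewrite in_itv.
exact: interval_open.
Qed.

Lemma near_ballP {R : realType} {V : normedModType R} (P : V -> Prop) (x : V) :
  (\forall y \near x, P y) <->
  exists2 d : R, 0 < d & forall y, `|y - x| < d -> P y.
Proof.
split=> [/nbhs_ballP[d /= d0 dP]|[d d0 dP]].
  by exists d => // y yx; apply: dP; rewrite -ball_normE /= distrC.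
apply/nbhs_ballP; exists d => //= y; rewrite -ball_normE /= distrC; exact: dP.
Qed.

Lemma cont_ballP {R : realType} {V W : normedModType R} (f : V -> W) (x : V) :
  {for x, continuous f} <->
  forall e : R, 0 < e -> exists2 d : R, 0 < d &
    forall y, `|y - x| < d -> `|f y - f x| < e.
Proof.
split=> [/cvgrPdist_lt cf e e0|cf].
  by have /near_ballP[d d0 dP] := cf e e0; exists d => // y /dP; rewrite distrC.
apply/cvgrPdist_lt => e e0; apply/near_ballP.
by have [d d0 dP] := cf e e0; exists d => // y /dP; rewrite distrC.
Qed.

Lemma ex_lt2 {R : realType} (a b : R) : 0 < a -> 0 < b ->
  exists2 t, 0 < t & t < a /\ t < b.
Proof.
move=> a0 b0; have m0 : 0 < Num.min a b by rewrite lt_min a0.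
exists (Num.min a b / 2); first by rewrite divr_gt0.
by apply/andP; rewrite -lt_min ltr_pdivrMr// mulr_natr mulr2n ltrDl.
Qed.

Lemma MVT_der {R : realType} (f df : R -> R) (a b : R) :
  a <= b -> (forall x, a <= x <= b -> is_derive x 1 f (df x)) ->
  exists2 c, a <= c <= b & f b - f a = df c * (b - a).
Proof.
move=> ab dfx.
have cf : {within `[a, b], continuous f}.
  apply: derivable_within_continuous => x; rewrite in_itv /= => xab.
  by have [] := dfx _ xab.
have dfo x : x \in `]a, b[ -> is_derive x 1 f (df x).
  by rewrite in_itv /= => /andP[ax xb]; apply: dfx; rewrite !ltW.
by have [c] := MVT_segment ab dfo cf; rewrite in_itv /=; exists c.
Qed.

Lemma MVT_oo {R : realType} (f df : R -> R) (a b : R) :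
  a < b -> (forall x, a < x < b -> is_derive x 1 f (df x)) ->
  (forall x, a <= x <= b -> {for x, continuous f}) ->
  exists2 c, a < c < b & f b - f a = df c * (b - a).
Proof.
move=> ab dfx cf.
have cf' : {within `[a, b], continuous f}.
  by apply: continuous_in_subspaceT => x; rewrite inE /= in_itv /=; exact: cf.
have dfo x : x \in `]a, b[ -> is_derive x 1 f (df x) by rewrite in_itv; exact: dfx.
by have [c] := MVT ab dfo cf'; rewrite in_itv /=; exists c.
Qed.

Lemma line_quotient {R : realType} {V W : normedModType R} (f : V -> W) (x v : V)
    (s : R) :
  (fun h : R => h^-1 *: (f (x + (h *: 1 + s) *: v) - f (x + s *: v))) =
  (fun h : R => h^-1 *: (f (h *: v + (x + s *: v)) - f (x + s *: v))).
Proof.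
apply/funext => h; congr (_ *: (f _ - _)).
by rewrite [h *: 1]mulr1 scalerDl addrCA.
Qed.

Lemma derive_line {R : realType} {V W : normedModType R} (f : V -> W) (x v : V) (s : R) :
  'D_v f (x + s *: v) = 'D_1 (fun u : R => f (x + u *: v)) s.
Proof. by rewrite /derive /= line_quotient. Qed.

Lemma is_derive_line {R : realType} {V W : normedModType R} (f : V -> W) (x v : V)
    (s : R) :
  derivable f (x + s *: v) v ->
  is_derive s (1 : R) (fun u : R => f (x + u *: v)) ('D_v f (x + s *: v)).
Proof.
move=> df; apply: DeriveDef; last exact/esym/derive_line.
by rewrite /derivable /= line_quotient.
Qed.

Lemma deriveZ_dir {R : realType} {V W : normedModType R} (f : V -> W) (x v : V)
    (c : R) : differentiable f x -> 'D_(c *: v) f x = c *: 'D_v f x.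
Proof. by move=> df; rewrite !deriveE// linearZ. Qed.

Lemma derive_sum_partial {R : realType} {n : nat} (f : 'rV[R]_n -> R) (x v : 'rV[R]_n) :
  differentiable f x -> 'D_v f x = \sum_i v 0 i * partial i f x.
Proof.
move=> df; rewrite deriveE// {1}(row_sum_delta v) linear_sum.
by apply: eq_bigr => i _; rewrite linearZ /partial deriveE.
Qed.

Lemma mx_norm_le {R : realType} {n : nat} (x : 'rV[R]_n) (e : R) : 0 <= e ->
  (forall i, `|x 0 i| <= e) -> `|x| <= e.
Proof.
move=> e0 xe; rewrite [`|x|]mx_normrE; apply/bigmax_leP; split=> // -[i j] _ /=.
by rewrite ord1.
Qed.

Lemma mx_norm_coord {R : realType} {n : nat} (x : 'rV[R]_n) i : `|x 0 i| <= `|x|.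
Proof.
rewrite [`|x|]mx_normrE.
exact: (@le_bigmax _ _ _ 0 (fun i : 'I_1 * 'I_n => `|x i.1 i.2|) (0, i)).
Qed.

(** Exhibits a differential that does not come from the rules of calculus. *)
Lemma differentiable_approx {R : realType} {V W : normedModType R} (f : V -> W)
    (L : {linear V -> W}) (x : V) : continuous L ->
  (forall e, 0 < e -> \forall h \near (0 : V),
    `|f (h + x) - f x - L h| <= e * `|h|) ->
  differentiable f x /\ 'd f x = L :> (V -> W).
Proof.
move=> cL fL.
have E : f \o shift x = cst (f x) + L +o_ 0 id.
  apply/eqaddoP => e e0; have := fL e e0.
  by apply: filter_app; near=> h => /=; rewrite opprD addrA.
split; last exact: diff_unique cL E.
by apply/diff_locallyP; rewrite (diff_unique cL E); split.
Unshelve. all: by end_near. Qed.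

Section partials_differentiable.
Context {R : realType} {n : nat}.
Variables (U : set 'rV[R]_n) (f : 'rV[R]_n -> R).
Hypothesis oU : open U.
Hypothesis df : forall i x, U x -> derivable f x (basis_vec i).
Hypothesis cdf : forall i x, U x -> {for x, continuous (partial i f)}.

Let A (x h : 'rV[R]_n) : R := \sum_i h 0 i * partial i f x.

Let A_linear x : linear (A x).
Proof.
move=> c u v; rewrite /A scaler_sumr -big_split /=; apply: eq_bigr => i _.
by rewrite !mxE mulrDl -mulrA.
Qed.

HB.instance Definition _ x :=
  GRing.isLinear.Build R 'rV[R]_n R _ (A x) (A_linear x).

Let A_continuous x : continuous (A x).
Proof.
apply: (continuous_big (@add_continuous R)) => i _ h.
exact: cvgMr_tmp (@coord_continuous R 1 n 0 i h).
Qed.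

(* The first k coordinates of h, then zeros: a staircase from 0 to h. *)
Let head (h : 'rV[R]_n) (k : nat) : 'rV[R]_n := \row_i (if (i < k)%N then h 0 i else 0).

Let headS h (k : 'I_n) : head h k.+1 = head h k + h 0 k *: basis_vec k.
Proof.
apply/rowP => i; rewrite !mxE eqxx /= ltnS leq_eqVlt -val_eqE /=.
case: eqVneq => [/val_inj ->|ik]; first by rewrite ltnn mulr1 add0r.
by rewrite mulr0 addr0.
Qed.

Let A_approx x e : U x -> 0 < e -> \forall h \near (0 : 'rV[R]_n),
  `|f (h + x) - f x - A x h| <= e * `|h|.
Proof.
move=> Ux e_gt0.
pose e1 := e / n.+1%:R.
have e1_gt0 : 0 < e1 by rewrite divr_gt0.
have N : \forall y \near x, U y /\
    forall i, `|partial i f x - partial i f y| <= e1.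
  near=> y; split; first by near: y; exact: open_nbhs_nbhs.
  near: y; apply: filter_forall => i.
  by have /cvgrPdist_le := @cdf i x Ux; exact.
have [d /= d0 Hd] := (nbhs_ballP _ _).1 N.
have {}Hd y : `|y - x| < d -> U y /\ forall i, `|partial i f x - partial i f y| <= e1.
  by move=> yx; apply: Hd; rewrite -ball_normE /= distrC.
near=> h.
have hd : `|h| < d.
  by near: h; apply/nbhs_ballP; exists d => //= y; rewrite -ball_normE /= sub0r normrN.
have -> : f (h + x) = f (x + head h n).
  by rewrite addrC; congr (f (_ + _)); apply/rowP => i; rewrite !mxE ltn_ord.
have h0 : head h 0 = 0 by apply/rowP => i; rewrite !mxE.
have -> : f (x + head h n) - f x - A x h =
    \sum_(k < n) (f (x + head h k.+1) - f (x + head h k) - h 0 k * partial k f x).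
  rewrite sumrB -(big_mkord xpredT (fun k => f (x + head h k.+1) - f (x + head h k))).
  by rewrite telescope_sumr// h0 addr0.
(* The k-th step of the staircase only moves the k-th coordinate; its points
   stay as close to x as x + h, whence the uniform bound e1. *)
have step (k : 'I_n) : `|f (x + head h k.+1) - f (x + head h k) - h 0 k * partial k f x|
    <= e1 * `|h|.
  pose z u := x + head h k + u *: basis_vec k.
  have zU (u : R) : `|u| <= `|h 0 k| -> `|z u - x| < d.
    move=> uh; apply: le_lt_trans hd; rewrite /z addrAC [x + _]addrC addrK.
    apply: mx_norm_le => // i; rewrite !mxE eqxx /=.
    case: ltnP => [ik|ki].
      rewrite [i == k]negbTE ?mulr0 ?addr0 ?mx_norm_coord//.
      by apply: contraTneq ik => ->; rewrite ltnn.
    rewrite add0r; case: eqVneq => _; last by rewrite mulr0 normr0.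
    by rewrite mulr1; apply: le_trans uh _; exact: mx_norm_coord.
  have zD (u : R) : `|u| <= `|h 0 k| ->
     is_derive (u : R) (1 : R) (fun u => f (z u)) (partial k f (z u)).
    by move=> /zU/Hd[Uz _]; apply: is_derive_line; exact: df.
  have [c ch E] : exists2 c, `|c| <= `|h 0 k| &
      f (z (h 0 k)) - f (z 0) = partial k f (z c) * h 0 k.
    have [hk0|hk0] := leP 0 (h 0 k).
      have zD' u : 0 <= u <= h 0 k ->
          is_derive (u : R) (1 : R) (fun u => f (z u)) (partial k f (z u)).
        by move=> /andP[u0 uh]; apply: zD; rewrite !ger0_norm.
      have [c /andP[c0 ch] ->] := MVT_der hk0 zD'.
      by exists c; rewrite ?subr0// !ger0_norm.
    have zD' u : h 0 k <= u <= 0 ->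
        is_derive (u : R) (1 : R) (fun u => f (z u)) (partial k f (z u)).
      by move=> /andP[u0 uh]; apply: zD; rewrite !ler0_norm ?lerN2// ltW.
    have [c /andP[c0 ch]] := MVT_der (ltW hk0) zD'.
    rewrite sub0r mulrN => E; exists c; first by rewrite !ler0_norm ?lerN2// ltW.
    by rewrite -opprB E opprK.
  rewrite headS addrA -/(z (h 0 k)).
  have -> : f (x + head h k) = f (z 0) by rewrite /z scale0r addr0.
  rewrite E mulrC -mulrBr normrM mulrC ler_pM ?normr_ge0 ?mx_norm_coord//.
  by rewrite distrC; have [_] := Hd _ (zU _ ch); exact.
apply: le_trans (ler_norm_sum _ _ _) _; apply: le_trans (ler_sum _ (fun k _ => step k)) _.
rewrite sumr_const card_ord -mulrnAl ler_wpM2r// /e1 -mulr_natr -mulrA ler_piMr ?(ltW e_gt0)//.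
by rewrite mulrC ler_pdivrMr// mul1r ler_nat.
Unshelve. all: by end_near. Qed.

(** Go from x to x + h one coordinate at a time and apply the mean value theorem
    on each segment: the partial derivatives get evaluated at points that tend
    to x, where they are continuous. *)
Lemma partials_differentiable x : U x -> differentiable f x.
Proof.
move=> Ux; apply: (differentiable_approx (@A_continuous x) _).1 => e.
exact: A_approx.
Qed.

End partials_differentiable.

Lemma iter_partial_rcons {R : realType} {n : nat} (s : seq 'I_n) i
    (f : 'rV[R]_n -> R) :
  iter_partial (rcons s i) f = iter_partial s (partial i f).
Proof. by rewrite /iter_partial foldr_rcons. Qed.

Lemma smooth_on_Ck {R : realType} {n : nat} (U : set 'rV[R]_n) (f : 'rV[R]_n -> R) k :
  open U -> smooth_on U f -> Ck k U f.
Proof.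
move=> oU; elim: k f => [|k IH] f sf; first by move=> x Ux; have [] := sf [::] x Ux.
have sp i : smooth_on U (partial i f).
  by move=> s x Ux; rewrite -iter_partial_rcons; exact: sf.
have df x : U x -> differentiable f x.
  apply: partials_differentiable => // i y Uy; first by have [_] := sf [::] y Uy; exact.
  by have [] := sp i [::] y Uy.
split=> // v.
have := Ck_sum oU (fun i => CkMl (v 0 i) oU (IH _ (sp i))).
by apply: eq_Ck => // x Ux; rewrite derive_sum_partial//; exact: df.
Qed.

Lemma Ck_smooth_on {R : realType} {n : nat} (U : set 'rV[R]_n) (f : 'rV[R]_n -> R) :
  (forall k, Ck k U f) -> smooth_on U f.
Proof.
move=> cf s x Ux.
have H k : Ck k U (iter_partial s f).
  by elim: s k => [//|i s IH] k; have [_ /(_ (basis_vec i))] := IH k.+1.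
have [df _] := H 1%N; split; first exact: H 0%N x Ux.
by move=> i; apply: diff_derivable; exact: df.
Qed.

(** From here on the Hessian only matters through restrictions to lines. *)
Lemma hessianE {R : realType} {n : nat} (U : set 'rV[R]_n) (f : 'rV[R]_n -> R)
    (x v : 'rV[R]_n) : open U -> Ck 2 U f -> U x ->
  (v *m hessian f x *m v^T) 0 0 = 'D_v ('D_v f) x.
Proof.
move=> oU [df Df] Ux.
have E : {near x, (fun y => \sum_i v 0 i * partial i f y) =1 'D_v f}.
  near=> y; have dy : differentiable f y.
    by apply: df; near: y; exact: open_nbhs_nbhs.
  by rewrite /= derive_sum_partial.
rewrite -(near_eq_derive v E).
have dfi i : differentiable (partial i f) x by have [+ _] := Df (basis_vec i); apply.
have -> : (fun y => \sum_i v 0 i * partial i f y) = \sum_i (v 0 i *: partial i f).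
  by apply/funext => y; rewrite fct_sumE.
rewrite derive_sum; last by move=> i; apply: derivableZ; exact: diff_derivable.
rewrite mxE; apply: eq_bigr => i _; rewrite deriveZ; last exact: diff_derivable.
rewrite derive_sum_partial// !mxE mulrC; congr (_ * _).
by apply: eq_bigr => j _; rewrite mxE.
Unshelve. all: by end_near. Qed.

Lemma rV_cvg {R : realType} {T : Type} {F : set_system T} {FF : Filter F} {m : nat}
    (c : T -> 'rV[R]_m) (l : 'rV[R]_m) :
  (forall i, c x 0 i @[x --> F] --> l 0 i) -> c @ F --> l.
Proof.
move=> cl; apply/cvgrPdist_le => e e0; near=> x.
apply: mx_norm_le; first exact: ltW.
move=> i; rewrite !mxE; move: i; near: x; apply: filter_forall => i.
by have /cvgrPdist_le := cl i; exact.
Unshelve. all: by end_near. Qed.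

Lemma Ck_curve {R : realType} {V : normedModType R} {m : nat} k (U : set V)
    (W : set 'rV[R]_m) (f : 'rV[R]_m -> R) (c : V -> 'rV[R]_m) :
  open U -> open W -> (forall x, U x -> W (c x)) ->
  Ck k W f -> (forall i, Ck k U (fun x => c x 0 i)) -> Ck k U (f \o c).
Proof.
move=> oU oW UW; elim: k f UW => [|k IH] f UW cf cc.
  move=> x Ux; apply: continuous_comp; last exact/cf/UW.
  by apply: rV_cvg => i; exact: cc.
have dc x : U x -> differentiable c x.
  move=> Ux; have -> : c = \sum_i (fun x => c x 0 i *: basis_vec i).
    by apply/funext => y; rewrite fct_sumE {1}(row_sum_delta (c y)).
  apply: differentiable_sum => i; apply: differentiableZl; have [+ _] := cc i; exact.
have [df Df] := cf; split=> [x Ux|v].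
  by apply: differentiable_comp; [exact: dc|exact: df (UW _ Ux)].
have := Ck_sum oU (fun i => CkM oU ((cc i).2 v) (IH _ UW (Df (basis_vec i)) (fun i => CkS (cc i)))).
apply: eq_Ck => // x Ux /=.
have dcx := dc _ Ux; have dfx := df _ (UW _ Ux).
rewrite [RHS]deriveE; last exact: differentiable_comp.
rewrite diff_comp//= -deriveE// derive_sum_partial// -deriveE//.
apply: eq_bigr => i _; congr (_ * _).
rewrite derive_mx ?mxE//; exact: diff_derivable.
Qed.

(** As q vanishes at x and grows at most linearly, replacing m by its value at x
    costs o(|h|): continuity of m is enough. This handles m * q where m is a
    difference quotient about which nothing more is known. *)
Lemma differentiable_Mvanish {R : realType} {V : normedModType R} (m q : V -> R)
    (x : V) : {for x, continuous m} -> differentiable q x -> q x = 0 ->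
  differentiable (fun y => m y * q y) x /\
  forall v, 'D_v (fun y => m y * q y) x = m x * 'D_v q x.
Proof.
move=> /cont_ballP cm dq q0.
pose L : {linear V -> R} := m x \*: ('d q x : {linear V -> R}).
have cdq : continuous ('d q x) by exact: diff_continuous.
have cL : continuous L by move=> y; apply: cvgZl_tmp; exact: cdq.
suff H e : 0 < e -> \forall h \near (0 : V),
    `|m (h + x) * q (h + x) - m x * q x - L h| <= e * `|h|.
  have [d1 d2] := @differentiable_approx _ _ _ (fun y => m y * q y) L x cL H.
  by split=> // v; rewrite deriveE// d2 deriveE.
move=> e0.
have [C C0 HC] := linear_lipschitz cdq.
have [d d0 Hd] := cm _ (divr_gt0 (divr_gt0 e0 (ltr0n R 2)) (addr_gt0 C0 ltr01)).
pose M := `|m x| + 1; have M0 : 0 < M by rewrite ltr_wpDl.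
pose eta := Num.min 1 (e / 2 / M).
have eta0 : 0 < eta by rewrite lt_min ltr01 !divr_gt0.
have := diff_locally dq => /eqaddoP/(_ eta eta0)/near_ballP[d' d'0 Hd'].
apply/near_ballP; exists (Num.min d d'); first by rewrite lt_min d0.
move=> h; rewrite subr0 lt_min => /andP[hd hd'].
have qh : `|q (h + x) - 'd q x h| <= eta * `|h|.
  by have := Hd' h; rewrite subr0 => /(_ hd'); rewrite !fctE /= q0 add0r.
have mh : `|m (h + x) - m x| < e / 2 / (C + 1) by apply: Hd; rewrite addrK.
have qh2 : `|q (h + x)| <= (C + 1) * `|h|.
  rewrite -(subrK ('d q x h) (q (h + x))) (le_trans (ler_normD _ _))//.
  rewrite addrC mulrDl lerD ?HC//; apply: le_trans qh _.
  by rewrite ler_wpM2r// /eta ge_min lexx.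
have -> : m (h + x) * q (h + x) - m x * q x - L h =
    (m (h + x) - m x) * q (h + x) + m x * (q (h + x) - 'd q x h).
  have -> : L h = m x * 'd q x h by [].
  by rewrite q0 mulr0 subr0 mulrBl mulrBr addrA subrK.
rewrite (le_trans (ler_normD _ _))// !normrM [e]splitr mulrDl lerD//.
  apply: le_trans (ler_pM (normr_ge0 _) (normr_ge0 _) (ltW mh) qh2) _.
  by rewrite mulrA divfK ?gt_eqF// addr_gt0.
apply: le_trans (ler_wpM2l (normr_ge0 _) qh) _.
rewrite mulrA ler_wpM2r//.
have : `|m x| * eta <= M * (e / 2 / M).
  apply: ler_pM => //; first exact: ltW.
    by rewrite /M lerDl.
  by rewrite /eta ge_min lexx orbT.
by move/le_trans; apply; rewrite mulrC divfK ?gt_eqF.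
Qed.

Section one_variable.
Context {R : realType}.
Implicit Types (f g : R -> R) (x a b c : R).

Lemma derE f x a b : is_derive x (1 : R) f a -> a = b -> is_derive x (1 : R) f b.
Proof. by move=> df <-. Qed.

Lemma derD f g x a b : is_derive x (1 : R) f a -> is_derive x (1 : R) g b ->
  is_derive x (1 : R) (fun t => f t + g t) (a + b).
Proof. by move=> df dg; exact: is_deriveD. Qed.

Lemma derB f g x a b : is_derive x (1 : R) f a -> is_derive x (1 : R) g b ->
  is_derive x (1 : R) (fun t => f t - g t) (a - b).
Proof. by move=> df dg; exact: is_deriveB. Qed.

Lemma derN f x a : is_derive x (1 : R) f a ->
  is_derive x (1 : R) (fun t => - f t) (- a).
Proof. by move=> df; exact: is_deriveN. Qed.

Lemma derM f g x a b : is_derive x (1 : R) f a -> is_derive x (1 : R) g b ->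
  is_derive x (1 : R) (fun t => f t * g t) (a * g x + f x * b).
Proof.
move=> df dg; have := is_deriveM df dg => h; apply: (is_derive_eq h).
by rewrite addrC; congr (_ + _); exact: mulrC.
Qed.

Lemma derC x c : is_derive x (1 : R) (fun=> c) 0.
Proof. exact: is_derive_cst. Qed.

Lemma derMl f x c a : is_derive x (1 : R) f a ->
  is_derive x (1 : R) (fun t => c * f t) (c * a).
Proof.
move=> df; apply: derE (derM (derC x c) df) _.
by rewrite mul0r add0r.
Qed.

Lemma derX x : is_derive x (1 : R) (fun t => t) 1.
Proof. exact: is_derive_id. Qed.

Lemma derV f x a : f x != 0 -> is_derive x (1 : R) f a ->
  is_derive x (1 : R) (fun t => (f t)^-1) (- (f x) ^- 2 * a).
Proof.
move=> fx [df dfa]; apply: DeriveDef; first exact: derivableV.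
by rewrite deriveV// dfa.
Qed.

Lemma der_comp f g x a b : is_derive (g x) (1 : R) f a -> is_derive x (1 : R) g b ->
  is_derive x (1 : R) (fun t => f (g t)) (a * b).
Proof. by move=> df dg; exact: is_derive1_comp. Qed.

Lemma der_exp n x : is_derive x (1 : R) (fun t => t ^+ n) (n%:R * x ^+ n.-1).
Proof.
apply: DeriveDef; first exact: exprn_derivable.
by rewrite exp_derive; exact: mulr1.
Qed.

Lemma der_cont f x a : is_derive x (1 : R) f a -> {for x, continuous f}.
Proof. by move=> [df _]; exact/differentiable_continuous/derivable1_diffP. Qed.

Lemma der_derive1 f x : differentiable f x -> is_derive x (1 : R) f (derive1 f x).
Proof. by move=> df; rewrite derive1E; apply: derivableP; apply: diff_derivable. Qed.

Lemma der_unique f x a b : is_derive x (1 : R) f a -> is_derive x (1 : R) f b -> a = b.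
Proof. by move=> [_ <-] [_ <-]. Qed.

Lemma der_neq0 f f' a b : (forall x, is_derive x (1 : R) f (f' x)) ->
  f a != f b -> exists x, f' x != 0.
Proof.
move=> df fab; apply: contrapT => H; case/eqP: fab.
apply: is_derive_0_is_cst => t; apply: derE (df t) _.
by apply/eqP/negPn/negP => h; apply: H; exists t.
Qed.

End one_variable.

(** * Division of a smooth function by the variable *)

Section division.
Context {R : realType}.
Variable r : R.
Hypothesis r_gt0 : 0 < r.
Let U : set R := [set x | - r < x < r].

Let oU : open U. Proof. exact: open_between. Qed.

Let U0 : U 0. Proof. by rewrite /U /= r_gt0 oppr_lt0 r_gt0. Qed.

(** The function B is x^-(m+1) * int_0^x t^m w t dt, a weighted mean of w up to
    the factor m + 1. It is characterised by the differential equation x B' = w - (m + 1) B and by its behaviour at 0,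
    so that no integral appears. Its derivative is the same function of w' with
    m + 1 in place of m, which allows induction on the order of smoothness. *)
Definition rdiv_rel (m : nat) (w B : R -> R) :=
  [/\ {for 0, continuous (fun x : R => x * B x)}, m.+1%:R * B 0 = w 0 &
   forall x : R, U x -> x != 0 -> is_derive x (1 : R) B (x^-1 * (w x - m.+1%:R * B x))].

(** A mean of w is a value of w: Rolle's theorem on [0, 1] for
    s |-> s^(m+1) (B (s x) - B x), which vanishes at both ends. *)
Lemma rdiv_mean m w B x : rdiv_rel m w B -> U x ->
  exists2 y, `|y| <= `|x| & m.+1%:R * B x = w y.
Proof.
move=> [cB B0 dB] Ux; have [->|x0] := eqVneq x 0; first by exists 0.
have Us (s : R) : 0 <= s <= 1 -> U (s * x).
  move=> /andP[s0 s1]; rewrite /U /= -ltr_norml normrM (ger0_norm s0).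
  by apply: le_lt_trans (_ : `|x| < r); rewrite ?ltr_norml// ler_piMl.
pose g (s : R) := s ^+ m.+1 * (B (s * x) - B x).
have dg (s : R) : 0 < s <= 1 ->
    is_derive s (1 : R) g (s ^+ m * (w (s * x) - m.+1%:R * B x)).
  move=> /andP[s0 s1].
  have sx0 : s * x != 0 by apply: mulf_neq0 => //; exact: lt0r_neq0.
  have Usx : U (s * x) by apply: Us; rewrite ltW.
  have dc := @der_comp _ B (fun u => u * x) _ _ _ (dB _ Usx sx0) (derM (derX s) (derC s x)).
  apply: derE (derM (der_exp m.+1 s) (derB dc (derC s (B x)))) _ => /=.
  rewrite [s ^+ m.+1]exprS.
  move: sx0; rewrite mulf_eq0 => /norP[s0' _]; field; exact/andP.
have cg (s : R) : 0 <= s <= 1 -> {for s, continuous g}.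
  move=> /andP[s0 s1]; have [s_gt0|] := ltP 0 s.
    by apply: der_cont (dg _ _); rewrite s_gt0.
  move=> s_le0; have -> : s = 0 by apply/le_anti; rewrite s_le0.
  have -> : g = (fun s => s ^+ m * (x^-1 * ((s * x) * B (s * x)) - s * B x)).
    by apply/funext => u; rewrite /g exprSr; field.
  have sx0 : u * x @[u --> (0 : R)] --> (0 : R).
    rewrite -[X in _ --> X](mul0r x).
    exact: (der_cont (f := fun u => u * x) (derM (derX 0) (derC 0 x))).
  apply: cvgM; first exact: der_cont (der_exp m 0).
  apply: cvgB; last exact: der_cont (derM (derX 0) (derC 0 (B x))).
  apply: cvgMl_tmp; apply: (@cvg_comp _ _ _ (fun u : R => u * x) (fun t => t * B t)) sx0 _.
  by rewrite mul0r; exact: cB.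
have dg' (s : R) : 0 < s < 1 ->
    is_derive s (1 : R) g (s ^+ m * (w (s * x) - m.+1%:R * B x)).
  by move=> /andP[s0 s1]; apply: dg; rewrite s0 ltW.
have [c /andP[c0 c1]] := MVT_oo ltr01 dg' cg.
have -> : g 1 - g 0 = 0 by rewrite /g mul1r subrr mulr0 expr0n mul0r subr0.
rewrite subr0 mulr1 => /esym/eqP; rewrite mulf_eq0 expf_eq0 gt_eqF// andbF/= subr_eq0.
move=> /eqP E; exists (c * x); last by [].
by rewrite normrM (gtr0_norm c0) ler_piMl// ltW.
Qed.

Lemma rdiv_cont m w B : {for 0, continuous w} -> rdiv_rel m w B -> {for 0, continuous B}.
Proof.
move=> /cont_ballP cw h; have [_ B0 _] := h; apply/cont_ballP => e e0.
have [d d0 Hd] := cw e e0.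
exists (Num.min d r); first by rewrite lt_min d0.
move=> x; rewrite subr0 lt_min => /andP[xd xr].
have [|y yx E] := rdiv_mean h (_ : U x); first by rewrite /U /= -ltr_norml.
have : `|w y - w 0| < e by apply: Hd; rewrite subr0; exact: le_lt_trans yx xd.
rewrite -E -B0 -mulrBr normrM; apply: le_lt_trans.
by rewrite ger0_norm// ler_peMl// ler1n.
Qed.

(** Differentiate x B' = w - (m + 1) B. At 0 the equation does not determine B';
    the value w' 0 / (m + 2) is the one that makes it continuous. *)
Lemma rdiv_step m w w' B :
  (forall x, U x -> is_derive x (1 : R) w (w' x)) ->
  (forall x, U x -> {for x, continuous w'}) ->
  rdiv_rel m w B -> exists B', rdiv_rel m.+1 w' B' /\ (forall x, U x -> is_derive x (1 : R) B (B' x)).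
Proof.
move=> dw cw' h; have [cB B0 dB] := h.
pose B' x := if x == 0 then w' 0 / m.+2%:R else x^-1 * (w x - m.+1%:R * B x).
have cw0 : {for 0, continuous w}.
  by apply/differentiable_continuous/derivable1_diffP; have [] := dw 0 U0.
have E x : m.+1%:R * B x = w x - x * B' x.
  rewrite /B'; case: eqVneq => [->|x0]; first by rewrite B0 mul0r subr0.
  by rewrite mulrA divff// mul1r opprB addrCA subrr addr0.
have h' : rdiv_rel m.+1 w' B'.
  split; last 2 first.
  - by rewrite /B' eqxx mulrC divfK.
  - move=> x Ux x0; have dBx := dB x Ux x0; have dwx := dw x Ux.
    have EB : \near x, x^-1 * (w x - m.+1%:R * B x) = B' x.
      near=> y; rewrite /B' ifF//; apply/negbTE; near: y.
      by apply: open_nbhs_nbhs; split=> //; exact: open_neq.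
    apply: near_eq_is_derive EB _.
    apply: derE (derM (derV x0 (derX x)) (derB dwx (derMl _ dBx))) _.
    by rewrite /B' (negbTE x0); field.
  have -> : (fun x => x * B' x) = (fun x => w x - m.+1%:R * B x).
    by apply/funext => x; rewrite E opprB addrCA subrr addr0.
  apply: cvgB; first exact: cw0.
  by apply: cvgMl_tmp; exact: rdiv_cont h.
exists B'; split=> // x Ux; have [->|x0] := eqVneq x 0; last first.
  by rewrite /B' (negbTE x0); exact: dB.
have cB' := rdiv_cont (cw' _ U0) h'.
have d0 : is_derive (0 : R) 1 (fun x => x * B' x) (B' 0).
  by apply/is_derive1_caratheodory; exists B'; split=> // z; rewrite mul0r !subr0 mulrC.
have dw0 := dw _ U0.
have -> : B = (fun x => m.+1%:R^-1 * (w x - x * B' x)).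
  by apply/funext => y; rewrite -E mulrA mulVf// mul1r.
apply: derE (derMl _ (derB dw0 d0)) _; rewrite /B' eqxx.
have m2 : m.+2%:R != 0 :> R by rewrite pnatr_eq0.
have m1 : m.+1%:R != 0 :> R by rewrite pnatr_eq0.
rewrite -natr1 in m2 *; set a := m.+1%:R in m1 m2 *.
by field; apply/andP.
Unshelve. all: by end_near. Qed.

Lemma rdiv_Ck k m w B : Ck k.+1 U w -> rdiv_rel m w B -> Ck k U B.
Proof.
elim: k m w B => [|k IH] m w B cw h.
  move=> x Ux; have [->|x0] := eqVneq x 0.
    by apply: rdiv_cont h; apply: Ck_cont cw _ _.
  case: h => _ _ /(_ x Ux x0) [dB _].
  exact/differentiable_continuous/derivable1_diffP.
have dw x : U x -> is_derive x (1 : R) w (derive1 w x).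
  move=> Ux; rewrite derive1E; apply: derivableP; apply: diff_derivable.
  by case: cw => + _; exact.
have cw' : Ck k.+1 U (derive1 w) by exact: Ck_RE dw cw.
have [B' [h' dB]] := rdiv_step dw (Ck_cont cw') h.
exact: (Ck_R oU dB (IH _ _ _ cw' h')).
Qed.

(** Hadamard's lemma. The quotient of f by x is the mean of f' over [0, x], that
    is, the case m = 0 of [rdiv_rel], and so it is as smooth as f'. *)
Lemma smooth_divX (f : R -> R) : (forall k, Ck k U f) -> f 0 = 0 ->
  exists2 q : R -> R, forall k, Ck k U q & forall x, f x = x * q x.
Proof.
move=> cf f0.
have df x : U x -> is_derive x (1 : R) f (derive1 f x).
  move=> Ux; rewrite derive1E; apply: derivableP; apply: diff_derivable.
  by case: (cf 1%N) => + _; exact.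
pose q x := if x == 0 then derive1 f 0 else x^-1 * f x.
have qE x : f x = x * q x.
  rewrite /q; case: eqVneq => [->|x0]; first by rewrite f0 mul0r.
  by rewrite mulrA divff// mul1r.
exists q => // k; apply: (@rdiv_Ck k 0 (derive1 f) q); first exact: Ck_RE df (cf _).
split; last 2 first.
- by rewrite mul1r /q eqxx.
- move=> x Ux x0; have dfx := df x Ux.
  have EB : \near x, x^-1 * f x = q x.
    near=> y; rewrite /q ifF//; apply/negbTE; near: y.
    by apply: open_nbhs_nbhs; split=> //; exact: open_neq.
  apply: near_eq_is_derive EB _.
  apply: derE (derM (derV x0 (derX x)) dfx) _.
  by rewrite mul1r qE; field.
have -> : (fun x => x * q x) = f by apply/funext => x; rewrite -qE.
by apply: Ck_cont (cf 0%N) _ _.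
Unshelve. all: by end_near. Qed.

End division.

(** * Smooth functions of an arc cosine *)

Section even_periodic.
Context {R : realType}.
Notation pi := (@pi R).

Definition oval (r : R) : set R := [set x | - r < x < r].

Lemma open_oval r : open (oval r).
Proof. exact: open_between. Qed.

Lemma oval_pi0 : oval pi 0.
Proof. by rewrite /oval /= pi_gt0 oppr_lt0 pi_gt0. Qed.

Lemma oval_opp r x : oval r x -> oval r (- x).
Proof. by move=> /andP[a b]; apply/andP; rewrite ltrN2 ltrNl. Qed.

Lemma sin_oval_neq0 x : oval pi x -> x != 0 -> sin x != 0.
Proof.
move=> /andP[a b] x0; have [xp|xn] := ltP 0 x.
  by rewrite gt_eqF// sin_gt0_pi// xp.
rewrite -oppr_eq0 -sinN gt_eqF// sin_gt0_pi// oppr_gt0 lt_neqAle x0 xn /=.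
by rewrite ltrNl.
Qed.

(** Both f and sin vanish at 0 and can be divided by x; the quotient of sin by x
    has no zero on ]-pi, pi[, so the quotients can be divided in turn. *)
Lemma odd_factor (f : R -> R) : (forall n, Ck n (oval pi) f) ->
  (forall x, oval pi x -> f (- x) = - f x) ->
  exists A : R -> R, [/\ forall n, Ck n (oval pi) A,
    forall x, oval pi x -> A (- x) = A x &
    forall x, oval pi x -> f x = sin x * A x].
Proof.
move=> cf of_.
have f0 : f 0 = 0.
  by have /eqP := of_ 0 oval_pi0; rewrite oppr0 -addr_eq0 -mulr2n mulrn_eq0 => /eqP.
have [q cq fq] := smooth_divX (pi_gt0 R) cf f0.
have [S cS sS] := smooth_divX (pi_gt0 R) (fun n => sub_Ck (@subsetT _ _) (Ck_trig n).2) (@sin0 R).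
have S0 x : oval pi x -> S x != 0.
  move=> Ux; have [->|x0] := eqVneq x 0; last first.
    by apply: contraNneq (sin_oval_neq0 Ux x0) => Sx; rewrite sS Sx mulr0.
  suff -> : S 0 = 1 by rewrite oner_eq0.
  have dS : is_derive (0 : R) (1 : R) S (derive1 S 0).
    by apply: der_derive1; case: (cS 1%N) => + _; apply; exact: oval_pi0.
  have := derM (derX 0) dS; have -> : (fun t => t * S t) = sin by apply/funext => t.
  by move/(der_unique (is_derive_sin 0)); rewrite cos0 mul1r mul0r addr0.
exists (fun x => q x * (S x)^-1); split.
- by move=> n; apply: CkM => //; [exact: open_oval|apply: CkV => //; exact: open_oval].
- move=> x Ux; have [->|x0] := eqVneq x 0; first by rewrite oppr0.
  have := of_ x Ux; rewrite !fq mulNr => /oppr_inj/(mulfI x0) ->.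
  by have := sinN x; rewrite !sS mulNr => /oppr_inj/(mulfI x0) ->.
- by move=> x Ux; rewrite fq sS; have Sx := S0 x Ux; field.
Qed.

Definition evper : set R := [set x | - pi < x < pi *+ 2].

(** What matters of a smooth, even and 2 pi-periodic function in the
    neighbourhood of [0, pi]. *)
Record even_per (k : R -> R) : Prop := EvenPer {
  even_per0 : forall x, oval pi x -> k (- x) = k x;
  even_perpi : forall x, oval pi x -> k (pi - x) = k (pi + x);
  even_perC : forall n, Ck n evper k }.

Lemma open_evper : open evper.
Proof. exact: open_between. Qed.

Lemma oval_evper x : oval pi x -> evper x.
Proof.
move=> /andP[a b]; apply/andP; split=> //; apply: lt_trans b _.
by rewrite mulr2n ltrDl pi_gt0.
Qed.

Lemma ovalD_evper x : oval pi x -> evper (pi + x).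
Proof.
move=> /andP[a b]; rewrite /evper /= mulr2n ltrD2l b andbT.
by move: a (pi_gt0 R); lra.
Qed.

Lemma derive1_odd (f : R -> R) : (forall x, oval pi x -> differentiable f x) ->
  (forall x, oval pi x -> f (- x) = f x) ->
  forall x, oval pi x -> derive1 f (- x) = - derive1 f x.
Proof.
move=> df ef x Ux; have dx := der_derive1 (df _ Ux).
have dxN := der_derive1 (df _ (oval_opp Ux)).
have := @der_comp _ f -%R x _ _ dxN (derN (derX x)).
have E : \near x, f (- x) = f x.
  near=> y; apply: ef; near: y; apply: open_nbhs_nbhs; split=> //; exact: open_oval.
by move/(near_eq_is_derive E)/(der_unique dx) => ->; rewrite mulrN1 opprK.
Unshelve. all: by end_near. Qed.

(** Since k is even about 0 and about pi, k' is odd about both points and sin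
    divides it smoothly. By the chain rule (k o acos)' = k1 o acos, where k1 is
    even about both points again: iterating, k o acos has derivatives of all
    orders up to the endpoints -1 and 1. *)
Lemma even_per_factor (k : R -> R) : even_per k ->
  exists k1, even_per k1 /\
    forall x, evper x -> is_derive x (1 : R) k (- (sin x * k1 x)).
Proof.
move=> [k0 kpi kC].
have dk x : evper x -> is_derive x (1 : R) k (derive1 k x).
  by move=> Ux; apply: der_derive1; case: (kC 1%N) => + _; exact.
have kC' n : Ck n evper (derive1 k) by exact: Ck_RE open_evper dk (kC _).
have dkd x : evper x -> differentiable k x.
  by move=> Ux; apply/derivable1_diffP; have [] := dk x Ux.
pose kt x := k (pi + x).
have cshift n (U : set R) (c : R) : open U -> Ck n U (fun x => c + x).
  by move=> oU; apply: CkD => //; [exact: Ck_cst|exact: Ck_id].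
have dkt x : oval pi x -> is_derive x (1 : R) kt (derive1 k (pi + x)).
  move=> Ux; apply: derE (der_comp (dk _ (ovalD_evper Ux)) (derD (derC x pi) (derX x))) _.
  by rewrite add0r mulr1.
have [A [cA eA fA]] : exists A : R -> R, [/\ forall n, Ck n (oval pi) A,
    forall x, oval pi x -> A (- x) = A x &
    forall x, oval pi x -> derive1 k x = sin x * A x].
  apply: odd_factor; first by move=> n; apply: sub_Ck (kC' n) => x; exact: oval_evper.
  by apply: derive1_odd => // x Ux; apply: dkd; exact: oval_evper.
have [B [cB eB fB]] : exists A : R -> R, [/\ forall n, Ck n (oval pi) A,
    forall x, oval pi x -> A (- x) = A x &
    forall x, oval pi x -> derive1 kt x = sin x * A x].
  apply: odd_factor.
    move=> n.
    have := Ck_comp (@open_oval pi) open_evper ovalD_evper (kC' n) (cshift n _ pi (@open_oval _)).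
    apply: eq_Ck; first exact: open_oval.
    by move=> x Ux /=; rewrite [RHS]derive1E; case: (dkt x Ux) => _ ->.
  apply: derive1_odd => [x Ux|x Ux]; last by rewrite /kt kpi.
  by apply/derivable1_diffP; have [] := dkt x Ux.
(* The factorisations about 0 and about pi agree on ]0, pi[, where sin does not
   vanish; any threshold between 0 and pi will do. *)
pose k1 x := if x < 1 then - A x else B (x - pi).
have pi1 : 1 < pi by apply: lt_le_trans (pi_ge2 R); rewrite ltr1n.
have sub_oval x : 0 < x -> evper x -> oval pi (x - pi).
  by rewrite /evper /oval /= mulr2n => x0 /andP[_ b]; lra.
have AB x : 0 < x < pi -> B (x - pi) = - A x.
  move=> /andP[x0 xpi]; have Ux : oval pi x by rewrite /oval /=; lra.
  have Uxp := sub_oval x x0 (oval_evper Ux).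
  have := fB _ Uxp; rewrite derive1E; case: (dkt _ Uxp) => _ ->.
  rewrite addrC subrK fA// sinB cospi sinpi mulr0 subr0 mulrN1 mulNr -mulrN.
  by move=> /mulfI -> //; rewrite ?opprK// gt_eqF// sin_gt0_pi// x0.
have k1A x : oval pi x -> k1 x = - A x.
  move=> Ux; rewrite /k1; case: ltP => // x1.
  by apply: AB; move: Ux => /andP[_ ->]; rewrite andbT; apply: lt_le_trans x1.
have k1B x : 0 < x -> evper x -> k1 x = B (x - pi).
  move=> x0 Ux; rewrite /k1; case: ltP => // x1.
  by rewrite AB// x0 (lt_trans x1).
have or x : evper x -> oval pi x \/ 0 < x.
  move=> /andP[a b]; have [x0|x0] := ltP 0 x; [by right|left].
  by rewrite /oval /= a (le_lt_trans x0)// pi_gt0.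
exists k1; split.
  split.
  - by move=> x Ux; rewrite !k1A ?eA//; exact: oval_opp.
  - move=> x Ux; have /andP[a b] := Ux.
    rewrite !k1B ?[pi + _]addrC ?addrK ?eB//; try (by rewrite -?ltrBlDr ?sub0r; lra).
      by rewrite addrC; exact: ovalD_evper.
    by rewrite addrC; apply: ovalD_evper; exact: oval_opp.
  - move=> n; apply: Ck_local => x Ux; case: (or x Ux) => [Uo|x0].
      exists (oval pi) => //; apply: eq_Ck (CkN (@open_oval _) (cA n)) => //.
        exact: open_oval.
      by move=> y /k1A.
    have oW : open [set x : R | 0 < x < pi *+ 2] by exact: open_between.
    exists [set x | 0 < x < pi *+ 2]; first by move: Ux => /andP[_ b] /=; rewrite x0.
    have ev y : 0 < y < pi *+ 2 -> evper y.
      by move=> /andP[y0 b]; rewrite /evper /= b (lt_trans _ y0)// oppr_lt0 pi_gt0.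
    have WO y : 0 < y < pi *+ 2 -> oval pi (- pi + y).
      by move=> yU; rewrite addrC; apply: sub_oval (ev _ yU); case/andP: yU.
    have := Ck_comp oW (@open_oval pi) WO (cB n) (cshift n _ (- pi) oW).
    apply: eq_Ck => // y /= yU; have /andP[y0 _] := yU.
    by rewrite (addrC (- pi)) k1B//; exact: ev.
move=> x Ux; apply: derE (dk x Ux) _; case: (or x Ux) => [Uo|x0].
  by rewrite fA// k1A// mulrN opprK.
have Uxp := sub_oval x x0 Ux; rewrite k1B//.
have := fB _ Uxp; rewrite derive1E; case: (dkt _ Uxp) => _ ->.
by rewrite addrC subrK => ->; rewrite sinB cospi sinpi mulr0 subr0 mulrN1 mulNr.
Qed.

Lemma acos_eps v e : -1 <= v <= 1 -> 0 < e -> exists2 d : R, 0 < d &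
  forall u, -1 <= u <= 1 -> `|u - v| < d -> `|acos u - acos v| < e.
Proof.
move=> v1 e0.
have ca : {within `[(@cos R pi), cos 0], continuous (@acos R)}.
  apply: segment_can_ge_continuous; first exact: pi_ge0.
    by apply: continuous_subspaceT; exact: continuous_cos.
  by move=> x; exact: cosK.
rewrite cos0 cospi in ca.
have /subspace_continuousP/(_ v) := ca; rewrite /= in_itv /= => /(_ v1).
move=> /cvgrPdist_lt/(_ e e0) H.
have {H} : \forall u \near v, `[-1, 1]%classic u -> `|acos v - acos u| < e by exact: H.
move=> /near_ballP[d d0 dP]; exists d => // u u1 uv.
by rewrite distrC; apply: dP => //=; rewrite in_itv.
Qed.

(** Cauchy's mean value theorem for k and cos between acos u and acos v: in the
    quotient of the derivatives the factor sin cancels. *)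
Lemma acos_slope k k1 u v :
  (forall x, evper x -> is_derive x (1 : R) k (- (sin x * k1 x))) ->
  -1 <= u <= 1 -> -1 <= v <= 1 ->
  exists y, [/\ `|y - acos v| <= `|acos u - acos v|, `|y - acos u| <= `|acos u - acos v| &
   k (acos u) - k (acos v) = k1 y * (u - v)].
Proof.
move=> dk; wlog uv : u v / acos u < acos v.
  move=> W u1 v1; have [uv|vu|E] := ltgtP (acos u) (acos v).
  - exact: W.
  - have [y [yu yv ky]] := W v u vu v1 u1; exists y.
    by split; rewrite 1?(distrC (acos u))// -opprB ky -mulrN opprB.
  - exists (acos v); rewrite E subrr normr0; split=> //.
    by rewrite subrr -[u]acosK ?in_itv// E acosK ?in_itv// subrr mulr0.
move=> u1 v1; set a := acos u in uv *; set b := acos v in uv *.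
have a0 : 0 <= a by exact: acos_ge0.
have bpi : b <= pi by exact: acos_lepi.
have ca : cos a = u by rewrite acosK ?in_itv.
have cb : cos b = v by rewrite acosK ?in_itv.
pose h t := k t * (u - v) - cos t * (k a - k b).
have dh t : a <= t <= b -> is_derive t (1 : R) h (sin t * (k a - k b - k1 t * (u - v))).
  move=> /andP[at_ tb].
  have evt : evper t by have := pi_gt0 R; rewrite /evper /= mulr2n; lra.
  apply: derE (derB (derM (dk t evt) (derC t _)) (derM (is_derive_cos t) (derC t _))) _.
  ring.
have ch t : a <= t <= b -> {for t, continuous h} by move=> /dh/der_cont.
have dh' t : a < t < b -> is_derive t (1 : R) h (sin t * (k a - k b - k1 t * (u - v))).
  by move=> /andP[at_ tb]; apply: dh; rewrite !ltW.
have [c /andP[ac cb'] /eqP] := MVT_oo uv dh' ch.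
have -> : h b - h a = 0 by rewrite /h ca cb; ring.
rewrite eq_sym !mulf_eq0 [b - a == 0]subr_eq0 [b == a]gt_eqF// orbF gt_eqF/=; last first.
  by apply: sin_gt0_pi; apply/andP; split; lra.
rewrite subr_eq0 => /eqP E; exists c; split=> //.
  by rewrite !ler0_norm ?subr_le0 ?(ltW cb') ?(ltW uv)// lerN2 lerD2r ltW.
rewrite ger0_norm ?subr_ge0 ?(ltW ac)// ler0_norm ?subr_le0 ?(ltW uv)//.
by rewrite opprB lerD2r ltW.
Qed.

(** Where q reaches -1 or 1 the function acos o q need not be differentiable,
    but [acos_slope] shows that k (acos q) has the differential
    k1 (acos q) * dq, with k1 of the same kind as k. *)
Lemma Ck_acos {V : normedModType R} n (U : set V) (k : R -> R) (q : V -> R) :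
  open U -> even_per k -> Ck n.+1 U q -> (forall x, U x -> -1 <= q x <= 1) ->
  Ck n U (fun x => k (acos (q x))).
Proof.
move=> oU ek cq q1.
suff H k' k1 : even_per k1 ->
    (forall x, evper x -> is_derive x (1 : R) k' (- (sin x * k1 x))) -> forall x, U x ->
    differentiable (fun x => k' (acos (q x))) x /\
    forall v, 'D_v (fun x => k' (acos (q x))) x = k1 (acos (q x)) * 'D_v q x.
  elim: n k ek cq => [|n IH] k ek cq; have [k1 [ek1 dk]] := even_per_factor ek.
    move=> x Ux; apply: differentiable_continuous; have [+ _] := H k k1 ek1 dk x Ux; exact.
  have cq' := CkS cq.
  split=> [x Ux|v]; first by have [+ _] := H k k1 ek1 dk x Ux; exact.
  have cqv : Ck n.+1 U ('D_v q) := cq.2 v.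
  have := CkM oU (IH k1 ek1 cq') (CkS cqv).
  by apply: eq_Ck => // x Ux; have [_ ->] := H k k1 ek1 dk x Ux.
move=> ek1 dk x Ux; have dqx : differentiable q x by have [+ _] := cq; exact.
(* m is the difference quotient of k' o acos from q x to q y. It is continuous at
   x even if q takes the value q x again arbitrarily close to x. *)
pose m y := if q y == q x then k1 (acos (q x))
  else (k' (acos (q y)) - k' (acos (q x))) / (q y - q x).
have mE y : k' (acos (q y)) = k' (acos (q x)) + m y * (q y - q x).
  rewrite /m; case: eqVneq => [->|qyx]; first by rewrite subrr mulr0 addr0.
  by rewrite divfK ?subr_eq0// addrC subrK.
have cm : {for x, continuous m}.
  apply/cont_ballP => e e0.
  have evx : evper (acos (q x)).
    have := acos_ge0 (q1 x Ux); have := acos_lepi (q1 x Ux).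
    by have := pi_gt0 R; rewrite /evper /= mulr2n; lra.
  have /cont_ballP/(_ e e0)[d d0 k1d] := Ck_cont (even_perC ek1 0) evx.
  have [d' d'0 ad'] := acos_eps (q1 x Ux) d0.
  have /cont_ballP/(_ d' d'0)[d2 d20 qd2] := differentiable_continuous dqx.
  have /near_ballP[d3 d30 Ud3] : \forall y \near x, U y by exact: open_nbhs_nbhs.
  exists (Num.min d2 d3); first by rewrite lt_min d20.
  move=> y; rewrite lt_min => /andP[y2 y3].
  rewrite {2}/m eqxx /m; case: eqVneq => [_|qyx]; first by rewrite subrr normr0.
  have [z [zx _ ->]] := acos_slope dk (q1 y (Ud3 _ y3)) (q1 x Ux).
  rewrite mulfK ?subr_eq0//; apply: k1d; apply: le_lt_trans zx _.
  by apply: ad'; [exact: q1 (Ud3 _ y3)|exact: qd2].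
have -> : (fun y => k' (acos (q y))) =
    cst (k' (acos (q x))) + (fun y => m y * (q y - q x)).
  by apply/funext => y; rewrite mE.
have dq' : differentiable (fun y => q y - q x) x.
  by apply: differentiableB => //; exact: differentiable_cst.
have [|dM DM] := differentiable_Mvanish cm dq'; first by rewrite subrr.
split=> [|v]; first by apply: differentiableD => //; exact: differentiable_cst.
rewrite deriveD; [|exact: derivable_cst|exact: diff_derivable].
rewrite derive_cst add0r DM /m eqxx; congr (_ * _).
have -> : (fun y => q y - q x) = q - cst (q x) by [].
rewrite deriveB; [|exact: diff_derivable|exact: derivable_cst].
by rewrite derive_cst subr0.
Qed.

End even_periodic.

(** * Homogeneous forms in cosine and sine *)

Section trig_form.
Context {R : realType}.
Notation pi := (@pi R).
Implicit Types (q : R -> R) (s t : R).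

(** Homogeneous forms of degree d in (cos s, sin s). The recursive description
    replaces polynomials in two variables and suits induction on d. *)
Fixpoint trig_form (d : nat) (q : R -> R) : Prop :=
  if d is d'.+1 then exists q1 q2, [/\ trig_form d' q1, trig_form d' q2 &
    forall s, q s = cos s * q1 s + sin s * q2 s]
  else exists c, forall s, q s = c.

Lemma eq_trig_form d q q' : q =1 q' -> trig_form d q -> trig_form d q'.
Proof. by move=> /funext ->. Qed.

Lemma trig_form0 d : trig_form d (fun=> 0).
Proof.
elim: d => [|d IH]; first by exists 0.
by exists (fun=> 0), (fun=> 0); split=> // s; rewrite !mulr0 addr0.
Qed.

Lemma trig_formD d q q' : trig_form d q -> trig_form d q' ->
  trig_form d (fun s => q s + q' s).
Proof.
elim: d q q' => [|d IH] q q' /=.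
  by move=> [c qc] [c' qc']; exists (c + c') => s; rewrite qc qc'.
move=> [q1 [q2 [h1 h2 E]]] [q1' [q2' [h1' h2' E']]].
exists (fun s => q1 s + q1' s), (fun s => q2 s + q2' s).
by split=> [||s]; [exact: IH|exact: IH|rewrite E E'; ring].
Qed.

Lemma trig_formZ d c q : trig_form d q -> trig_form d (fun s => c * q s).
Proof.
elim: d q => [|d IH] q /=.
  by move=> [c' qc]; exists (c * c') => s; rewrite qc.
move=> [q1 [q2 [h1 h2 E]]]; exists (fun s => c * q1 s), (fun s => c * q2 s).
by split=> [||s]; [exact: IH|exact: IH|rewrite E; ring].
Qed.

Lemma trig_formB d q q' : trig_form d q -> trig_form d q' ->
  trig_form d (fun s => q s - q' s).
Proof.
move=> h h'; apply: eq_trig_form (trig_formD h (trig_formZ (-1) h')) => s.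
by rewrite mulN1r.
Qed.

Lemma trig_form_sum d (I : Type) (r : seq I) (F : I -> R -> R) :
  (forall i, trig_form d (F i)) -> trig_form d (fun s => \sum_(i <- r) F i s).
Proof.
move=> hF; elim: r => [|i r IH].
  by apply: eq_trig_form (trig_form0 d) => s; rewrite big_nil.
by apply: eq_trig_form (trig_formD (hF i) IH) => s; rewrite big_cons.
Qed.

Lemma trig_form_mul1 d a b q : trig_form d q ->
  trig_form d.+1 (fun s => (a * cos s + b * sin s) * q s).
Proof.
move=> hq; exists (fun s => a * q s), (fun s => b * q s).
by split=> [||s]; [exact: trig_formZ|exact: trig_formZ|ring].
Qed.

Lemma trig_formM d d' q q' : trig_form d q -> trig_form d' q' ->
  trig_form (d + d') (fun s => q s * q' s).
Proof.
elim: d q => [|d IH] q /=.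
  by move=> [c qc] h; apply: eq_trig_form (trig_formZ c h) => s; rewrite qc.
move=> [q1 [q2 [h1 h2 E]]] h'.
exists (fun s => q1 s * q' s), (fun s => q2 s * q' s).
by split=> [||s]; [exact: IH|exact: IH|rewrite E; ring].
Qed.

Lemma trig_form_lin a b : trig_form 1 (fun s => a * cos s + b * sin s).
Proof.
exists (fun=> a), (fun=> b).
by split=> [||s]; [exists a|exists b|ring].
Qed.

Lemma trig_formX d e q : trig_form d q -> trig_form (d * e) (fun s => q s ^+ e).
Proof.
move=> h; elim: e => [|e IH]; first by rewrite muln0; exists 1 => s.
by rewrite mulnS; apply: eq_trig_form (trig_formM h IH) => s; rewrite exprS.
Qed.

Lemma trig_form_prod (I : Type) (r : seq I) (e : I -> nat) (F : I -> R -> R) :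
  (forall i, trig_form (e i) (F i)) ->
  trig_form (\sum_(i <- r) e i) (fun s => \prod_(i <- r) F i s).
Proof.
move=> hF; elim: r => [|i r IH].
  by rewrite big_nil; exists 1 => s; rewrite big_nil.
by rewrite big_cons; apply: eq_trig_form (trig_formM (hF i) IH) => s; rewrite big_cons.
Qed.

Lemma trig_form_shift d c q : trig_form d q -> trig_form d (fun s => q (s + c)).
Proof.
elim: d q => [|d IH] q /=; first by move=> [c' qc]; exists c' => s; rewrite qc.
move=> [q1 [q2 [h1 h2 E]]].
exists (fun s => cos c * q1 (s + c) + sin c * q2 (s + c)),
  (fun s => cos c * q2 (s + c) - sin c * q1 (s + c)).
split=> [||s]; last by rewrite E cosD sinD; ring.
  by apply: trig_formD; apply: trig_formZ; exact: IH.
by apply: trig_formB; apply: trig_formZ; exact: IH.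
Qed.

Lemma trig_form_opp d q : trig_form d q -> trig_form d (fun s => q (- s)).
Proof.
elim: d q => [|d IH] q /=; first by move=> [c' qc]; exists c' => s; rewrite qc.
move=> [q1 [q2 [h1 h2 E]]]; exists (fun s => q1 (- s)), (fun s => -1 * q2 (- s)).
by split=> [||s]; [exact: IH|apply: trig_formZ; exact: IH|rewrite E cosN sinN; ring].
Qed.

Lemma trig_form_multiple d :
  trig_form d (fun s => cos (d%:R * s)) /\ trig_form d (fun s => sin (d%:R * s)).
Proof.
elim: d => [|d [IHc IHs]].
  by split; [exists 1|exists 0] => s; rewrite mul0r ?cos0 ?sin0.
split; [exists (fun s => cos (d%:R * s)), (fun s => -1 * sin (d%:R * s))|
        exists (fun s => sin (d%:R * s)), (fun s => cos (d%:R * s))]; split=> //.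
- exact: trig_formZ.
- by move=> s; rewrite -natr1 mulrDl mul1r cosD; ring.
- by move=> s; rewrite -natr1 mulrDl mul1r sinD; ring.
Qed.

Lemma trig_form_der d q : trig_form d q -> exists2 q',
  trig_form d q' & forall s, is_derive s (1 : R) q (q' s).
Proof.
elim: d q => [|d IH] q /=.
  move=> [c /funext ->]; exists (fun=> 0); first by exists 0.
  by move=> s; exact: derC.
move=> [q1 [q2 [h1 h2 /funext ->]]].
have [q1' h1' d1] := IH _ h1; have [q2' h2' d2] := IH _ h2.
exists (fun s => cos s * (q1' s + q2 s) + sin s * (q2' s - q1 s)).
  exists (fun s => q1' s + q2 s), (fun s => q2' s - q1 s); split=> //.
    exact: trig_formD.
  exact: trig_formB.
move=> s; apply: derE (derD (derM (is_derive_cos s) (d1 s)) (derM (is_derive_sin s) (d2 s))) _.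
ring.
Qed.

(** In the frame rotated by s0 the form is cos (s - s0) p1 + sin (s - s0) p2.
    There p1 vanishes at s0 and has lower degree, so sin (s - s0) divides it by
    induction. *)
Lemma trig_form_root d q s0 : trig_form d.+1 q -> q s0 = 0 ->
  exists2 q', trig_form d q' & forall s, q s = sin (s - s0) * q' s.
Proof.
elim: d q => [|d IH] q [q1 [q2 [h1 h2 E]]] q0.
  case: h1 h2 => [c1 c1E] [c2 c2E]; rewrite E c1E c2E in q0.
  exists (fun s => cos s0 * c2 - sin s0 * c1); first by eexists.
  move=> s; rewrite E c1E c2E sinB; move: (cos2Dsin2 s0).
  set x := cos s0 in q0 *; set y := sin s0 in q0 *; move=> xy.
  have -> : cos s * c1 + sin s * c2 =
    (x ^+ 2 + y ^+ 2) * (cos s * c1 + sin s * c2) by rewrite xy mul1r.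
  have -> : (sin s * x - cos s * y) * (x * c2 - y * c1) =
    (x ^+ 2 + y ^+ 2) * (cos s * c1 + sin s * c2) - (x * c1 + y * c2) * (x * cos s + y * sin s) by ring.
  by rewrite q0 mul0r subr0.
pose p1 s := cos s0 * q1 s + sin s0 * q2 s.
pose p2 s := cos s0 * q2 s - sin s0 * q1 s.
have E' s : q s = cos (s - s0) * p1 s + sin (s - s0) * p2 s.
  rewrite E cosB sinB /p1 /p2; move: (cos2Dsin2 s0).
  set x := cos s0; set y := sin s0; move=> xy.
  rewrite -[LHS]mul1r -xy; ring.
have hp1 : trig_form d.+1 p1 by apply: trig_formD; exact: trig_formZ.
have hp2 : trig_form d.+1 p2 by apply: trig_formB; exact: trig_formZ.
have p10 : p1 s0 = 0 by move: q0; rewrite E' subrr cos0 sin0 mul1r mul0r addr0.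
have [p3 hp3 p1E] := IH _ hp1 p10.
exists (fun s => cos (s - s0) * p3 s + p2 s).
  apply: trig_formD => //.
  apply: eq_trig_form (trig_form_mul1 (cos s0) (sin s0) hp3) => s.
  by rewrite cosB; ring.
by move=> s; rewrite E' p1E; ring.
Qed.

(** Each zero splits off a factor by [trig_form_root], and the zeros that differ
    from it modulo pi remain zeros of the quotient. *)
Lemma trig_form_eq0 d q (l : seq R) : trig_form d q -> (d < size l)%N ->
  pairwise (fun a b => sin (b - a) != 0) l -> (forall a, a \in l -> q a = 0) ->
  forall s, q s = 0.
Proof.
elim: d q l => [|d IH] q [|a l]//=.
  by move=> [c qc] _ _ /(_ a (mem_head _ _)); rewrite qc => c0 s; rewrite qc c0.
move=> hq; rewrite ltnS => sl /andP[al pl] ql.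
have [q' hq' E] := trig_form_root hq (ql a (mem_head _ _)).
have q'l b : b \in l -> q' b = 0.
  move=> bl; have := ql b; rewrite inE bl orbT => /(_ isT)/eqP.
  by rewrite E mulf_eq0 (negbTE (allP al b bl)) => /eqP.
by move=> s; rewrite E (IH q' l hq' sl pl q'l) mulr0.
Qed.

Lemma trig_form_isolated d q : trig_form d q -> (exists s, q s != 0) ->
  exists2 e, 0 < e & forall s, 0 < s < e -> q s != 0.
Proof.
elim: d q => [|d IH] q.
  by move=> [c qc] [s qs]; exists 1 => // t _; rewrite qc -(qc s).
move=> hq qn0.
have [[s0 /andP[s00 s01] q0]|H] := pselect (exists2 s, 0 < s < 1 & q s = 0); last first.
  by exists 1 => // s s1; apply/eqP => q0; apply: H; exists s.
have [q' hq' E] := trig_form_root hq q0.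
have [|e e0 he] := IH _ hq'.
  by case: qn0 => s qs; exists s; apply: contraNneq qs => q's; rewrite E q's mulr0.
exists (Num.min e s0); first by rewrite lt_min e0.
move=> s; rewrite lt_min => /and3P[s_gt0 se ss0]; rewrite E mulf_neq0 ?he ?s_gt0//.
rewrite -oppr_eq0 -sinN gt_eqF// sin_gt0_pi// opprB subr_gt0 ss0 ltrBlDr.
by rewrite (lt_le_trans s01)// (le_trans _ (ler_wpDr (ltW s_gt0) (pi_ge2 R)))// ler1n.
Qed.

(** Stands in for analytic continuation: two forms of the same degree with the
    same germ are equal. *)
Lemma trig_form_eq0_near d q a e : trig_form d q -> 0 < e ->
  (forall s, a < s < a + e -> q s = 0) -> forall s, q s = 0.
Proof.
move=> hq e0 q0 s; apply/eqP; apply/negPn/negP => qs.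
have [|d0 d00 hd] := trig_form_isolated (trig_form_shift a hq).
  by exists (s - a); rewrite subrK.
have [t t0 [td te]] := ex_lt2 d00 e0.
have := hd t; rewrite t0 td => /(_ isT)/eqP; apply; apply: q0.
by rewrite addrC ltrDl t0 ltrD2l.
Qed.

End trig_form.

Section homogeneous_polynomial.
Import (canonicals) mpoly.

(** The only way in which the algebraic nature of the isoparametric function is
    used: along great circles it becomes a form, determined by its germ at any
    point. *)
Lemma trig_form_homog {R : realType} {n d : nat} (P : mpoly.dhomog n R d)
    (u v : 'rV[R]_n) :
  trig_form d (fun s => mpoly.meval (fun i => (cos s *: u + sin s *: v) 0 i)
    (mpoly.mpoly_of_dhomog P)).
Proof.
case: P => P hP /=; move/mpoly.dhomogP: hP => hP.
set r := mpoly.msupp P in hP *.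
pose F m s := if m \in r then mpoly.mcoeff m P *
    \prod_(i < n) (cos s *: u + sin s *: v) 0 i ^+ mpoly.fun_of_multinom m i else 0.
suff hF m : trig_form d (F m).
  apply: eq_trig_form (trig_form_sum r hF) => s.
  by rewrite mpoly.mevalE [RHS]big_seq [RHS]big_mkcond.
rewrite /F; have [mr|mr] := boolP (m \in r); last exact: trig_form0.
have -> : d = (\sum_i mpoly.fun_of_multinom m i)%N.
  by rewrite -(hP m mr); exact: mpoly.mdegE.
apply: trig_formZ.
apply: trig_form_prod => i; rewrite -[X in trig_form X]mul1n; apply: trig_formX.
apply: eq_trig_form (trig_form_lin (u 0 i) (v 0 i)) => s.
by rewrite !mxE mulrC [sin s * _]mulrC.
Qed.

End homogeneous_polynomial.

(** * Uniqueness for the eikonal equation *)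

Section eikonal.
Context {R : realType}.
Notation pi := (@pi R).

Lemma sign_const (g : R -> R) (a b : R) : (forall x, {for x, continuous g}) ->
  (forall x, a < x < b -> g x != 0) ->
  (forall x, a < x < b -> 0 < g x) \/ (forall x, a < x < b -> g x < 0).
Proof.
move=> cg g0; have [[x xab gx]|H] := pselect (exists2 x, a < x < b & 0 < g x); last first.
  right=> x xab; rewrite lt_neqAle g0//= leNgt; apply/negP => gx; apply: H.
  by exists x.
left=> y yab; rewrite ltNge le_eqVlt negb_or g0//=; apply/negP => gy.
have Hz u v : a < u < b -> a < v < b -> u <= v ->
    Num.min (g u) (g v) <= 0 <= Num.max (g u) (g v) -> False.
  move=> /andP[au ub] /andP[av vb] uv m.
  have [|z] := IVT uv _ m; first by apply: continuous_subspaceT; exact: cg.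
  rewrite in_itv /= => /andP[uz zv] gz.
  suff : g z != 0 by rewrite gz eqxx.
  by apply: g0; rewrite (lt_le_trans au uz) (le_lt_trans zv vb).
have [xy|yx] := leP x y.
  by apply: (Hz x y xab yab xy); rewrite ge_min le_max (ltW gx) (ltW gy) orbT.
by apply: (Hz y x yab xab (ltW yx)); rewrite ge_min le_max (ltW gx) (ltW gy) orbT.
Qed.

Lemma der_lt0_decr (f f' : R -> R) (a b : R) :
  (forall x, is_derive x (1 : R) f (f' x)) -> (forall x, a < x < b -> f' x < 0) ->
  forall x y, a <= x -> x < y -> y <= b -> f y < f x.
Proof.
move=> df f'0 x y ax xy yb.
have dfo t : x < t < y -> is_derive t (1 : R) f (f' t) by [].
have cf t : x <= t <= y -> {for t, continuous f} by move=> _; exact: der_cont (df t).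
have [c /andP[xc cy] E] := MVT_oo xy dfo cf.
rewrite -subr_lt0 E pmulr_llt0 ?subr_gt0//; apply: f'0.
by rewrite (le_lt_trans ax xc) (lt_le_trans cy yb).
Qed.

Section eikonal_local.
Variables (phi phi' q q' a : R -> R) (L e : R).
Hypotheses (L0 : 0 < L) (e0 : 0 < e).
Hypothesis dphi : forall s : R, is_derive s (1 : R) phi (phi' s).
Hypothesis dq : forall s : R, is_derive s (1 : R) q (q' s).
Hypothesis cphi' : forall s : R, {for s, continuous phi'}.
Hypothesis cq' : forall s : R, {for s, continuous q'}.
Hypotheses (phi0 : phi 0 = 1) (phiL : phi L = -1).
Hypothesis phiE : forall s : R, 0 < s < L -> phi' s ^+ 2 = a (phi s).
Hypothesis phi'0 : forall s : R, 0 < s < L -> phi' s != 0.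
Hypotheses (q0 : q 0 = 1) (q1 : forall s : R, q s <= 1).
Hypothesis qE : forall s : R, 0 < s < e -> q' s ^+ 2 = a (q s).
Hypothesis q'0 : forall s : R, 0 < s < e -> q' s != 0.

Let phi'_lt0 s : 0 < s < L -> phi' s < 0.
Proof.
have [H|] := sign_const cphi' phi'0; last exact.
have dN t : is_derive t (1 : R) (fun s => - phi s) (- phi' t) by exact: derN.
have := @der_lt0_decr _ _ 0 L dN _ 0 L (lexx 0) L0 (lexx L).
rewrite phi0 phiL ltrN2 => H'; have : 1 < -1 :> R.
  by apply: H' => x xL; rewrite oppr_lt0; exact: H.
lra.
Qed.

Let q'_lt0 s : 0 < s < e -> q' s < 0.
Proof.
have [H|] := sign_const cq' q'0; last exact.
have dN t : is_derive t (1 : R) (fun s => - q s) (- q' t) by exact: derN.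
have := @der_lt0_decr _ _ 0 e dN _ 0 e (lexx 0) e0 (lexx e).
rewrite q0 ltrN2 => H'; have : 1 < q e.
  by apply: H' => x xL; rewrite oppr_lt0; exact: H.
by rewrite ltNge q1.
Qed.

Let phi_decr x y : 0 <= x -> x < y -> y <= L -> phi y < phi x.
Proof. exact: (der_lt0_decr dphi phi'_lt0). Qed.

Let phi_surj y : -1 < y < 1 -> exists2 t, 0 < t < L & phi t = y.
Proof.
move=> /andP[y0 y1].
have [| |t] := @IVT _ phi 0 L y (ltW L0).
- by apply: continuous_subspaceT => t; exact: der_cont (dphi t).
- by rewrite phi0 phiL ge_min le_max (ltW y0) (ltW y1) orbT.
rewrite in_itv /= !le_eqVlt => /andP[/predU1P[<-|t0] /predU1P[tL|tL]].
- by move: L0; rewrite tL ltxx.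
- by rewrite phi0 => y1'; move: y1; rewrite y1' ltxx.
- by rewrite tL phiL => y1'; move: y0; rewrite y1' ltxx.
by exists t => //; rewrite t0.
Qed.

Let phi_inj x y : 0 < x < L -> 0 < y < L -> phi x = phi y -> x = y.
Proof.
move=> /andP[x0 xL] /andP[y0 yL] xy; have [xy'|xy'|//] := ltgtP x y.
  by have := phi_decr (ltW x0) xy' (ltW yL); rewrite xy ltxx.
by have := phi_decr (ltW y0) xy' (ltW xL); rewrite xy ltxx.
Qed.

(** The equation y'^2 = a y is degenerate at the initial value 1 and has no
    uniqueness there in general. But both functions decrease strictly at first,
    so phi can be inverted, and phi^-1 o q has derivative 1. Hence q is a
    translate of phi, and the common initial value leaves no room for the
    translation. *)
Lemma eikonal_local : exists2 d, 0 < d & forall s, 0 < s < d -> q s = phi s.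
Proof.
pose psi y := xget 0 [set t | 0 < t < L /\ phi t = y].
have psiP y : -1 < y < 1 -> 0 < psi y < L /\ phi (psi y) = y.
  by move=> /phi_surj[t tL ty]; apply: (@xgetPex _ 0 [set t | 0 < t < L /\ phi t = y]); exists t.
have phi_itv t : 0 < t < L -> -1 < phi t < 1.
  move=> /andP[t0 tL]; rewrite -phiL -phi0; apply/andP; split; apply: phi_decr => //; exact: ltW.
have psiK t : 0 < t < L -> psi (phi t) = t.
  by move=> tL; have [h1 h2] := psiP _ (phi_itv t tL); exact: phi_inj.
have dpsi (t : R) : 0 < t < L -> is_derive (phi t) (1 : R) psi (phi' t)^-1.
  move=> tL; apply: is_derive_inverse => //.
  - have : \forall x \near t, [set x | 0 < x < L] x.
      by apply: open_nbhs_nbhs; split=> //; exact: open_between.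
    by apply: filterS => x; exact: psiK.
  - by near=> x; exact: der_cont (dphi x).
  - exact: phi'0.
have /cont_ballP/(_ 1 ltr01)[d d0 qd] := der_cont (dq 0).
pose e' := Num.min d e.
have e'0 : 0 < e' by rewrite lt_min d0.
have qs s : 0 < s < e' -> -1 < q s < 1.
  rewrite lt_min => /and3P[s0 sd se]; apply/andP; split; last first.
    by rewrite -q0; exact: (der_lt0_decr dq q'_lt0 (lexx 0) s0 (ltW se)).
  by have := qd s; rewrite subr0 gtr0_norm// => /(_ sd); rewrite q0 ltr_norml; lra.
have ee s : 0 < s < e' -> 0 < s < e by rewrite lt_min => /and3P[-> _ ->].
clearbody e'.
pose sg s := psi (q s).
have dsg (s : R) : 0 < s < e' -> is_derive s (1 : R) sg 1.
  move=> se; have [sL sE] := psiP _ (qs s se).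
  have := dpsi _ sL; rewrite sE => dps.
  apply: derE (der_comp dps (dq s)) _.
  have : phi' (psi (q s)) ^+ 2 = q' s ^+ 2 by rewrite phiE// sE qE// ee.
  move=> /eqP; rewrite eqf_sqr => /orP[/eqP E|/eqP E].
    by rewrite E mulVf// q'0// ee.
  by have := phi'_lt0 sL; rewrite E oppr_lt0 ltNge ltW// q'_lt0// ee.
have dsgs (s : R) : 0 < s < e' -> is_derive s (1 : R) (fun s => sg s - s) 0.
  by move=> se; apply: derE (derB (dsg s se) (derX s)) _; rewrite subrr.
have sgc s t : 0 < s < e' -> 0 < t < e' -> sg s - s = sg t - t.
  wlog st : s t / s <= t.
    by move=> W hs ht; have [st|/ltW ts] := leP s t; [exact: W|apply/esym; exact: W].
  move=> /andP[s0 se] /andP[t0 te].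
  have [|c _ E] := MVT_der st (df := fun=> 0) (f := fun s => sg s - s).
    by move=> x /andP[sx xt]; apply: dsgs; rewrite (lt_le_trans s0)// (le_lt_trans xt).
  by apply/esym/eqP; rewrite -subr_eq0 E mul0r.
(* At this point phi^-1 (q s) = s + k, and it remains to prove k = 0: letting s
   tend to 0 gives phi k = 1, a value that phi takes only at 0 on [0, L[. *)
pose k := sg (e' / 2) - e' / 2.
have he : 0 < e' / 2 < e' by rewrite divr_gt0//= ltr_pdivrMr// mulr_natr mulr2n ltrDl.
have sgE s : 0 < s < e' -> sg s = s + k.
  by move=> se; rewrite /k -(sgc s _ se he) addrC subrK.
have sgL s : 0 < s < e' -> 0 < s + k < L.
  by move=> se; rewrite -sgE//; have [] := psiP _ (qs s se).
have qphi s : 0 < s < e' -> q s = phi (s + k).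
  by move=> se; rewrite -sgE//; have [_] := psiP _ (qs s se).
have k0 : 0 <= k.
  rewrite leNgt; apply/negP => kn.
  have := sgL (Num.min (e' / 2) (- k)); rewrite lt_min oppr_gt0 kn (andP he).1 gt_min (andP he).2.
  move=> /(_ isT)/andP[+ _]; rewrite -ltrBlDr sub0r lt_min => /andP[_].
  by rewrite ltxx.
have phik : phi k = 1.
  apply/eqP; rewrite -subr_eq0 -normr_le0 leNgt; apply/negP => n0.
  have n20 : 0 < `|phi k - 1| / 2 by rewrite divr_gt0.
  have /cont_ballP/(_ _ n20)[d1 d10 H1] := der_cont (dphi k).
  have /cont_ballP/(_ _ n20)[d2 d20 H2] := der_cont (dq 0).
  have [d3 d30 [d31 d32]] := ex_lt2 d10 d20.
  have [s s0 [s3 se]] := ex_lt2 d30 e'0.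
  have s1 := lt_trans s3 d31; have s2 := lt_trans s3 d32.
  have := H1 (s + k); rewrite addrK gtr0_norm// => /(_ s1).
  have := H2 s; rewrite subr0 gtr0_norm// => /(_ s2).
  rewrite q0 qphi ?s0// => A B.
  have : `|phi k - 1| <= `|phi (s + k) - 1| + `|phi (s + k) - phi k|.
    rewrite (distrC _ (phi k)); have -> : phi k - 1 = (phi (s + k) - 1) + (phi k - phi (s + k)) by ring.
    exact: ler_normD.
  lra.
have kz : k = 0.
  apply/eqP; rewrite eq_le k0 andbT leNgt; apply/negP => kp.
  have [ _ kL] := andP (sgL _ he).
  have := phi_itv k; rewrite kp phik ltxx andbF => /(_ _)/negP; apply => //=.
  by apply: lt_trans kL; rewrite ltrDr (andP he).1.
by exists e' => // s se; rewrite qphi// kz addr0.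
Unshelve. all: by end_near. Qed.

End eikonal_local.
End eikonal.

(** * The profile of an isoparametric function *)

Lemma pi_div_gt0 {R : realType} d : (0 < d)%N -> 0 < pi / d%:R :> R.
Proof. by move=> d0; rewrite divr_gt0 ?pi_gt0// ltr0n. Qed.

Lemma pi_div_le {R : realType} d : (0 < d)%N -> pi / d%:R <= pi :> R.
Proof. by move=> d0; rewrite ler_pdivrMr ?ltr0n// ler_peMr ?pi_ge0// ler1n. Qed.

Lemma pi_divK {R : realType} d : (0 < d)%N -> d%:R * (pi / d%:R) = pi :> R.
Proof. by move=> d0; rewrite mulrC divfK// pnatr_eq0 -lt0n. Qed.

Section chebyshev.
Context {R : realType}.
Notation pi := (@pi R).

Lemma trig_form_derE d (q q' : R -> R) : trig_form d q ->
  (forall s, is_derive s (1 : R) q (q' s)) -> trig_form d q'.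
Proof.
move=> hq dq; have [q2 h2 d2] := trig_form_der hq.
by apply: eq_trig_form h2 => s; exact: der_unique (d2 s) (dq s).
Qed.

Lemma trig_form_cont d (q : R -> R) : trig_form d q -> forall s, {for s, continuous q}.
Proof. by move=> /trig_form_der[q' _ dq] s; exact: der_cont (dq s). Qed.

(** The agreement near 0 given by [eikonal_local] extends to the whole line for
    forms. *)
Lemma eikonal_trig_form d (phi phi' q q' a : R -> R) (L : R) :
  0 < L -> trig_form d phi -> trig_form d q ->
  (forall s, is_derive s (1 : R) phi (phi' s)) ->
  (forall s, is_derive s (1 : R) q (q' s)) ->
  phi 0 = 1 -> phi L = -1 ->
  (forall s, 0 < s < L -> phi' s ^+ 2 = a (phi s)) ->
  (forall s, 0 < s < L -> phi' s != 0) ->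
  q 0 = 1 -> (forall s, q s <= 1) -> (exists s, q s != 1) ->
  (forall s, q' s ^+ 2 = a (q s)) -> q =1 phi.
Proof.
move=> L0 hphi hq dphi dq phi0 phiL phiE phi'0 q0 q1 qn1 qE.
have hphi' := trig_form_derE hphi dphi; have hq' := trig_form_derE hq dq.
have q'n0 : exists s, q' s != 0.
  by have [s qs] := qn1; apply: (der_neq0 dq (a := s) (b := 0)); rewrite q0.
have [e e0 q'e] := trig_form_isolated hq' q'n0.
have [d0 d00 E] := eikonal_local L0 e0 dphi dq (trig_form_cont hphi') (trig_form_cont hq')
  phi0 phiL phiE phi'0 q0 q1 (fun s _ => qE s) q'e.
move=> s; apply/eqP; rewrite -subr_eq0; apply/eqP.
apply: (trig_form_eq0_near (trig_formB hq hphi) d00 (a := 0)) => t.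
by rewrite add0r => /E ->; rewrite subrr.
Qed.

(** The reflections of q about 0 and about L solve the same equation as q, so
    uniqueness makes q even about both points. In particular q takes the value
    (-1)^k at k L. With C chosen to match q at L / 2, the form
    q s - cos (d s) - C sin (d s) has degree d and d + 1 zeros modulo pi, so it
    vanishes; evenness of q gives C = 0. *)
Lemma chebyshev_cos d (phi phi' q q' a : R -> R) : (0 < d)%N ->
  let L := pi / d%:R in
  trig_form d phi -> trig_form d q ->
  (forall s, is_derive s (1 : R) phi (phi' s)) ->
  (forall s, is_derive s (1 : R) q (q' s)) ->
  phi 0 = 1 -> phi L = -1 ->
  (forall s, 0 < s < L -> phi' s ^+ 2 = a (phi s)) ->
  (forall s, 0 < s < L -> phi' s != 0) ->
  q 0 = 1 -> (forall s, -1 <= q s <= 1) -> (exists s, q s != 1) ->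
  (forall s, q' s ^+ 2 = a (q s)) -> forall s, q s = cos (d%:R * s).
Proof.
move=> d0 L hphi hq dphi dq phi0 phiL phiE phi'0 q0 q1 qn1 qE.
have L0 : 0 < L := pi_div_gt0 d0.
have qphi : q =1 phi.
  by apply: (eikonal_trig_form L0 hphi hq dphi dq _ _ phiE) => // s; case/andP: (q1 s).
have qev s : q (- s) = q s.
  rewrite [RHS]qphi; move: s.
  apply: (eikonal_trig_form (q := fun s => q (- s)) (q' := fun s => - q' (- s))
            L0 hphi (trig_form_opp hq) dphi _ _ _ phiE) => //.
  - by move=> s; apply: derE (der_comp (dq (- s)) (derN (derX s))) _; rewrite mulrN1.
  - by rewrite oppr0.
  - by move=> s; case/andP: (q1 (- s)).
  - by have [s hs] := qn1; exists (- s); rewrite opprK.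
  - by move=> s; rewrite sqrrN.
(* Reversing both the time and the sign exchanges the two ends of the profile:
   the functions - phi (L - s) and - q (L + s) solve the equation with
   y |-> a (- y). *)
have qref s : q (L + s) = q (L - s).
  apply: oppr_inj; rewrite [X in _ = - X]qphi; move: s.
  apply: (eikonal_trig_form (phi := fun s => - phi (L - s)) (q := fun s => - q (L + s))
            (phi' := fun s => phi' (L - s)) (q' := fun s => - q' (L + s))
            (a := fun y => a (- y)) (d := d) (L := L)) => //.
  - apply: eq_trig_form (trig_formZ (-1) (trig_form_opp (trig_form_shift L hphi))) => s.
    by rewrite mulN1r addrC.
  - apply: eq_trig_form (trig_formZ (-1) (trig_form_shift L hq)) => s.
    by rewrite mulN1r addrC.
  - move=> s; apply: derE (derN (@der_comp _ phi (fun s => L - s) s _ _ (dphi (L - s)) (derB (derC s L) (derX s)))) _; ring.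
  - move=> s; apply: derE (derN (@der_comp _ q (fun s => L + s) s _ _ (dq (L + s)) (derD (derC s L) (derX s)))) _; ring.
  - by rewrite subr0 phiL opprK.
  - by rewrite subrr phi0.
  - by move=> s sL; rewrite opprK phiE//; lra.
  - by move=> s sL; rewrite phi'0//; lra.
  - by rewrite addr0 qphi phiL opprK.
  - by move=> s; rewrite lerNl; case/andP: (q1 (L + s)).
  - exists (- L); rewrite subrr q0; apply/eqP; lra.
  - by move=> s; rewrite sqrrN opprK.
have qper s : q (s + L *+ 2) = q s.
  have -> : s + L *+ 2 = L + (L + s) by rewrite mulr2n addrC addrA.
  by rewrite qref opprD addrA subrr sub0r qev.
have qk k : q (k%:R * L) = (-1) ^+ k.
  have [H0 H1] : q 0 = 1 /\ q L = -1 by split; last rewrite qphi.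
  suff : q (k%:R * L) = (-1) ^+ k /\ q (k.+1%:R * L) = (-1) ^+ k.+1 by case.
  elim: k => [|k [IH1 IH2]]; first by rewrite mul0r mul1r expr0 expr1.
  split=> //; rewrite -(natr1 k.+1) -(natr1 k) -addrA mulrDl !exprS mulrA mulrNN !mul1r -IH1.
  by rewrite -[RHS]qper; congr (q (_ + _)); rewrite mulrDl mul1r mulr2n.
have dL : d%:R * L = pi := pi_divK d0.
have kpi k : d%:R * (k%:R * L) = k%:R * pi by rewrite mulrCA dL.
have ckpi k : cos (k%:R * pi) = (-1) ^+ k :> R /\ sin (k%:R * pi) = 0 :> R.
  elim: k => [|k [IH1 IH2]]; first by rewrite mul0r cos0 sin0.
  by rewrite -natr1 mulrDl mul1r cosDpi sinDpi IH1 IH2 exprS mulN1r oppr0.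
pose C := q (L / 2).
have dL2 : d%:R * (L / 2) = pi / 2 by rewrite mulrA dL.
have H s : q s - (cos (d%:R * s) + C * sin (d%:R * s)) = 0.
  have [hc hs] := @trig_form_multiple R d.
  apply: (trig_form_eq0 (l := L / 2 :: [seq k%:R * L | k <- iota 0 d])
            (trig_formB hq (trig_formD hc (trig_formZ C hs)))).
  - by rewrite /= size_map size_iota.
  - rewrite /= all_map pairwise_map; apply/andP; split.
      apply/allP => k; rewrite mem_iota add0n => /andP[_ kd] /=.
      have kL : k%:R * L <= pi - L.
        by rewrite -dL -[X in _ - X]mul1r -mulrBl ler_wpM2r ?(ltW L0)// lerBrDr natr1 ler_nat.
      have Lpi : L <= pi by rewrite -dL ler_peMl ?(ltW L0)// ler1n.
      have kL0 : 0 <= k%:R * L by rewrite mulr_ge0// ltW.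
      case: k kd kL kL0 => [|k] kd kL kL0.
        rewrite mul0r sub0r sinN oppr_eq0 gt_eqF// sin_gt0_pi//; apply/andP; split; lra.
      have kL1 : L <= k.+1%:R * L by rewrite ler_peMl ?(ltW L0)// ler1n.
      rewrite gt_eqF// sin_gt0_pi//; apply/andP; split; lra.
    apply: (@sub_in_pairwise _ (fun k => (k < d)%N) ltn).
    - move=> j k; rewrite !unfold_in => jd kd jk /=.
      have E : k%:R * L - j%:R * L = (k - j)%:R * L by rewrite natrB ?mulrBl// ltnW.
      rewrite E gt_eqF// sin_gt0_pi//; apply/andP; split.
        by rewrite mulr_gt0// ltr0n subn_gt0.
      by rewrite -dL ltr_pM2r// ltr_nat (leq_ltn_trans (leq_subr _ _)).
    - by apply/allP => k; rewrite mem_iota add0n.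
    - rewrite -sorted_pairwise; last exact: ltn_trans.
      exact: iota_ltn_sorted.
  move=> t; rewrite inE => /predU1P[->|/mapP[k _ ->]].
    by rewrite dL2 cos_pihalf sin_pihalf add0r mulr1 subrr.
  by rewrite qk kpi (ckpi k).1 (ckpi k).2 mulr0 addr0 subrr.
have {}H s : q s = cos (d%:R * s) + C * sin (d%:R * s) by apply/eqP; rewrite -subr_eq0 H.
have C0 : C = 0.
  have := qev (L / 2); rewrite -/C H mulrN dL2 cosN sinN cos_pihalf sin_pihalf; lra.
by move=> s; rewrite H C0 mul0r addr0.
Qed.

End chebyshev.

(** * Euclidean geometry of the sphere *)

Section dot.
Context {R : realType} {n : nat}.
Implicit Types (x y z u v w : 'rV[R]_n) (a b c s t : R).

Lemma dotC x y : dot x y = dot y x.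
Proof. by apply: eq_bigr => i _; rewrite mulrC. Qed.

Lemma dotDl x y z : dot (x + y) z = dot x z + dot y z.
Proof. by rewrite /dot -big_split; apply: eq_bigr => i _; rewrite mxE mulrDl. Qed.

Lemma dotZl a x y : dot (a *: x) y = a * dot x y.
Proof. by rewrite /dot mulr_sumr; apply: eq_bigr => i _; rewrite mxE mulrA. Qed.

Lemma dotDr x y z : dot x (y + z) = dot x y + dot x z.
Proof. by rewrite dotC dotDl !(dotC x). Qed.

Lemma dotZr a x y : dot x (a *: y) = a * dot x y.
Proof. by rewrite dotC dotZl dotC. Qed.

Lemma dotNl x y : dot (- x) y = - dot x y.
Proof. by rewrite -scaleN1r dotZl mulN1r. Qed.

Lemma dotNr x y : dot x (- y) = - dot x y.
Proof. by rewrite dotC dotNl dotC. Qed.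

Lemma dotBl x y z : dot (x - y) z = dot x z - dot y z.
Proof. by rewrite dotDl dotNl. Qed.

Lemma dotBr x y z : dot x (y - z) = dot x y - dot x z.
Proof. by rewrite dotDr dotNr. Qed.

Definition dotE := (dotDl, dotDr, dotBl, dotBr, dotNl, dotNr, dotZl, dotZr).

Lemma dot0l x : dot 0 x = 0.
Proof. by rewrite -(scale0r x) dotZl mul0r. Qed.

Lemma dot0r x : dot x 0 = 0.
Proof. by rewrite dotC dot0l. Qed.

Lemma dot_ge0 x : 0 <= dot x x.
Proof. by apply: sumr_ge0 => i _; rewrite -expr2 sqr_ge0. Qed.

Lemma dot_eq0 x : (dot x x == 0) = (x == 0).
Proof.
apply/idP/eqP => [|->]; last by rewrite dot0l.
rewrite psumr_eq0; last by move=> i _; rewrite -expr2 sqr_ge0.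
move=> /allP H; apply/rowP => i; rewrite mxE; apply/eqP.
by have := H i (mem_index_enum _); rewrite -expr2 sqrf_eq0.
Qed.

Lemma dot_gt0 x : (0 < dot x x) = (x != 0).
Proof. by rewrite lt_neqAle dot_ge0 andbT eq_sym dot_eq0. Qed.

Lemma dot_basis x i : dot x (basis_vec i) = x 0 i.
Proof.
rewrite /dot (bigD1 i)//= big1 ?addr0 /basis_vec ?mxE ?eqxx ?mulr1//.
by move=> j ji; rewrite mxE (negbTE ji) andbF mulr0.
Qed.

Lemma cauchy_schwarz x y : dot x y ^+ 2 <= dot x x * dot y y.
Proof.
have [->|y0] := eqVneq y 0; first by rewrite !dot0r mulr0 expr0n.
have yy : 0 < dot y y by rewrite dot_gt0.
have h := dot_ge0 (dot y y *: x - dot x y *: y).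
rewrite -subr_ge0 -(pmulr_rge0 _ yy); apply: le_trans h _.
rewrite !dotE (dotC y x) le_eqVlt; apply/orP; left; apply/eqP; ring.
Qed.

Lemma enorm_ge0 x : 0 <= enorm x. Proof. exact: sqrtr_ge0. Qed.

Lemma enorm_sqr x : enorm x ^+ 2 = dot x x.
Proof. by rewrite sqr_sqrtr// dot_ge0. Qed.

Lemma enorm_gt0 x : (0 < enorm x) = (x != 0).
Proof. by rewrite sqrtr_gt0 dot_gt0. Qed.

Lemma enorm_eq0 x : (enorm x == 0) = (x == 0).
Proof. by rewrite /enorm sqrtr_eq0 le_eqVlt ltNge dot_ge0 orbF dot_eq0. Qed.

Lemma enormZ a x : 0 <= a -> enorm (a *: x) = a * enorm x.
Proof.
by move=> a0; rewrite /enorm !dotE mulrA sqrtrM ?mulr_ge0// -expr2 sqrtr_sqr ger0_norm.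
Qed.

Lemma sphereP x : sphere x <-> dot x x = 1.
Proof.
rewrite /sphere /= /enorm; split=> [h|->]; last exact: sqrtr1.
by rewrite -enorm_sqr /enorm h expr1n.
Qed.

Lemma sphere_neq0 x : sphere x -> x != 0.
Proof. by move=> /sphereP xx; rewrite -dot_gt0 xx. Qed.

Lemma normalize_sphere x : x != 0 -> sphere ((enorm x)^-1 *: x).
Proof.
move=> x0; apply/sphereP; rewrite !dotE -enorm_sqr expr2.
have := x0; rewrite -enorm_gt0 => /lt0r_neq0 e0; by field.
Qed.

Lemma normalizeK x : x != 0 -> enorm x *: ((enorm x)^-1 *: x) = x.
Proof. by rewrite -enorm_eq0 => e0; rewrite scalerA divff// scale1r. Qed.

Lemma radial_ext_sphere (p : 'rV[R]_n -> R) x : sphere x -> radial_ext p x = p x.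
Proof. by move=> xS; rewrite /radial_ext (xS : enorm x = 1) invr1 scale1r. Qed.

Lemma radial_extZ (p : 'rV[R]_n -> R) a x : 0 < a ->
  radial_ext p (a *: x) = radial_ext p x.
Proof.
move=> a0; rewrite /radial_ext enormZ ?ltW// scalerA invfM mulrAC.
by rewrite mulVf ?mul1r// gt_eqF.
Qed.

Definition circle u v s : 'rV[R]_n := cos s *: u + sin s *: v.

Definition orthonormal2 u v := [/\ sphere u, sphere v & dot u v = 0].

Lemma dot_circle u v s t : orthonormal2 u v ->
  dot (circle u v s) (circle u v t) = cos (s - t).
Proof.
move=> [/sphereP uu /sphereP vv uv].
by rewrite /circle !dotE uu vv uv (dotC v u) uv cosB; ring.
Qed.

Lemma circle_sphere u v s : orthonormal2 u v -> sphere (circle u v s).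
Proof. by move=> uv; apply/sphereP; rewrite dot_circle// subrr cos0. Qed.

Lemma circle0 u v : circle u v 0 = u.
Proof. by rewrite /circle cos0 sin0 scale1r scale0r addr0. Qed.

Lemma circleDpihalf u v s : circle u v (s + pi / 2) = - sin s *: u + cos s *: v.
Proof. by rewrite /circle cosDpihalf sinDpihalf. Qed.

Lemma orthonormal2_tangent u v s : orthonormal2 u v ->
  orthonormal2 (circle u v s) (circle u v (s + pi / 2)).
Proof.
move=> uv; split; [exact: circle_sphere|exact: circle_sphere|].
by rewrite dot_circle// opprD addrA subrr sub0r cosN cos_pihalf.
Qed.

Lemma circleD u v s t :
  circle u v (s + t) = cos t *: circle u v s + sin t *: circle u v (s + pi / 2).
Proof.
rewrite circleDpihalf /circle cosD sinD.
by apply/rowP => i; rewrite !mxE; ring.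
Qed.

Lemma derivable_rV {V : normedModType R} (c : V -> 'rV[R]_n) (l : 'rV[R]_n) (x v : V) :
  (forall i, is_derive x v (fun h => c h 0 i) (l 0 i)) -> is_derive x v c l.
Proof.
move=> h; have dc : derivable c x v.
  by apply/derivable_mxP => i j; rewrite ord1; have [] := h j.
by apply: DeriveDef => //; rewrite derive_mx//; apply/rowP => i; rewrite mxE; have [] := h i.
Qed.

Lemma is_derive_coord {V : normedModType R} (c : V -> 'rV[R]_n) (l : 'rV[R]_n) (x v : V) i :
  is_derive x v c l -> is_derive x v (fun h => c h 0 i) (l 0 i).
Proof.
move=> [dc <-]; apply: DeriveDef; first by have /derivable_mxP := dc; exact.
by rewrite derive_mx// mxE.
Qed.

Lemma is_derive_circle u v s :
  is_derive s (1 : R) (circle u v) (circle u v (s + pi / 2)).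
Proof.
apply: derivable_rV => i; rewrite circleDpihalf !mxE.
have -> : (fun s => circle u v s 0 i) = (fun s => cos s * u 0 i + sin s * v 0 i).
  by apply/funext => t; rewrite !mxE.
apply: derE (derD (derM (is_derive_cos s) (derC s _)) (derM (is_derive_sin s) (derC s _))) _.
ring.
Qed.

Lemma is_derive_dot (c : R -> 'rV[R]_n) w m s : is_derive s (1 : R) c w ->
  is_derive s (1 : R) (fun s => dot (c s) m) (dot w m).
Proof.
move=> dc; have -> : (fun s => dot (c s) m) = \sum_i (fun s => c s 0 i * m 0 i).
  by apply/funext => t; rewrite fct_sumE.
apply: is_derive_sum => i.
by apply: derE (derM (is_derive_coord i dc) (derC s _)) _; rewrite mulr0 addr0.
Qed.

Lemma derive_dot_grad (f : 'rV[R]_n -> R) x v : differentiable f x ->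
  'D_v f x = dot (grad f x) v.
Proof.
move=> df; rewrite derive_sum_partial//; apply: eq_bigr => i _.
by rewrite mulrC mxE.
Qed.

Lemma chain_rule (f : 'rV[R]_n -> R) (c : R -> 'rV[R]_n) w s :
  differentiable f (c s) -> is_derive s (1 : R) c w ->
  is_derive s (1 : R) (fun t => f (c t)) (dot (grad f (c s)) w).
Proof.
move=> df [dc dcw]; have dcd : differentiable c s by apply/derivable1_diffP.
apply: DeriveDef; first by apply/derivable1_diffP; exact: differentiable_comp.
rewrite deriveE; last exact: differentiable_comp.
by rewrite diff_comp//= -!deriveE// dcw derive_dot_grad.
Qed.

Lemma open_neq0 : open [set x : 'rV[R]_n | x != 0].
Proof.
have -> : [set x : 'rV[R]_n | x != 0] = ~` [set 0].
  by apply/seteqP; split => x /=; [move=> /eqP|move=> /eqP].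
apply: closed_openC; apply: accessible_closed_set1.
exact/hausdorff_accessible/norm_hausdorff.
Qed.

Section sphere_function.
Variable p : 'rV[R]_n -> R.
Hypothesis hp : smooth_on_sphere p.

Lemma radial_ext_diff x : x != 0 -> differentiable (radial_ext p) x.
Proof.
by move=> x0; have [+ _] := smooth_on_Ck 1 open_neq0 hp; exact.
Qed.

(** The radial extension is constant along rays, so its gradient at a point of
    the sphere is already tangent. *)
Lemma grad_radial_ext x : sphere x -> grad (radial_ext p) x = sgrad p x.
Proof.
move=> xS; have x0 := sphere_neq0 xS; have dx := radial_ext_diff x0.
suff H : dot (grad (radial_ext p) x) x = 0 by rewrite /sgrad /tproj H scale0r subr0.
rewrite -derive_dot_grad//.
have d1 := is_derive_line (f := radial_ext p) (x := x) (v := x) (s := 0).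
rewrite scale0r addr0 in d1; have dd : derivable (radial_ext p) x x by exact: diff_derivable.
have {}d1 := d1 dd.
have E : \forall s \near (0 : R), radial_ext p x = radial_ext p (x + s *: x).
  apply/near_ballP; exists 1 => // s; rewrite subr0 ltr_norml => /andP[s1 _].
  rewrite -[x in x + _]scale1r -scalerDl radial_extZ//; lra.
have := derC (0 : R) (radial_ext p x) => d0.
apply: der_unique d1 _; exact: near_eq_is_derive d0.
Qed.

Lemma sgrad_tangent x : sphere x -> dot (sgrad p x) x = 0.
Proof.
by move=> /sphereP xx; rewrite /sgrad /tproj !dotE xx mulr1 subrr.
Qed.

Lemma is_derive_sphere_curve (c : R -> 'rV[R]_n) w s :
  (forall t, sphere (c t)) -> is_derive s (1 : R) c w ->
  is_derive s (1 : R) (fun t => p (c t)) (dot (sgrad p (c s)) w).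
Proof.
move=> cS dc; rewrite -grad_radial_ext//.
have -> : (fun t => p (c t)) = (fun t => radial_ext p (c t)).
  by apply/funext => t; rewrite radial_ext_sphere.
by apply: chain_rule => //; apply: radial_ext_diff; exact: sphere_neq0.
Qed.

Lemma is_derive_on_circle u v s : orthonormal2 u v ->
  is_derive s (1 : R) (fun s => p (circle u v s))
    (dot (sgrad p (circle u v s)) (circle u v (s + pi / 2))).
Proof.
move=> uv; apply: is_derive_sphere_curve; last exact: is_derive_circle.
by move=> t; exact: circle_sphere.
Qed.

End sphere_function.
End dot.

(** * Tangent vectors of a regular level set *)

Section level_tangent.
Context {R : realType} {n : nat}.
Variables (p : 'rV[R]_n -> R) (y z : 'rV[R]_n).
Hypothesis hp : smooth_on_sphere p.
Hypothesis yS : sphere y.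
Variable N : 'rV[R]_n.
Hypothesis NE : N = sgrad p y.
Hypothesis N0 : N != 0.
Hypotheses (zy : dot z y = 0) (zN : dot z N = 0).

Let Q := radial_ext p.
Let x (s u : R) : 'rV[R]_n := y + s *: z + u *: N.

Let Ny : dot N y = 0. Proof. by rewrite NE; exact: sgrad_tangent. Qed.

Let xx s u : dot (x s u) (x s u) = 1 + s ^+ 2 * dot z z + u ^+ 2 * dot N N.
Proof.
rewrite /x !dotE (dotC y z) (dotC y N) (dotC N z) zy Ny zN (sphereP y).1//; ring.
Qed.

Let x_neq0 s u : x s u != 0.
Proof.
rewrite -dot_gt0 xx -addrA ltr_wpDr// addr_ge0// mulr_ge0 ?sqr_ge0 ?dot_ge0//.
Qed.

(* N is the gradient of Q at y and z is orthogonal to it, so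
   Q (y + s z + u N) = Q y + u |N|^2 + o(|s|) for |u| <= |s|: the left side takes
   values on both sides of Q y already for |u| <= e |s|. *)
Let root_near (e : R) : 0 < e <= 1 -> exists2 d, 0 < d &
  forall s, `|s| < d -> exists2 u, `|u| <= e * `|s| & Q (x s u) = Q y.
Proof.
move=> /andP[e0 e1]; have NN : 0 < dot N N by rewrite dot_gt0.
have dQ : differentiable Q y by apply: radial_ext_diff => //; exact: sphere_neq0.
pose C := `|z| + `|N| + 1.
have C0 : 0 < C by rewrite ltr_wpDl// addr_ge0.
pose eta := e * dot N N / C.
have eta0 : 0 < eta by rewrite divr_gt0// mulr_gt0.
have := diff_locally dQ => /eqaddoP/(_ eta eta0)/near_ballP[d d0 Hd].
exists (d / C); first by rewrite divr_gt0.
move=> s sd.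
have hC u : `|u| <= e * `|s| -> `|s *: z + u *: N| <= C * `|s|.
  move=> us; apply: le_trans (ler_normD _ _) _; rewrite !normrZ /C !mulrDl mul1r.
  rewrite -addrA lerD//; first by rewrite mulrC.
  rewrite (le_trans (_ : _ <= `|N| * `|s|))// ?lerDl// mulrC ler_wpM2l//.
  by apply: le_trans us _; rewrite ler_piMl.
have main u : `|u| <= e * `|s| ->
    `|Q (x s u) - Q y - u * dot N N| <= e * dot N N * `|s|.
  move=> us; have hd := hC u us.
  have hdd : `|s *: z + u *: N - 0| < d.
    by rewrite subr0; apply: le_lt_trans hd _; rewrite mulrC -ltr_pdivlMr.
  have := Hd _ hdd; have E : s *: z + u *: N + y = x s u by rewrite /x addrC addrA.
  rewrite !fctE /= E.
  have -> : 'd Q y (s *: z + u *: N) = u * dot N N.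
    rewrite -deriveE// derive_dot_grad// grad_radial_ext// -NE !dotE (dotC N z) zN.
    by rewrite mulr0 add0r.
  rewrite opprD addrA => /le_trans; apply.
  by apply: le_trans (ler_wpM2l (ltW eta0) hd) _; rewrite /eta mulrA divfK// gt_eqF.
have cQ : continuous (fun u => Q (x s u)).
  move=> u; apply: (@continuous_comp _ _ _ (x s) Q).
    apply: cvgD; first exact: cvg_cst.
    by apply: cvgZr_tmp; exact: cvg_id.
  exact: (differentiable_continuous (radial_ext_diff hp (x_neq0 s u))).
pose r := e * `|s|; have r0 : 0 <= r by rewrite mulr_ge0// ltW.
have [| | |u] := @IVT _ (fun u => Q (x s u)) (- r) r (Q y).
- by rewrite (le_trans _ r0)// oppr_le0.
- exact: continuous_subspaceT.
- apply/andP; split.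
    rewrite ge_min; apply/orP; left.
    have := main (- r); rewrite normrN ger0_norm// => /(_ (lexx _)).
    rewrite ler_norml => /andP[_]; rewrite -/r mulNr opprK (_ : e * dot N N * `|s| = r * dot N N).
      by rewrite gerDr subr_le0.
    by rewrite /r; ring.
  rewrite le_max; apply/orP; right.
  have := main r; rewrite ger0_norm// => /(_ (lexx _)).
  rewrite ler_norml => /andP[+ _]; rewrite (_ : e * dot N N * `|s| = r * dot N N); last by rewrite /r; ring.
  by rewrite lerBrDr addNr subr_ge0.
rewrite in_itv /= => ur Qu; exists u => //.
by rewrite ler_norml.
Qed.

Let roots s : set R := [set u | Q (x s u) = Q y].
Let minabs s : R := inf [set `|u| | u in roots s].
(* A root that is smallest up to s^2: the slack leaves it o(|s|), which is what
   differentiability at 0 asks for. *)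
Let sol s : R := xget 0 [set u | roots s u /\ `|u| <= minabs s + s ^+ 2].

Let sol_root s : (exists u, roots s u) -> roots s (sol s) /\ `|sol s| <= minabs s + s ^+ 2.
Proof.
move=> [u0 ru0]; have lb : has_lbound [set `|u| | u in roots s] by exists 0 => _ [u _ <-].
suff : exists u, roots s u /\ `|u| <= minabs s + s ^+ 2.
  by move=> [u hu]; apply: (@xgetPex _ 0 [set u | roots s u /\ `|u| <= minabs s + s ^+ 2]); exists u.
have [s0|s0] := eqVneq s 0.
  have r0 : roots s 0 by rewrite /roots /= s0 /x !scale0r !addr0.
  exists 0; split=> //; rewrite normr0 addr_ge0 ?sqr_ge0//.
  by apply: lb_le_inf; [exists `|0 : R|; exists 0|move=> _ [u _ <-]].
have hi : has_inf [set `|u| | u in roots s] by split=> //; exists `|u0|, u0.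
have [|_ [u ru <-] us] := @inf_adherent _ _ (s ^+ 2) _ hi.
  by rewrite lt_neqAle sqr_ge0 eq_sym sqrf_eq0 s0.
by exists u; split=> //; exact: ltW.
Qed.

Let sol_small (e : R) : 0 < e -> exists2 d, 0 < d & forall s, `|s| < d ->
  roots s (sol s) /\ `|sol s| <= e * `|s|.
Proof.
move=> e0; pose e1 := Num.min 1 (e / 2).
have e10 : 0 < e1 <= 1 by rewrite lt_min ltr01 divr_gt0//= ge_min lexx.
have [d d0 Hd] := root_near e10.
exists (Num.min d (e / 2)); first by rewrite lt_min d0 divr_gt0.
move=> s; rewrite lt_min => /andP[sd se].
have [u us ru] := Hd s sd.
have [] := sol_root (ex_intro _ u ru); split=> //.
apply: le_trans (_ : minabs s + s ^+ 2 <= _) => //.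
rewrite [e]splitr mulrDl lerD//.
  apply: le_trans (_ : `|u| <= _).
    apply: inf_lbound; last by exists u.
    by exists 0 => _ [v _ <-].
  by apply: le_trans us _; rewrite ler_wpM2r// ge_min lexx orbT.
by rewrite -real_normK ?num_real// expr2 ler_wpM2r// ltW.
Qed.

Let sol0 : sol 0 = 0.
Proof.
have [d d0 Hd] := sol_small ltr01.
have [|_] := Hd 0; first by rewrite normr0.
by rewrite normr0 mulr0 normr_le0 => /eqP.
Qed.

Let dsol : is_derive (0 : R) (1 : R) sol 0.
Proof.
apply/is_derive1_caratheodory.
exists (fun s => if s == 0 then 0 else sol s / s); split.
- move=> s; rewrite sol0 !subr0; case: eqVneq => [->|s0]; first by rewrite sol0 mul0r.
  by rewrite divfK.
- apply/cont_ballP => e e0; have e20 : 0 < e / 2 by rewrite divr_gt0.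
  have [d d0 Hd] := sol_small e20; exists d => // s; rewrite subr0 eqxx subr0 => sd.
  case: eqVneq => [_|s0]; first by rewrite normr0.
  rewrite normrM normfV ltr_pdivrMr ?normr_gt0//.
  have [_ /le_lt_trans] := Hd s sd; apply; rewrite ltr_pM2r ?normr_gt0//.
  by rewrite ltr_pdivrMr// mulr_natr mulr2n ltrDl.
by rewrite eqxx.
Qed.

Lemma level_tangent_aux : tangent_vector (level p (p y)) y z.
Proof.
exists (fun s => (enorm (x s (sol s)))^-1 *: x s (sol s)).
have x0 : x 0 (sol 0) = y by rewrite /x sol0 !scale0r !addr0.
split.
- by rewrite x0 (yS : enorm y = 1) invr1 scale1r.
- have [d d0 Hd] := sol_small ltr01; apply/near_ballP; exists d => // s.
  rewrite subr0 => /Hd[r _]; split; first exact: normalize_sphere (x_neq0 _ _).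
  by rewrite -[LHS]/(Q (x s (sol s))) r /Q radial_ext_sphere.
- apply: derivable_rV => i.
  pose f s := (Num.sqrt (1 + s ^+ 2 * dot z z + sol s ^+ 2 * dot N N))^-1.
  have -> : (fun s => ((enorm (x s (sol s)))^-1 *: x s (sol s)) 0 i) =
      (fun s => f s * (y 0 i + s * z 0 i + sol s * N 0 i)).
    by apply/funext => s; rewrite !mxE /enorm xx.
  have f0 : f 0 = 1 by rewrite /f sol0 expr0n !mul0r !addr0 sqrtr1 invr1.
  have df : is_derive (0 : R) (1 : R) f 0.
    pose g (s : R) := 1 + s ^+ 2 * dot z z + sol s ^+ 2 * dot N N.
    have g0 : g 0 = 1 by rewrite /g sol0 expr0n !mul0r !addr0.
    have dg : is_derive (0 : R) (1 : R) g 0.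
      have dsol2 := @der_comp _ (fun t => t ^+ 2) sol 0 _ _ (der_exp 2 (sol 0)) dsol.
      apply: derE (derD (derD (derC 0 1) (derM (der_exp 2 0) (derC 0 (dot z z))))
        (derM dsol2 (derC 0 (dot N N)))) _.
      by rewrite sol0; ring.
    have ds : is_derive (g 0) (1 : R) Num.sqrt (2 * Num.sqrt (g 0))^-1.
      by rewrite g0; apply: is_derive1_sqrt.
    have dsg := der_comp ds dg.
    by apply: derE (derV _ dsg) _; rewrite ?g0 ?sqrtr1 ?oner_neq0// !mulr0.
  apply: derE (derM df (derD (derD (derC 0 (y 0 i)) (derM (derX 0) (derC 0 (z 0 i))))
     (derM dsol (derC 0 (N 0 i))))) _.
  by rewrite f0 sol0; ring.
Qed.

End level_tangent.

(** The implicit function theorem, in the weak form that velocities require: the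
    intermediate value theorem gives a root of p on each line y + s z + u N, with
    u = o(s). The resulting curve in the level set has velocity z at 0, although
    it need not be continuous elsewhere. *)
Lemma level_tangent {R : realType} {n : nat} (p : 'rV[R]_n -> R) (y z : 'rV[R]_n) :
  smooth_on_sphere p -> sphere y -> sgrad p y != 0 -> dot z y = 0 ->
  dot z (sgrad p y) = 0 -> tangent_vector (level p (p y)) y z.
Proof. by move=> hp yS N0 zy zN; exact: (level_tangent_aux hp yS erefl). Qed.

(** * Great circles and the spherical triangle inequality *)

Section great_circles.
Context {R : realType} {n : nat}.

Lemma ex_orthogonal_unit (m : 'rV[R]_n) : (1 < n)%N ->
  sphere m -> exists2 v, sphere v & dot m v = 0.
Proof.
move=> n1 mS; have mm := (sphereP m).1 mS.
suff [w w0 mw] : exists2 w, w != 0 & dot m w = 0.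
  by exists ((enorm w)^-1 *: w); [exact: normalize_sphere|rewrite dotZr mw mulr0].
pose i0 := Ordinal (ltnW n1); pose i1 := Ordinal n1.
pose w i := basis_vec i - m 0 i *: m.
have wm i : dot m (w i) = 0 by rewrite /w dotBr dotZr mm mulr1 dot_basis subrr.
have [w0|w0] := eqVneq (w i0) 0; last by exists (w i0).
exists (w i1) => //; apply: contraTneq isT => w1; apply/negP => _.
have e0 : basis_vec i0 = m 0 i0 *: m by apply/eqP; rewrite -subr_eq0; apply/eqP.
have e1 : basis_vec i1 = m 0 i1 *: m by apply/eqP; rewrite -subr_eq0; apply/eqP.
have b00 : m 0 i0 * m 0 i0 = 1.
  by have := congr1 (fun v : 'rV[R]_n => v 0 i0) e0; rewrite !mxE !eqxx.
have b11 : m 0 i1 * m 0 i1 = 1.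
  by have := congr1 (fun v : 'rV[R]_n => v 0 i1) e1; rewrite !mxE !eqxx.
have b01 : m 0 i0 * m 0 i1 = 0.
  by have := congr1 (fun v : 'rV[R]_n => v 0 i1) e0; rewrite !mxE /=.
have : (m 0 i0 * m 0 i1) * (m 0 i0 * m 0 i1) = 1 by rewrite mulrACA b00 b11 mul1r.
by rewrite b01 mul0r => /eqP; rewrite eq_sym oner_eq0.
Qed.

(** Gram-Schmidt. When x is m or its antipode, v is any unit vector orthogonal
    to m. *)
Lemma circle_through (m x : 'rV[R]_n) (t : R) : (1 < n)%N ->
  sphere m -> sphere x -> 0 <= t <= pi -> dot x m = cos t ->
  exists2 v, orthonormal2 m v & x = circle m v t.
Proof.
move=> n1 mS xS /andP[t0 tpi] xm.
have mm := (sphereP m).1 mS; have xx := (sphereP x).1 xS.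
have s2 : dot (x - cos t *: m) (x - cos t *: m) = sin t ^+ 2.
  by rewrite !dotE (dotC m x) xm xx mm sin2cos2; ring.
have [st|st] := eqVneq (sin t) 0.
  have [v vS mv] := ex_orthogonal_unit n1 mS; exists v; first by split.
  apply/eqP; rewrite /circle st scale0r addr0 -subr_eq0 -dot_eq0 s2 st.
  by rewrite expr0n.
exists ((sin t)^-1 *: (x - cos t *: m)).
  split=> //; last by rewrite !dotE (dotC m x) xm mm mulr1 subrr mulr0.
  apply/sphereP; rewrite dotZl dotZr s2; field.
  exact: st.
by rewrite /circle scalerA divff// scale1r addrC subrK.
Qed.

(** The Cauchy-Schwarz inequality for the components of x and z orthogonal
    to y. *)
Lemma spherical_triangle (x y z : 'rV[R]_n) (a b : R) :
  sphere x -> sphere y -> sphere z -> 0 <= sin a -> 0 <= sin b ->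
  dot x y = cos a -> dot y z = cos b -> cos (a + b) <= dot x z <= cos (a - b).
Proof.
move=> /sphereP xx /sphereP yy /sphereP zz a0 b0 xy yz.
pose X := x - cos a *: y; pose Z := z - cos b *: y.
have hX : dot X X = sin a ^+ 2.
  by rewrite /X !dotE (dotC y x) xx yy xy sin2cos2; ring.
have hZ : dot Z Z = sin b ^+ 2.
  by rewrite /Z !dotE (dotC z y) zz yy yz sin2cos2; ring.
have hXZ : dot X Z = dot x z - cos a * cos b.
  by rewrite /X /Z !dotE yy xy yz; ring.
have := cauchy_schwarz X Z; rewrite hX hZ hXZ cosD cosB -exprMn => H.
have S0 : 0 <= sin a * sin b by rewrite mulr_ge0.
by apply/andP; split; nra.
Qed.

End great_circles.

(** * Leaves and normal great circles *)

(** The properties of the foliation that the argument relies on, normalised so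
    that p takes the value 1 on M 0. The polynomial is replaced by the forms it
    induces on great circles, and the distance to M 0 by the largest dot product
    with a point of M 0, which is attained. *)
Record foliation_data {R : realType} {n : nat} (d : nat) (M : R -> set 'rV[R]_n)
    (p : 'rV[R]_n -> R) (a : R -> R) : Prop := FoliationData {
  fd_d : (0 < d)%N;
  fd_n : (2 < n)%N;
  fd_smooth : smooth_on_sphere p;
  fd_trig : forall u v, orthonormal2 u v -> trig_form d (fun s => p (circle u v s));
  fd_grad : forall x, sphere x -> dot (sgrad p x) (sgrad p x) = a (p x);
  fd_bound : forall x, sphere x -> -1 <= p x <= 1;
  fd_reg : forall x, sphere x -> -1 < p x < 1 -> sgrad p x != 0;
  fd_crit : forall x, sphere x -> p x = 1 \/ p x = -1 -> sgrad p x = 0;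
  fd_M0 : M 0 = level p 1;
  fd_ML : M (pi / d%:R) = level p (-1);
  fd_ML0 : level p (-1) !=set0;
  fd_leaf : forall t, 0 <= t <= pi / d%:R -> M t !=set0 /\ exists s, M t = level p s;
  fd_cover : forall x, sphere x -> exists2 t, 0 <= t <= pi / d%:R & M t x;
  fd_dist : forall t x, 0 <= t <= pi / d%:R -> M t x ->
    (forall y, M 0 y -> dot x y <= cos t) /\ exists2 y, M 0 y & dot x y = cos t }.

Lemma der_local_max {R : realType} (f : R -> R) (l : R) : is_derive (0 : R) (1 : R) f l ->
  (\forall s \near (0 : R), f s <= f 0) -> l = 0.
Proof.
move=> /is_derive1_caratheodory[g [fg /cont_ballP cg g0]] /near_ballP[d d0 fd].
apply/eqP; apply/negPn/negP => l0; have l1 : 0 < `|l| by rewrite normr_gt0.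
have [d' d'0 gd'] := cg _ l1.
have [m m0 [md md']] := ex_lt2 d0 d'0.
have [lp|ln] := ltP 0 l.
  have := gd' m; rewrite subr0 gtr0_norm// g0 => /(_ md').
  rewrite [`|l|]gtr0_norm// ltr_norml => /andP[gm _].
  have := fd m; rewrite subr0 gtr0_norm// => /(_ md).
  rewrite -subr_le0 fg subr0 leNgt pmulr_lgt0//; move: gm; lra.
have ln' : l < 0 by rewrite lt_neqAle l0.
have := gd' (- m); rewrite subr0 normrN gtr0_norm// g0 => /(_ md').
rewrite [`|l|]ltr0_norm// ltr_norml => /andP[_ gm].
have := fd (- m); rewrite subr0 normrN gtr0_norm// => /(_ md).
rewrite -subr_le0 fg subr0 mulrN -mulNr leNgt pmulr_lgt0//; move: gm; lra.
Qed.

(** A unit vector w that is normal to the level set is, up to sign, the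
    normalised gradient, for w minus its component along the gradient is tangent
    to the level set. Along curves orthogonal to the levels this turns
    |grad p|^2 = a o p into a differential equation. *)
Lemma normal_gradient {R : realType} {n : nat} (p : 'rV[R]_n -> R) (y w : 'rV[R]_n) :
  smooth_on_sphere p -> sphere y -> sphere w -> dot w y = 0 -> sgrad p y != 0 ->
  (forall z, tangent_vector (level p (p y)) y z -> dot w z = 0) ->
  dot (sgrad p y) w ^+ 2 = dot (sgrad p y) (sgrad p y).
Proof.
move=> hp yS /sphereP ww wy N0 H.
have Ny := sgrad_tangent p yS; move: N0 Ny.
have T z := level_tangent (z := z) hp yS; move: T.
move: (sgrad p y) => N T N0 Ny.
have NN : dot N N != 0 by rewrite dot_eq0.
pose l := dot w N / dot N N.
have z1 : dot (w - l *: N) y = 0 by rewrite !dotE wy Ny mulr0 subrr.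
have z2 : dot (w - l *: N) N = 0 by rewrite !dotE /l divfK// subrr.
have := H _ (T _ N0 z1 z2); rewrite !dotE ww => /eqP.
by rewrite subr_eq0 (dotC N w) /l => /eqP E; rewrite -[RHS]mul1r E; field.
Qed.

Lemma dot_le1 {R : realType} {n : nat} (x y : 'rV[R]_n) :
  sphere x -> sphere y -> dot x y <= 1.
Proof.
move=> /sphereP xx /sphereP yy; have := dot_ge0 (x - y).
rewrite !dotE xx yy (dotC y); lra.
Qed.

Lemma dot_itv {R : realType} {n : nat} (x y : 'rV[R]_n) :
  sphere x -> sphere y -> -1 <= dot x y <= 1.
Proof.
move=> xS yS; rewrite dot_le1// andbT -[dot x y]opprK -dotNl lerN2 dot_le1//.
by apply/sphereP; rewrite dotNl dotNr opprK; exact/sphereP.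
Qed.

Section foliation.
Context {R : realType} {n d : nat}.
Variables (M : R -> set 'rV[R]_n) (p : 'rV[R]_n -> R) (a : R -> R).
Hypothesis fd : foliation_data d M p a.
Notation L := (pi / d%:R : R).
Implicit Types (x y m u v w : 'rV[R]_n) (s t : R).

Let n1 : (1 < n)%N. Proof. exact: ltnW (fd_n fd). Qed.

Lemma L_gt0 : 0 < L.
Proof. exact: pi_div_gt0 (fd_d fd). Qed.

Lemma L_lepi : L <= pi.
Proof. exact: pi_div_le (fd_d fd). Qed.

Lemma dL : d%:R * L = pi.
Proof. exact: pi_divK (fd_d fd). Qed.

Lemma leaf_sphere t x : 0 <= t <= L -> M t x -> sphere x.
Proof. by move=> tL; have [_ [s ->]] := fd_leaf fd tL => -[]. Qed.

Lemma leaf_level t x : 0 <= t <= L -> M t x -> M t = level p (p x).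
Proof. by move=> tL; have [_ [s ->]] := fd_leaf fd tL => -[_ ->]. Qed.

Lemma cos_leaf_le s t : 0 <= s <= L -> 0 <= t <= L -> cos s <= cos t -> t <= s.
Proof.
move=> /andP[s0 sL] /andP[t0 tL]; have := L_lepi => Lpi; rewrite leNgt => /negP H.
rewrite leNgt; apply/negP => st; apply: H.
by rewrite ltr_cos// ?in_itv /= ?s0 ?t0/= ?(le_trans _ Lpi).
Qed.

Lemma leaf_uniq s t x : 0 <= s <= L -> 0 <= t <= L -> M s x -> M t x -> s = t.
Proof.
move=> hs ht Ms Mt; have [h1 [y1 M1 d1]] := fd_dist fd hs Ms.
have [h2 [y2 M2 d2]] := fd_dist fd ht Mt.
apply/eqP; rewrite eq_le; apply/andP; split; apply: cos_leaf_le => //.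
  by rewrite -d2; exact: h1.
by rewrite -d1; exact: h2.
Qed.

Lemma M0_sphere m : M 0 m -> sphere m.
Proof. by apply: leaf_sphere; rewrite lexx ltW// L_gt0. Qed.

(** A geodesic that realises the distance to M 0 crosses M s at time s: if one of
    its points had a shorter way to M 0, then so would x, by the triangle
    inequality. *)
Lemma min_geodesic t x : 0 <= t <= L -> M t x -> exists m v,
  [/\ M 0 m, orthonormal2 m v, x = circle m v t &
      forall s, 0 <= s <= t -> M s (circle m v s)].
Proof.
move=> tL Mt; have [xle [m M0m xm]] := fd_dist fd tL Mt.
have xS := leaf_sphere tL Mt; have mS := M0_sphere M0m.
have Lpi := L_lepi; have /andP[t0 tL'] := tL.
have tpi : 0 <= t <= pi by rewrite t0 (le_trans tL').
have [v mv xE] := circle_through n1 mS xS tpi xm.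
exists m, v; split=> // s /andP[s0 st].
have cS := circle_sphere s mv.
have [r rL Mr] := fd_cover fd cS; have /andP[r0 rL'] := rL.
suff rs : r = s by rewrite -{1}rs.
have [cle [m' M0m' cm']] := fd_dist fd rL Mr.
have sL : 0 <= s <= L by rewrite s0 (le_trans st).
have rs : r <= s.
  apply: cos_leaf_le => //; have := cle m M0m.
  by rewrite -{2}[m](circle0 m v) dot_circle// subr0.
have := spherical_triangle (a := t - s) (b := r) xS cS (M0_sphere M0m').
rewrite {1}xE dot_circle// => T.
have {T}/andP[T _] : cos (t - s + r) <= dot x m' <= cos (t - s - r).
  by apply: T => //; apply: sin_ge0_pi; apply/andP; split; lra.
have : t <= t - s + r.
  have hc : cos (t - s + r) <= cos t by apply: le_trans T _; exact: xle.
  by apply: cos_leaf_le => //; apply/andP; split; lra.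
by move=> ?; apply/le_anti/andP; split=> //; lra.
Qed.

(** A minimising geodesic from M 0 to M L visits all leaves, and by the first
    variation of the distance to M 0 it is orthogonal to them; p restricted to it
    is the function phi. *)
Lemma profile_ode : exists phi phi' : R -> R,
  [/\ trig_form d phi, forall s, is_derive s (1 : R) phi (phi' s),
      forall s, 0 <= s <= L -> exists2 x, M s x & p x = phi s,
      phi 0 = 1 /\ phi L = -1 &
      forall s, 0 < s < L -> phi' s ^+ 2 = a (phi s) /\ phi' s != 0].
Proof.
have L0 := L_gt0; have LL : 0 <= L <= L by rewrite lexx ltW.
have [x xL] : exists x, M L x by rewrite (fd_ML fd); exact: (fd_ML0 fd).
have [m [v [M0m mv xE Ms]]] := min_geodesic LL xL.
pose phi' s := dot (sgrad p (circle m v s)) (circle m v (s + pi / 2)).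
have dphi s : is_derive s (1 : R) (fun s => p (circle m v s)) (phi' s).
  exact: (is_derive_on_circle (fd_smooth fd) s mv).
have phi0 : p (circle m v 0) = 1.
  by have := M0m; rewrite circle0 (fd_M0 fd) => -[].
have phiL : p (circle m v L) = -1.
  by have := xL; rewrite -xE (fd_ML fd) => -[].
exists (fun s => p (circle m v s)), phi'; split=> //.
- exact: (fd_trig fd mv).
- by move=> s sL; exists (circle m v s) => //; exact: Ms.
move=> s /andP[s0 sL].
have sL' : 0 <= s <= L by rewrite !ltW.
have cS := circle_sphere s mv.
have Msc := Ms s sL'.
have pn : -1 < p (circle m v s) < 1.
  have /andP[b1 b2] := fd_bound fd cS.
  rewrite !lt_neqAle b1 b2 !andbT; apply/andP; split; apply/eqP => E.
    have : M L (circle m v s) by rewrite (fd_ML fd).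
    by move=> /(leaf_uniq sL' LL Msc) sE; move: sL; rewrite sE ltxx.
  have : M 0 (circle m v s) by rewrite (fd_M0 fd).
  have L0' : 0 <= (0 : R) <= L by rewrite lexx ltW.
  by move=> /(leaf_uniq sL' L0' Msc) sE; move: s0; rewrite sE ltxx.
have reg := fd_reg fd cS pn.
suff E : phi' s ^+ 2 = a (p (circle m v s)).
  split=> //; rewrite -sqrf_eq0 E -(fd_grad fd cS) dot_eq0.
  exact: reg.
rewrite -(fd_grad fd cS); have [tS1 tS2 tS3] := orthonormal2_tangent s mv.
apply: normal_gradient => //; [exact: (fd_smooth fd)|by rewrite dotC|].
move=> z [k [k0 kn dk]].
have Mlev : M s = level p (p (circle m v s)) by exact: leaf_level.
(* First variation: on the leaf the dot product with m is maximal at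
   circle m v s, so z is orthogonal to m, hence to the velocity of the circle. *)
have mle t : M s (k t) -> dot (k t) m <= cos s.
  by move=> Mk; have [+ _] := fd_dist fd sL' Mk; exact.
have zm : dot z m = 0.
  apply: (der_local_max (is_derive_dot m dk)).
  apply: filterS kn => t kt; rewrite k0.
  have -> : dot (circle m v s) m = cos s.
    by rewrite -{2}[m](circle0 m v) dot_circle// subr0.
  by apply: mle; rewrite Mlev.
have mE : m = cos s *: circle m v s - sin s *: circle m v (s + pi / 2).
  by have := circleD m v s (- s); rewrite subrr circle0 cosN sinN scaleNr.
have zc : dot z (circle m v s) = 0.
  apply: (der_local_max (is_derive_dot _ dk)).
  apply: filterS kn => t [kt _]; rewrite k0 ((sphereP _).1 cS).
  exact: dot_le1.
have := congr1 (dot z) mE; rewrite dotBr !dotZr zm zc mulr0 sub0r => /esym/eqP.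
rewrite oppr_eq0 mulf_eq0 gt_eqF/=; first by rewrite dotC => /eqP.
by rewrite sin_gt0_pi// s0 (lt_le_trans sL L_lepi).
Qed.

Section normal_circle.
Variables (u v : 'rV[R]_n).
Hypothesis uv : orthonormal2 u v.
Hypothesis M0u : M 0 u.
Hypothesis MLuv : exists s, M L (circle u v s).
Hypothesis normal : forall s t w, 0 <= t <= L -> M t (circle u v s) ->
  tangent_vector (M t) (circle u v s) w -> dot (circle u v (s + pi / 2)) w = 0.

(** Both the given great circle and the minimising geodesic of [profile_ode]
    start from M 0 and carry solutions of the same equation; by [chebyshev_cos]
    the solution is cos (d s). The minimising geodesic reaches M t at time t,
    which gives the value of p on M t, and differentiating cos (d s) gives a. *)
Lemma normal_circle_leaves :
  (forall s, p (circle u v s) = cos (d%:R * s)) /\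
  (forall t, 0 <= t <= L -> M t = level p (cos (d%:R * t))) /\
  (forall s, a (cos (d%:R * s)) = (d%:R * sin (d%:R * s)) ^+ 2).
Proof.
have L0 := L_gt0; have LL : 0 <= L <= L by rewrite lexx ltW.
have [phi [phi' [hphi dphi Mphi [phi0 phiL] phiE]]] := profile_ode.
pose q s := p (circle u v s).
pose q' s := dot (sgrad p (circle u v s)) (circle u v (s + pi / 2)).
have hq : trig_form d q by exact: (fd_trig fd uv).
have dq s : is_derive s (1 : R) q (q' s).
  exact: (is_derive_on_circle (fd_smooth fd) s uv).
have q1 s : -1 <= q s <= 1 by apply: (fd_bound fd); exact: circle_sphere.
have q0 : q 0 = 1 by have := M0u; rewrite /q circle0 (fd_M0 fd) => -[].
have qn1 : exists s, q s != 1.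
  have [s] := MLuv; rewrite (fd_ML fd) => -[_ ps]; exists s; rewrite /q ps.
  by apply/eqP; lra.
have qE s : q' s ^+ 2 = a (q s).
  have cS := circle_sphere s uv; rewrite /q -(fd_grad fd cS).
  have [N0|N0] := eqVneq (sgrad p (circle u v s)) 0.
    by rewrite /q' N0 !dot0l expr0n.
  have [tS1 tS2 tS3] := orthonormal2_tangent s uv.
  apply: normal_gradient => //; [exact: (fd_smooth fd)|by rewrite dotC|].
  move=> z; have [t tL Mt] := fd_cover fd cS.
  by rewrite -(leaf_level tL Mt); exact: normal tL Mt.
have qcos := chebyshev_cos (fd_d fd) hphi hq dphi dq phi0 phiL
  (fun s h => (phiE s h).1) (fun s h => (phiE s h).2) q0 q1 qn1 qE.
have qphi := eikonal_trig_form L0 hphi hq dphi dq phi0 phiL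
  (fun s h => (phiE s h).1) (fun s h => (phiE s h).2) q0
  (fun s => (andP (q1 s)).2) qn1 qE.
split=> //; split=> [t tL|s].
  by have [x Mx px] := Mphi t tL; rewrite (leaf_level tL Mx) px -qphi qcos.
rewrite -qcos -qE.
suff -> : q' s = - (d%:R * sin (d%:R * s)) by rewrite sqrrN.
have qf : q = (fun s => cos (d%:R * s)) by apply/funext.
have dqs := dq s; rewrite qf in dqs.
have := @der_comp _ cos (fun s => d%:R * s) s _ _ (is_derive_cos _) (derMl d%:R (derX s)).
by move=> /(der_unique dqs) ->; ring.
Qed.

End normal_circle.

Section leaves.
Hypothesis leaves : forall t, 0 <= t <= L -> M t = level p (cos (d%:R * t)).

(** The distance from x to M 0, read off from p = cos (d t) on M t. *)
Definition angle x : R := acos (p x) / d%:R.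

Lemma angle_itv x : sphere x -> 0 <= angle x <= L.
Proof.
move=> /(fd_bound fd) px; have d0 : 0 < d%:R :> R by rewrite ltr0n (fd_d fd).
by rewrite divr_ge0 ?acos_ge0 ?(ltW d0)//= ler_pM2r ?invr_gt0// acos_lepi.
Qed.

Lemma cos_angle x : sphere x -> cos (d%:R * angle x) = p x.
Proof.
move=> /(fd_bound fd) px; rewrite /angle mulrC divfK ?acosK ?in_itv//.
by rewrite pnatr_eq0 -lt0n (fd_d fd).
Qed.

Lemma leaf_angle x : sphere x -> M (angle x) x.
Proof. by move=> xS; rewrite leaves ?angle_itv//; split=> //; rewrite cos_angle. Qed.

Lemma angle_cos t x : 0 <= t <= L -> p x = cos (d%:R * t) -> angle x = t.
Proof.
move=> /andP[t0 tL] px; rewrite /angle px cosK; first by rewrite mulrC mulKf// pnatr_eq0 -lt0n (fd_d fd).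
by rewrite in_itv /= mulr_ge0//= -dL ler_pM2l// ltr0n (fd_d fd).
Qed.

(** The distance to M 0 is 1-Lipschitz: triangle inequality with a point of M 0
    closest to y. *)
Lemma dot_leaves x y : sphere x -> sphere y -> dot x y <= cos (angle x - angle y).
Proof.
wlog xy : x y / angle y <= angle x.
  move=> W xS yS; have [/W|/ltW/W] := leP (angle y) (angle x); first exact.
  by rewrite dotC -cosN opprB; apply.
move=> xS yS; have xL := angle_itv xS; have yL := angle_itv yS.
have [_ [m M0m ym]] := fd_dist fd yL (leaf_angle yS).
have [xle _] := fd_dist fd xL (leaf_angle xS).
have mS := M0_sphere M0m.
have xm1 := dot_itv xS mS.
have ca := acosK (x := dot x m); rewrite in_itv /= in ca; have {}ca := ca xm1.
have Lpi := L_lepi; have a0 := acos_ge0 xm1; have api := acos_lepi xm1.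
have /andP[x0 x1] := xL; have /andP[y0 y1] := yL.
have my : dot m y = cos (angle y) by rewrite dotC.
have := spherical_triangle (a := acos (dot x m)) (b := angle y) xS mS yS.
rewrite ca => T.
have {T}/andP[_ T] : cos (acos (dot x m) + angle y) <= dot x y <= cos (acos (dot x m) - angle y).
  by apply: T => //; apply: sin_ge0_pi; apply/andP; split; lra.
apply: le_trans T _.
have H : angle x <= acos (dot x m).
  rewrite leNgt; apply/negP => H; have := xle m M0m; rewrite -ca leNgt => /negP; apply.
  by rewrite ltr_cos ?in_itv//=; apply/andP; split; lra.
rewrite leNgt; apply/negP; rewrite ltr_cos ?in_itv/=; first lra.
  by apply/andP; split; lra.
by apply/andP; split; lra.
Qed.

(** The equality p = cos (d s) holds on the minimising arc from M 0 to x, hence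
    on the whole circle because both sides are forms. *)
Lemma ex_normal_circle x : sphere x -> p x != 1 -> exists u v t,
  [/\ orthonormal2 u v, 0 < t <= L, x = circle u v t &
      forall s, p (circle u v s) = cos (d%:R * s)].
Proof.
move=> xS px; have xL := angle_itv xS.
have [m [v [M0m mv xE Ms]]] := min_geodesic xL (leaf_angle xS).
exists m, v, (angle x); split=> //.
  case/andP: xL => x0 ->; rewrite andbT lt_neqAle x0 andbT eq_sym.
  by apply: contra px => /eqP a0; rewrite -cos_angle// a0 mulr0 cos0.
move=> s; apply/eqP; rewrite -subr_eq0; apply/eqP.
have x0 : 0 < angle x.
  case/andP: xL => x0 _; rewrite lt_neqAle x0 andbT eq_sym.
  by apply: contra px => /eqP a0; rewrite -cos_angle// a0 mulr0 cos0.
have [hc _] := @trig_form_multiple R d.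
apply: (trig_form_eq0_near (trig_formB (fd_trig fd mv) hc) x0 (a := 0)) => r.
rewrite add0r => /andP[r0 rx].
have rL : 0 <= r <= L by rewrite (ltW r0) (le_trans (ltW rx))//; case/andP: xL.
have := Ms r; rewrite (ltW r0) (ltW rx) leaves// => /(_ isT)[_ ->].
by rewrite subrr.
Qed.

End leaves.
End foliation.

Arguments angle {R n} d p x.

(** * Normalisation of an isoparametric foliation *)

Section compactness.
Context {R : realType} {n : nat}.

Lemma dot_continuous (x : 'rV[R]_n) : continuous (dot x).
Proof.
apply: (continuous_big (@add_continuous R)) => i _ h.
exact: cvgMl_tmp (@coord_continuous R 1 n 0 i h).
Qed.

Lemma dot_self_continuous :
  continuous (fun x : 'rV[R]_n => dot x x).
Proof.
apply: (continuous_big (@add_continuous R)) => i _ h.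
have c := @coord_continuous R 1 n 0 i h; exact: (cvgM c c).
Qed.

Lemma sphere_closed : closed (@sphere R n).
Proof.
have -> : @sphere R n = (fun x => dot x x) @^-1` [set 1].
  by apply/seteqP; split => x /=; rewrite sphereP.
apply: closed_comp; first by move=> x _; exact: dot_self_continuous.
exact: closed_eq.
Qed.

Lemma sphere_bounded : bounded_set (@sphere R n).
Proof.
exists 1; split=> // e e1 x /sphereP xx; apply: mx_norm_le; first by rewrite ltW// (lt_trans _ e1).
move=> i; apply: le_trans (ltW e1); rewrite -[1]sqrtr1 -sqrtr_sqr ler_wsqrtr//.
rewrite -xx /dot (bigD1 i)//= expr2 lerDl sumr_ge0// => j _.
by rewrite -expr2 sqr_ge0.
Qed.

Lemma sphere_compact : compact (@sphere R n).
Proof. by apply: bounded_closed_compact; [exact: sphere_bounded|exact: sphere_closed]. Qed.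

Lemma level_compact (p : 'rV[R]_n -> R) (s : R) :
  smooth_on_sphere p -> compact (level p s).
Proof.
move=> hp; apply: bounded_closed_compact.
  by have [M [Mr HM]] := sphere_bounded; exists M; split=> // e /HM H x [/H].
move=> x hx; have xS : sphere x.
  by apply: sphere_closed; apply: closure_subset hx => y [].
split=> //; apply/eqP; apply/negPn/negP => ps.
have dQ := radial_ext_diff hp (sphere_neq0 xS).
have /cont_ballP H := differentiable_continuous dQ.
have e0 : 0 < `|p x - s| by rewrite normr_gt0 subr_eq0.
have [d d0 Hd] := H _ e0.
have nb : nbhs x [set y | `|y - x| < d] by apply/(near_ballP (fun y => `|y - x| < d) x); exists d.
have [y [[yS py] yx]] := hx _ nb.
by have := Hd y yx; rewrite !radial_ext_sphere// py distrC ltxx.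
Qed.

End compactness.

Section foliation_dataP.
Context {R : realType} {n d : nat}.
Variable M : R -> set 'rV[R]_n.
Notation L := (pi / d%:R : R).

(** The hypotheses that do not tell the two focal leaves apart. *)
Let oriented_hyps (p : 'rV[R]_n -> R) (a : R -> R) :=
  [/\ smooth_on_sphere p,
      forall u v, orthonormal2 u v -> trig_form d (fun s => p (circle u v s)),
      forall x, sphere x -> dot (sgrad p x) (sgrad p x) = a (p x),
      forall x, sphere x -> -1 <= p x <= 1
    & p @` critical_point p = [set 1; -1]] /\
  M @` `[0, L] = [set B | B !=set0 /\ exists s, B = level p s].

(** The leaf M 0 may be p^-1(1) or p^-1(-1); changing the sign of p leads from
    one case to the other. *)
Let oriented_hypsN p a : oriented_hyps p a -> oriented_hyps (fun x => - p x) (fun y => a (- y)).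
Proof.
move=> [[hp ht ha hb hc] hM].
have RE : radial_ext (fun x => - p x) = (fun x => - radial_ext p x) by [].
have gN x : sphere x -> sgrad (fun x => - p x) x = - sgrad p x.
  move=> xS; rewrite /sgrad RE; have dx := radial_ext_diff hp (sphere_neq0 xS).
  have -> : grad (fun x => - radial_ext p x) x = - grad (radial_ext p) x.
    apply/rowP => i; rewrite !mxE /partial.
    by apply: deriveN; exact: diff_derivable.
  by rewrite /tproj dotNl scaleNr opprK opprB addrC.
have lN s : level (fun x => - p x) s = level p (- s).
  by apply/seteqP; split => x [xS ps]; split=> //; rewrite -?ps ?opprK// ps opprK.
split; first split.
- by apply: Ck_smooth_on => k; rewrite RE; apply: CkN; [exact: open_neq0|apply: smooth_on_Ck => //; exact: open_neq0].
- by move=> u v uv; apply: eq_trig_form (trig_formZ (-1) (ht u v uv)) => s; rewrite mulN1r.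
- by move=> x xS; rewrite gN// dotNl dotNr !opprK ha.
- by move=> x /hb; lra.
- have cN : critical_point (fun x => - p x) = critical_point p.
    apply/seteqP; split => x [xS]; rewrite ?gN// => h; split=> //.
      by apply/eqP; rewrite -oppr_eq0 h.
    by rewrite gN// h oppr0.
  rewrite cN; apply/seteqP; split => y.
    move=> [x xc <-]; have : (p @` critical_point p) (p x) by exists x.
    by rewrite hc => -[] ->; [right|left; rewrite opprK].
  move=> hy; have : [set 1; -1] (- y) by case: hy => ->; [right|left; rewrite opprK].
  by rewrite -hc => -[x xc px]; exists x => //; rewrite px opprK.
- rewrite hM; apply/seteqP; split => B [B0 [s E]]; split=> //; rewrite E.
    by exists (- s); rewrite lN opprK.
  by exists (- s); rewrite lN.
Qed.

(** Compactness of M 0 makes the distance to it attained. *)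
Let oriented_foliation_data p a : (0 < d)%N -> (2 < n)%N -> oriented_hyps p a -> M 0 = level p 1 -> M L = level p (-1) ->
  (forall t x, t \in `[0, L] -> M t x -> sphere_dist_set x (M 0) = t) ->
  foliation_data d M p a.
Proof.
move=> d0 n2 [[hp ht ha hb hc] hM] M0 ML hdist.
have crit y : [set 1; -1] y -> exists2 x, level p y x & sgrad p x = 0.
  by rewrite -hc => -[x [xS gx] <-]; exists x.
have leaf t : 0 <= t <= L -> M t !=set0 /\ exists s, M t = level p s.
  move=> tL; have : (M @` `[0, L]) (M t) by exists t => //=; rewrite in_itv.
  by rewrite hM.
have leafS t x : 0 <= t <= L -> M t x -> sphere x.
  by move=> /leaf[_ [s ->]] [].
split=> //.
- move=> x xS /andP[p1 p2]; apply/eqP => gx.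
  have : (p @` critical_point p) (p x) by exists x.
  by rewrite hc => -[] px; move: p1 p2; rewrite px ltxx.
- move=> x xS px; apply/eqP; rewrite -dot_eq0 ha//.
  by have [y [yS <-] gy] := crit (p x) px; rewrite -ha// gy dot0l.
- by have [|x lx _] := crit (-1); [right|exists x].
- move=> x xS; have : (M @` `[0, L]) (level p (p x)).
    by rewrite hM; split; [exists x|exists (p x)].
  by move=> [t /=]; rewrite in_itv /= => tL E; exists t => //; rewrite E.
move=> t x tL Mt; have xS := leafS t x tL Mt.
have /hdist/(_ Mt) tE : t \in `[0, L] by rewrite in_itv.
have Lpi : L <= pi := pi_div_le d0.
have dxy y : M 0 y -> -1 <= dot x y <= 1.
  by rewrite M0 => -[yS _]; exact: dot_itv.
have acE y : M 0 y -> cos (acos (dot x y)) = dot x y.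
  by move=> My; rewrite acosK// in_itv /= dxy.
have lb : has_lbound [set sphere_dist x y | y in M 0].
  by exists 0 => _ [y My <-]; rewrite acos_ge0// dxy.
have [m0 m0l _] : exists2 x, level p 1 x & sgrad p x = 0 by apply: crit; left.
have [y My ymax] : exists2 y, M 0 y & forall z, M 0 z -> dot x z <= dot x y.
  have [|||y] := @EVT_max_rV R n (dot x) (M 0).
  - by exists m0; rewrite M0.
  - by rewrite M0; exact: level_compact.
  - by apply: continuous_subspaceT; exact: dot_continuous.
  by rewrite inE => My H; exists y => // z Mz; apply: H; rewrite inE.
have tle z : M 0 z -> t <= acos (dot x z).
  by move=> Mz; rewrite -tE; apply: ge_inf => //; exists z.
have cle s r : 0 <= s -> s <= r -> r <= pi -> cos r <= cos s.
  move=> s0 sr rpi; rewrite leNgt; apply/negP.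
  by rewrite ltr_cos ?in_itv/=; [lra|apply/andP; split; lra|apply/andP; split; lra].
have /andP[t0 tL'] := tL.
split=> [z Mz|].
  rewrite -acE//; apply: cle => //; first exact: tle.
  by rewrite acos_lepi// dxy.
exists y => //; rewrite -acE//; congr cos; apply/le_anti/andP; split; last exact: tle.
rewrite -tE; apply: lb_le_inf; first by exists (sphere_dist x y), y.
move=> _ [z Mz <-]; rewrite /sphere_dist leNgt; apply/negP.
have /andP[h1 h2] := dxy z Mz; have /andP[h3 h4] := dxy y My.
rewrite -ltr_cos ?in_itv /= ?acos_ge0 ?acos_lepi ?dxy// !acE// => h.
by have := ymax z Mz; rewrite leNgt h.
Qed.

Lemma foliation_dataP : (2 < n)%N -> isoparametric_foliation d M ->
  exists p a, foliation_data d M p a.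
Proof.
move=> n2 [d_in [p [[[hp _ [a ha] _] [P hP] hb hc] [_ _ hM hMM hdist]]]].
have d0 : (0 < d)%N by move: d_in; rewrite !inE; case: d.
have h : oriented_hyps p a.
  split=> //; split=> // u v uv.
  apply: eq_trig_form (trig_form_homog P u v) => s.
  by rewrite hP//; exact: circle_sphere.
have l1 : level p 1 <> level p (-1).
  move=> E; have : (p @` critical_point p) 1 by rewrite hc; left.
  move=> [x [xS _] px]; have : level p 1 x by [].
  by rewrite E => -[_]; rewrite px; lra.
have M0 : [set M 0; M L] (M 0) by left.
have ML : [set M 0; M L] (M L) by right.
have l1M : [set level p 1; level p (-1)] (level p 1) by left.
have l2M : [set level p 1; level p (-1)] (level p (-1)) by right.
rewrite hMM in M0 ML; rewrite -hMM in l1M l2M.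
case: M0 => M0.
  exists p, a; apply: oriented_foliation_data => //.
  by case: l2M => E //; case: l1; rewrite E M0.
exists (fun x => - p x), (fun y => a (- y)); apply: oriented_foliation_data => //.
- exact: oriented_hypsN.
- rewrite M0; apply/seteqP; split => x [xS px]; split=> //; first by rewrite px opprK.
  by rewrite -px opprK.
have -> : M L = level p 1 by case: l1M => E //; case: l1; rewrite E M0.
apply/seteqP; split => x [xS px]; split=> //; first by rewrite px.
by apply: oppr_inj.
Qed.

End foliation_dataP.

(** * Energies of Minkowski norms and their restriction to a plane *)

Lemma Ck_energy {R : realType} {m k : nat} (U : set 'rV[R]_m) (F : 'rV[R]_m -> R) :
  open U -> Ck k U F -> Ck k U (energy F).
Proof.
by move=> oU cF; apply: eq_Ck (CkMl 2^-1 oU (CkM oU cF cF)).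
Qed.

Section minkowski_energy.
Context {R : realType} {m : nat}.
Variable F : 'rV[R]_m -> R.
Hypothesis mF : minkowski_norm F.
Let E := energy F.
Implicit Types x v : 'rV[R]_m.

Lemma energy_Ck k : Ck k [set x : 'rV[R]_m | x != 0] E.
Proof.
have [_ _ sF _ _] := mF.
exact: (Ck_energy open_neq0 (smooth_on_Ck k open_neq0 sF)).
Qed.

Lemma energy_diff x : x != 0 -> differentiable E x.
Proof. by move=> x0; have [+ _] := energy_Ck 1; exact. Qed.

Lemma energyZ l x : 0 <= l -> E (l *: x) = l ^+ 2 * E x.
Proof. by have [_ _ _ hF _] := mF => l0; rewrite /E /energy hF// exprMn mulrCA. Qed.

Lemma energy0 : E 0 = 0.
Proof. by rewrite -(scale0r 0) energyZ// expr0n mul0r. Qed.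

Lemma energy_gt0 x : x != 0 -> 0 < E x.
Proof.
have [_ F0 _ _ _] := mF => x0; rewrite /E /energy mulr_gt0 ?invr_gt0//.
by rewrite exprn_gt0// F0.
Qed.

(** E is homogeneous of degree 2, hence O(s^2) along lines through 0. So the
    identities below hold at 0 too. *)
Lemma energy_derive0 v : 'D_v E 0 = 0.
Proof.
have := derive_line E 0 v 0; rewrite scale0r addr0 => ->.
suff [] : is_derive (0 : R) (1 : R) (fun s => E (0 + s *: v)) 0 by [].
apply/is_derive1_caratheodory.
exists (fun s => if 0 <= s then s * E v else s * E (- v)); split.
- move=> s; rewrite !add0r scale0r energy0 !subr0; case: leP => [s0|s0].
    by rewrite energyZ// expr2 mulrAC.
  have -> : s *: v = (- s) *: (- v) by rewrite scalerN scaleNr opprK.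
  by rewrite energyZ ?oppr_ge0 ?ltW// sqrrN expr2 mulrAC.
- apply/cont_ballP => e e0.
  have C0 : 0 < `|E v| + `|E (- v)| + 1 by rewrite ltr_wpDl// addr_ge0.
  exists (e / (`|E v| + `|E (- v)| + 1)); first by rewrite divr_gt0.
  move=> s; rewrite subr0 lexx mul0r subr0 => se.
  have : `|s| * (`|E v| + `|E (- v)| + 1) < e by rewrite -ltr_pdivlMr.
  apply: le_lt_trans; case: (leP 0 s) => _ /=; rewrite normrM ler_wpM2l//; have := normr_ge0 (E v);
    have := normr_ge0 (E (- v)); lra.
by rewrite lexx mul0r.
Qed.

(** Euler's identity; it recovers F from its Legendre transformation. *)
Lemma euler_energy x : dot (legendre F x) x = 2 * E x.
Proof.
have [->|x0] := eqVneq x 0; first by rewrite dot0r energy0 mulr0.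
rewrite /legendre -derive_dot_grad; last exact: energy_diff.
have := derive_line E x x 0; rewrite scale0r addr0 => ->.
have d1 : is_derive (0 : R) (1 : R) (fun s => (1 + s) ^+ 2 * E x) (2 * E x).
  apply: derE (derM (@der_comp _ (fun t => t ^+ 2) (fun s => 1 + s) 0 _ _
    (der_exp 2 _) (derD (derC 0 1) (derX 0))) (derC 0 (E x))) _.
  by rewrite /=; ring.
have d2 : is_derive (0 : R) (1 : R) (fun s => E (x + s *: x)) (2 * E x).
  apply: near_eq_is_derive d1; apply/near_ballP; exists 1 => // s.
  rewrite subr0 ltr_norml => /andP[s1 _].
  have -> : x + s *: x = (1 + s) *: x by rewrite scalerDl scale1r.
  by rewrite energyZ//; lra.
by case: d2.
Qed.

Lemma dot_legendre x v : dot (legendre F x) v = 'D_v E x.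
Proof.
have [->|x0] := eqVneq x 0; last by rewrite derive_dot_grad//; exact: energy_diff.
rewrite energy_derive0; apply: big1 => i _.
by rewrite mxE /partial energy_derive0 mul0r.
Qed.

Lemma energy_hess x v : x != 0 -> v != 0 -> 0 < 'D_v ('D_v E) x.
Proof.
move=> x0 v0; have [_ _ _ _ /(_ x x0 v v0)] := mF.
by rewrite (hessianE _ open_neq0 (energy_Ck 2)).
Qed.

End minkowski_energy.

Lemma minkowski_eq_energy {R : realType} {m : nat} (F1 F2 : 'rV[R]_m -> R) x1 x2 :
  minkowski_norm F1 -> minkowski_norm F2 -> energy F1 x1 = energy F2 x2 -> F1 x1 = F2 x2.
Proof.
move=> [[_ F10] _ _ _ _] [[_ F20] _ _ _ _]; rewrite /energy => /mulfI H.
apply/eqP; rewrite -(eqrXn2 (n := 2))//; apply/eqP; apply: H.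
by rewrite invr_neq0.
Qed.

Lemma ord2P (j : 'I_2) : j = 0 \/ j = 1.
Proof. by case: j => -[|[|//]] h; [left|right]; apply/val_inj. Qed.

Section plane.
Context {R : realType} {n : nat}.
Variable g : R -> 'rV[R]_n.
Notation u := (g 0).
Notation v := (g (pi / 2)).
Hypothesis uv : orthonormal2 u v.

Let pp_linear : linear (plane_point g).
Proof. by move=> c y z; rewrite /plane_point !mxE; apply/rowP => i; rewrite !mxE; ring. Qed.

HB.instance Definition _ :=
  GRing.isLinear.Build R 'rV[R]_2 'rV[R]_n _ (plane_point g) pp_linear.

Lemma plane_pointZ c y : plane_point g (c *: y) = c *: plane_point g y.
Proof. exact: linearZ. Qed.

Lemma plane_point_continuous : continuous (plane_point g).
Proof.
move=> y; apply: (@rV_cvg R 'rV[R]_2 (nbhs y) _ n (plane_point g)) => i.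
have -> : (fun y => plane_point g y 0 i) = (fun y : 'rV[R]_2 => y 0 0 * u 0 i + y 0 1 * v 0 i).
  by apply/funext => z; rewrite !mxE.
have -> : plane_point g y 0 i = y 0 0 * u 0 i + y 0 1 * v 0 i by rewrite !mxE.
have c j := @coord_continuous R 1 2 0 j y.
exact: (cvgD (cvgMr_tmp (c 0)) (cvgMr_tmp (c 1))).
Qed.

Lemma dot2E (x y : 'rV[R]_2) : dot x y = x 0 0 * y 0 0 + x 0 1 * y 0 1.
Proof. by rewrite /dot big_ord_recl big_ord1; congr (_ + x 0 _ * y 0 _); apply/val_inj. Qed.

Lemma dot_plane_point y z : dot (plane_point g y) (plane_point g z) = dot y z.
Proof.
have [/sphereP uu /sphereP vv uv0] := uv.
by rewrite /plane_point !dotE uu vv uv0 (dotC v u) uv0 dot2E; ring.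
Qed.

Lemma plane_point_eq0 y : (plane_point g y == 0) = (y == 0).
Proof. by rewrite -dot_eq0 dot_plane_point dot_eq0. Qed.

Lemma plane_point_basis (j : 'I_2) :
  plane_point g (basis_vec j) = if j == 0 then u else v.
Proof.
have [->|->] := ord2P j.
  by rewrite /plane_point /basis_vec !mxE /= scale1r scale0r addr0.
by rewrite /plane_point /basis_vec !mxE /= scale1r scale0r add0r.
Qed.

Lemma derive_plane_point (f : 'rV[R]_n -> R) (w : 'rV[R]_2) :
  'D_w (f \o plane_point g) = 'D_(plane_point g w) f \o plane_point g.
Proof. by apply/funext => x; rewrite /derive /=; under eq_fun do rewrite linearP. Qed.

Lemma derive2_plane_point (f : 'rV[R]_n -> R) (w y : 'rV[R]_2) :
  'D_w ('D_w (f \o plane_point g)) y =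
  'D_(plane_point g w) ('D_(plane_point g w) f) (plane_point g y).
Proof.
by rewrite (derive_plane_point f w) [LHS](congr1 (fun h => h y) (derive_plane_point _ w)).
Qed.

Lemma restriction_minkowski F : minkowski_norm F -> minkowski_norm (F \o plane_point g).
Proof.
move=> mF; have [[cF F0] Fp sF hF _] := mF.
have pre : plane_point g @^-1` [set x | x != 0] = [set y | y != 0].
  by apply/seteqP; split => y /=; rewrite plane_point_eq0.
have mE : energy (F \o plane_point g) = energy F \o plane_point g by [].
have cE k : Ck k [set y : 'rV[R]_2 | y != 0] (energy (F \o plane_point g)).
  rewrite mE -pre; apply: Ck_lin; first exact: plane_point_continuous.
  exact: energy_Ck.
split.
- split; last by move=> y; exact: F0.
  by move=> y; apply: continuous_comp; [exact: plane_point_continuous|exact: cF].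
- by move=> y y0; apply: Fp; rewrite plane_point_eq0.
- apply: Ck_smooth_on => k; rewrite -pre; apply: Ck_lin; first exact: plane_point_continuous.
  by apply: smooth_on_Ck => //; exact: open_neq0.
- by move=> l y l0 /=; rewrite linearZ hF.
- move=> y y0 w w0; rewrite (hessianE _ open_neq0 (cE 2%N))//.
  rewrite mE derive2_plane_point.
  by apply: (energy_hess mF); rewrite plane_point_eq0.
Qed.

(** By the chain rule the partial derivatives of the restricted energy are the
    derivatives of E along the basis of the plane, which are the coordinates of
    the projection of grad E to the plane. *)
Lemma restriction_legendre F : minkowski_norm F ->
  plane_restriction g (legendre F) = legendre (F \o plane_point g).
Proof.
move=> mF; apply/funext => y; apply/rowP => j.
have E : energy (F \o plane_point g) = energy F \o plane_point g by [].
rewrite [RHS]mxE /partial E.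
have -> : 'D_(basis_vec j) (energy F \o plane_point g) y =
    'D_(plane_point g (basis_vec j)) (energy F) (plane_point g y).
  exact: (congr1 (fun h => h y) (derive_plane_point (energy F) (basis_vec j))).
by rewrite plane_point_basis -(dot_legendre mF) mxE.
Qed.

End plane.

(** * Norms induced by the foliation, restricted to a normal plane *)

Definition pol {R : realType} (s : R) : 'rV[R]_2 :=
  \row_j (if j == 0 then cos s else sin s).

Lemma dot_pol {R : realType} (s t : R) : dot (pol s) (pol t) = cos (s - t).
Proof. by rewrite dot2E !mxE /= cosB. Qed.

Lemma pol_sphere {R : realType} (s : R) : sphere (pol s).
Proof. by apply/sphereP; rewrite dot_pol subrr cos0. Qed.

Lemma pol_neq0 {R : realType} (s : R) : pol s != 0.
Proof. exact: sphere_neq0 (pol_sphere s). Qed.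

Lemma polar_upper {R : realType} (x : 'rV[R]_2) : 0 <= x 0 1 -> exists r s,
  [/\ 0 <= r, 0 <= s <= pi & x = r *: pol s].
Proof.
move=> x1; have [->|x0] := eqVneq x 0.
  by exists 0, 0; rewrite scale0r lexx pi_ge0.
have e0 : 0 < enorm x by rewrite enorm_gt0.
have xx := enorm_sqr x; rewrite dot2E -!expr2 in xx.
have x1E : x 0 1 ^+ 2 = enorm x ^+ 2 - x 0 0 ^+ 2 by rewrite xx; ring.
have a1 : -1 <= x 0 0 / enorm x <= 1.
  rewrite ler_pdivlMr// ler_pdivrMr// mulN1r mul1r.
  have := sqr_ge0 (x 0 1); rewrite x1E => h; apply/andP; split; nra.
exists (enorm x), (acos (x 0 0 / enorm x)); split; first exact: ltW.
  by rewrite acos_ge0 ?acos_lepi.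
apply/rowP => j; rewrite !mxE.
have [->|->] := ord2P j.
  by rewrite /= acosK ?in_itv//= mulrC divfK// gt_eqF.
rewrite /= sin_acos//; have -> : 1 - (x 0 0 / enorm x) ^+ 2 = (x 0 1 / enorm x) ^+ 2.
  by rewrite !expr_div_n x1E; field; rewrite gt_eqF.
by rewrite sqrtr_sqr ger0_norm ?divr_ge0 ?(ltW e0)// mulrC divfK// gt_eqF.
Qed.

Lemma polar2 {R : realType} (y : 'rV[R]_2) : y != 0 ->
  exists r s, 0 < r /\ y = r *: pol s.
Proof.
move=> y0; have pos r s : 0 <= r -> y = r *: pol s -> 0 < r.
  by move=> r0 yE; rewrite lt_neqAle r0 andbT; apply: contraNneq y0 => rz;
    rewrite yE -rz scale0r.
have [y1|y1] := leP 0 (y 0 1).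
  by have [r [s [r0 _ yE]]] := polar_upper y1; exists r, s; split=> //; exact: pos yE.
have [|r [s [r0 _ yE]]] := @polar_upper _ (- y); first by rewrite mxE oppr_ge0 ltW.
have yE' : y = r *: pol (s + pi).
  rewrite -[y]opprK yE -scalerN; congr (_ *: _); apply/rowP => j; rewrite !mxE.
  by case: ifP; rewrite ?cosDpi ?sinDpi.
by exists r, (s + pi); split=> //; exact: pos yE'.
Qed.

Lemma pol_reflection {R : realType} (s : R) : pol s *m reflection_mx = pol (- s).
Proof.
apply/rowP => j; rewrite !mxE big_ord_recl big_ord1 !mxE /= cosN sinN.
have [->|->] := ord2P j.
  by rewrite /= !mulr1n ?mulr0n ?mulr1 ?mulr0 ?addr0.
by rewrite /= ?mulr1n ?mulr0n ?mulr0 ?add0r mulrN1.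
Qed.

Lemma pol_rotation {R : realType} (s a : R) : pol s *m rotation_mx a = pol (s + a).
Proof.
apply/rowP => j; rewrite !mxE big_ord_recl big_ord1 !mxE /= cosD sinD.
have [->|->] := ord2P j.
  by rewrite /= mulrN.
by rewrite /= addrC.
Qed.

(** Invariance can be tested on generators, and on unit vectors by homogeneity.
    Inverses need no care about singular matrices, on which invmx is the
    identity. *)
Lemma dihedral_invariantP {R : realType} (d : nat) (f : 'rV[R]_2 -> R) :
  (forall l y, 0 <= l -> f (l *: y) = l * f y) ->
  dihedral_invariant d f <->
  (forall s, f (pol (- s)) = f (pol s)) /\
  (forall s, f (pol (s + 2 * pi / d%:R)) = f (pol s)).
Proof.
move=> fh; split=> [fd|[f1 f2] A].
  split=> s; first by rewrite -pol_reflection fd//; exact: dihedral_reflection.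
  by rewrite -pol_rotation fd//; exact: dihedral_rotation.
have ext (B : 'M[R]_2) : (forall s, f (pol s *m B) = f (pol s)) -> forall x, f (x *m B) = f x.
  move=> fB x; have [->|x0] := eqVneq x 0; first by rewrite mul0mx.
  by have [r [s [r0 ->]]] := polar2 x0; rewrite -scalemxAl !fh ?ltW// fB.
elim: A / => [x|||A B _ IHA _ IHB x|A _ IHA x].
- by rewrite mulmx1.
- by apply: ext => s; rewrite pol_reflection.
- by apply: ext => s; rewrite pol_rotation.
- by rewrite mulmxA IHB.
have [Au|Au] := boolP (A \in unitmx); last by rewrite /invmx (negbTE Au).
by rewrite -IHA mulmxKV.
Qed.

Section restriction.
Context {R : realType} {n d : nat}.
Variables (M : R -> set 'rV[R]_n) (p : 'rV[R]_n -> R) (a : R -> R).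
Hypothesis fd : foliation_data d M p a.
Notation L := (pi / d%:R : R).
Hypothesis leaves : forall t, 0 <= t <= L -> M t = level p (cos (d%:R * t)).
Hypothesis aE : forall s, a (cos (d%:R * s)) = (d%:R * sin (d%:R * s)) ^+ 2.
Variable g : R -> 'rV[R]_n.
Notation u := (g 0).
Notation v := (g (pi / 2)).
Hypothesis uv : orthonormal2 u v.
Hypothesis pg : forall s, p (circle u v s) = cos (d%:R * s).

Lemma plane_point_pol s : plane_point g (pol s) = circle u v s.
Proof. by rewrite /plane_point !mxE. Qed.

Section induced.
Variable F : 'rV[R]_n -> R.
Hypothesis mF : minkowski_norm F.
Hypothesis iF : induced_by d M F.

Lemma induced_eq x y : sphere x -> sphere y -> p x = p y -> F x = F y.
Proof.
move=> xS yS pxy; have xL := angle_itv fd xS.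
have Mx := leaf_angle fd leaves xS.
apply: (iF _ Mx); first by rewrite in_itv.
by rewrite (leaf_level fd xL Mx); split.
Qed.

Lemma restriction_dihedral : dihedral_invariant d (F \o plane_point g).
Proof.
have [_ _ _ hF _] := mF.
apply/dihedral_invariantP; first by move=> l y l0 /=; rewrite plane_pointZ hF.
split=> s /=; rewrite !plane_point_pol; apply: induced_eq; try exact: circle_sphere;
  rewrite !pg; first by rewrite mulrN cosN.
have d0 : d%:R != 0 :> R by rewrite pnatr_eq0 -lt0n (fd_d fd).
have -> : d%:R * (s + 2 * pi / d%:R) = d%:R * s + pi *+ 2.
  by rewrite mulrDr; congr (_ + _); rewrite mulrC divfK// mulr_natl.
by rewrite cosD2pi.
Qed.

(** At regular points of the circle grad p is a multiple of the velocity of the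
    circle, since its length |d sin (d s)| is that of its component along the
    velocity. Vectors orthogonal to the plane are thus tangent to the leaf. *)
Let w_tangent_regular s w : dot w u = 0 -> dot w v = 0 -> sin (d%:R * s) != 0 ->
  tangent_vector (level p (p (circle u v s))) (circle u v s) w.
Proof.
move=> wu wv sn; have cS := circle_sphere s uv.
have w_c t : dot w (circle u v t) = 0.
  by rewrite /circle dotDr !dotZr wu wv !mulr0 addr0.
set N := sgrad p (circle u v s).
have NN : dot N N = (d%:R * sin (d%:R * s)) ^+ 2 by rewrite /N (fd_grad fd cS) pg aE.
have N0 : N != 0.
  rewrite -dot_eq0 NN sqrf_eq0 mulf_neq0// pnatr_eq0 -lt0n; exact: (fd_d fd).
pose c' := circle u v (s + pi / 2).
have Nc : dot N c' = - (d%:R * sin (d%:R * s)).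
  have h1 := is_derive_on_circle (fd_smooth fd) s uv; rewrite -/N -/c' in h1.
  have h2 := @der_comp _ cos (fun s => d%:R * s) s _ _ (is_derive_cos _) (derMl d%:R (derX s)).
  have E : (fun s => p (circle u v s)) = (fun s => cos (d%:R * s)) by apply/funext.
  by rewrite E in h1; rewrite (der_unique h1 h2); ring.
have NE : N = dot N c' *: c'.
  have cc : dot c' c' = 1 by exact/sphereP/circle_sphere.
  apply/eqP; rewrite -subr_eq0 -dot_eq0; move: Nc cc NN; move: (N) (c') => X Y XY YY XX.
  by rewrite !dotE YY XX (dotC Y X) XY; apply/eqP; ring.
apply: level_tangent => //; first exact: (fd_smooth fd).
by rewrite -/N NE dotZr w_c mulr0.
Qed.

Let derive_normal_regular r s w : 0 < r -> dot w u = 0 -> dot w v = 0 ->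
  sin (d%:R * s) != 0 -> 'D_w (energy F) (r *: circle u v s) = 0.
Proof.
move=> r0 wu wv sn; have cS := circle_sphere s uv.
have [k [k0 kn dk]] := w_tangent_regular wu wv sn.
have x0 : r *: circle u v s != 0.
  by rewrite scaler_eq0 negb_or gt_eqF//=; exact: sphere_neq0.
have dE := energy_diff mF x0.
have drk : is_derive (0 : R) (1 : R) (fun t => r *: k t) (r *: w).
  apply: derivable_rV => i; rewrite mxE.
  have -> : (fun t => (r *: k t) 0 i) = (fun t => r * k t 0 i) by apply/funext => t; rewrite mxE.
  exact: derMl (is_derive_coord i dk).
have dE' : differentiable (energy F) (r *: k 0) by rewrite k0.
have := chain_rule dE' drk; rewrite k0 dotZr -derive_dot_grad// => h1.
have h0 : is_derive (0 : R) (1 : R) (fun t => energy F (r *: k t)) 0.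
  apply: near_eq_is_derive (derC 0 (r ^+ 2 * energy F (circle u v s))).
  apply: filterS kn => t [kS kp]; rewrite (energyZ mF _ (ltW r0)); congr (_ * _).
  by rewrite /energy (induced_eq kS cS kp).
have /eqP := der_unique h1 h0; rewrite mulf_eq0 gt_eqF//= => /eqP.
by [].
Qed.

(** F is constant on the leaf, to which w is tangent where sin (d s) is not 0.
    The other points of the circle, those on focal leaves, are isolated and
    follow by continuity. *)
Lemma derive_normal r s w : 0 < r -> dot w u = 0 -> dot w v = 0 ->
  'D_w (energy F) (r *: circle u v s) = 0.
Proof.
move=> r0 wu wv; apply/eqP; apply/negPn/negP => n0.
pose h t := 'D_w (energy F) (r *: circle u v t).
have ch : {for s, continuous h}.
  have x0 : r *: circle u v s != 0.
    by rewrite scaler_eq0 negb_or gt_eqF//=; apply: sphere_neq0; exact: circle_sphere.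
  have [_ /(_ w) cD] := energy_Ck mF 1.
  apply: (@continuous_comp _ _ _ (fun t => r *: circle u v t) ('D_w (energy F))); last exact: cD.
  apply: cvgZl_tmp; apply: differentiable_continuous; apply/derivable1_diffP.
  by have [] := is_derive_circle u v s.
have hn : 0 < `|h s| by rewrite normr_gt0.
have /cont_ballP/(_ _ hn)[e e0 he] := ch.
have d0 : 0 < d%:R :> R by rewrite ltr0n (fd_d fd).
have sn : sin (d%:R * s) = 0.
  by apply/eqP; apply/negPn/negP => sn; rewrite derive_normal_regular ?eqxx in n0.
have L0 : 0 < L := L_gt0 fd.
have [t t0 [te tL]] := ex_lt2 e0 L0.
have ht : h (s + t) = 0.
  apply: derive_normal_regular => //; rewrite mulrDr sinD sn mul0r add0r.
  rewrite mulf_neq0//; first by rewrite -norm_sin_eq1 sn normr0 eq_sym oner_eq0.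
  by rewrite gt_eqF// sin_gt0_pi// mulr_gt0//= -(dL fd) ltr_pM2l.
have := he (s + t); rewrite [s + t]addrC addrK gtr0_norm// => /(_ te).
by rewrite addrC ht sub0r normrN ltxx.
Qed.

(** By [derive_normal], grad E at a point of the plane is orthogonal to the
    orthogonal complement of the plane. *)
Lemma legendre_plane x : (exists y, x = plane_point g y) -> x != 0 ->
  exists y, legendre F x = plane_point g y.
Proof.
move=> [y xE] x0.
have [r [s [r0 yE]]] : exists r s, 0 < r /\ y = r *: pol s.
  by apply: polar2; apply: contra x0 => /eqP y0; rewrite xE y0 linear0.
have {}xE : x = r *: circle u v s by rewrite xE yE plane_pointZ plane_point_pol.
have [/sphereP uu /sphereP vv uv0] := uv.
pose X := legendre F x.
pose w := X - (dot X u *: u + dot X v *: v).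
have wu : dot w u = 0 by rewrite /w !dotE uu (dotC v u) uv0; ring.
have wv : dot w v = 0 by rewrite /w !dotE vv uv0; ring.
have Xw : dot X w = 0 by rewrite /X dot_legendre// xE derive_normal.
have w0 : w = 0.
  apply/eqP; rewrite -dot_eq0 {1}/w dotBl Xw dotDl !dotZl !(dotC _ w) wu wv.
  by rewrite !mulr0 addr0 subrr.
exists (plane_coord g X); rewrite /plane_point !mxE /=.
by apply/eqP; rewrite -subr_eq0; apply/eqP.
Qed.

End induced.

(** Euler's identity shows that the restrictions of F1 and F2 to the plane
    coincide. The plane meets every leaf, so F1 and F2 coincide on the sphere. *)
Lemma restriction_injective F1 F2 : minkowski_norm F1 -> minkowski_norm F2 ->
  induced_by d M F1 -> induced_by d M F2 ->
  plane_restriction g (legendre F1) = plane_restriction g (legendre F2) -> F1 = F2.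
Proof.
move=> m1 m2 i1 i2; rewrite !restriction_legendre// => lE.
have mf1 := restriction_minkowski uv m1; have mf2 := restriction_minkowski uv m2.
have eq_plane y : F1 (plane_point g y) = F2 (plane_point g y).
  apply: (minkowski_eq_energy mf1 mf2 (x1 := y) (x2 := y)).
  have := euler_energy mf1 y; rewrite lE euler_energy// => /mulfI -> //.
have [_ _ _ h1 _] := m1; have [_ _ _ h2 _] := m2.
apply/funext => x; have [->|x0] := eqVneq x 0.
  by rewrite -(scale0r 0) h1// h2// !mul0r.
have xS := normalize_sphere x0; set x' := _ *: x in xS.
have xE : x = enorm x *: x' by rewrite /x' normalizeK.
rewrite xE h1 ?enorm_ge0// h2 ?enorm_ge0//; congr (_ * _).
pose c := circle u v (angle d p x').
have cS : sphere c by exact: circle_sphere.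
have pc : p x' = p c by rewrite pg (cos_angle fd).
rewrite (induced_eq i1 xS cS pc) (induced_eq i2 xS cS pc).
by rewrite /c -plane_point_pol eq_plane.
Qed.

End restriction.

(** * Strong convexity of the energy in the plane *)

(** The mean value theorem for r', then for r minus its lower Taylor
    polynomial. *)
Lemma taylor_convex {R : realType} (r r' r'' : R -> R) (K : R) :
  (forall t : R, 0 <= t <= 1 -> is_derive t (1 : R) r (r' t)) ->
  (forall t : R, 0 <= t <= 1 -> is_derive t (1 : R) r' (r'' t)) ->
  (forall t, 0 <= t <= 1 -> K *+ 2 <= r'' t) ->
  r 0 + r' 0 + K <= r 1.
Proof.
move=> dr dr' hK.
have H (t : R) : 0 <= t <= 1 -> r' 0 + K *+ 2 * t <= r' t.
  move=> /andP[t0 t1].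
  have d1 (s : R) : 0 <= s <= t -> is_derive s (1 : R) r' (r'' s).
    by move=> /andP[s0 st]; apply: dr'; rewrite s0 (le_trans st).
  have [c /andP[c0 ct] E] := MVT_der t0 d1.
  rewrite addrC -lerBrDr E subr0 ler_wpM2r//; apply: hK.
  by rewrite c0 (le_trans ct).
pose s t := r t - (r' 0 * t + K * t ^+ 2).
have ds (t : R) : 0 <= t <= 1 -> is_derive t (1 : R) s (r' t - (r' 0 + K *+ 2 * t)).
  move=> t1; apply: derE (derB (dr t t1) (derD (derMl (r' 0) (derX t)) (derMl K (der_exp 2 t)))) _.
  by rewrite /=; ring.
have [c c01 E] := MVT_der ler01 ds.
have := H c c01; rewrite -subr_ge0 => h.
have : 0 <= s 1 - s 0 by rewrite E subr0 mulr1.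
by rewrite /s mulr1 mulr0 !expr2 mul1r mul0r mulr1 mulr0; lra.
Qed.

Section homogeneous.
Context {R : realType} {m : nat}.
Variable F : 'rV[R]_m -> R.
Hypothesis mF : minkowski_norm F.
Notation E := (energy F).
Implicit Types x w : 'rV[R]_m.

Let comp_scale (f : 'rV[R]_m -> R) r w x :
  'D_w (fun y => f (r *: y)) x = 'D_(r *: w) f (r *: x).
Proof.
rewrite /derive /=; set A := (X in lim (X @ _)); set B := (X in _ = lim (X @ _)).
suff -> : A = B by [].
by apply/funext => h; rewrite /A /B /=; congr (_ *: (f _ - _));
  rewrite scalerDr !scalerA mulrC.
Qed.

Let energy_derive_diff w x : x != 0 -> differentiable ('D_w E) x.
Proof. by move=> x0; have [_ /(_ w) [+ _]] := energy_Ck mF 2; exact. Qed.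

Lemma energy_deriveZ r w x : 0 < r -> x != 0 -> 'D_w E (r *: x) = r * 'D_w E x.
Proof.
move=> r0 x0; have rx0 : r *: x != 0 by rewrite scaler_eq0 negb_or gt_eqF.
have := comp_scale E r w x; rewrite deriveZ_dir; last exact: energy_diff.
have -> : (fun y => E (r *: y)) = r ^+ 2 *: E.
  by apply/funext => y; exact: (energyZ mF y (ltW r0)).
rewrite deriveZ; last by apply: diff_derivable; exact: energy_diff.
move=> H; apply: (mulfI (lt0r_neq0 r0)).
by rewrite mulrA -expr2; exact/esym.
Qed.

(** Second derivatives of E are homogeneous of degree 0, so bounds on the unit
    sphere are bounds everywhere. *)
Lemma energy_derive2Z r w x : 0 < r -> x != 0 ->
  'D_w ('D_w E) (r *: x) = 'D_w ('D_w E) x.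
Proof.
move=> r0 x0; have rx0 : r *: x != 0 by rewrite scaler_eq0 negb_or gt_eqF.
have := comp_scale ('D_w E) r w x; rewrite deriveZ_dir; last exact: energy_derive_diff.
have nE : \forall y \near x, 'D_w E (r *: y) = (r *: 'D_w E) y.
  have nx : \forall y \near x, [set y | y != 0] y by apply: open_nbhs_nbhs; split=> //; exact: open_neq0.
  by apply: filterS nx => y /= y0; rewrite energy_deriveZ.
rewrite (near_eq_derive w nE) deriveZ; last by apply: diff_derivable; exact: energy_derive_diff.
by move=> H; apply: (mulfI (lt0r_neq0 r0)); exact/esym.
Qed.

Lemma energy_line x w t : x + t *: w != 0 ->
  is_derive t (1 : R) (fun s => E (x + s *: w)) ('D_w E (x + t *: w)).
Proof. by move=> h; apply: is_derive_line; apply: diff_derivable; exact: energy_diff. Qed.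

Lemma energy_line2 x w t : x + t *: w != 0 ->
  is_derive t (1 : R) (fun s => 'D_w E (x + s *: w)) ('D_w ('D_w E) (x + t *: w)).
Proof. by move=> h; apply: is_derive_line; apply: diff_derivable; exact: energy_derive_diff. Qed.

End homogeneous.

Section plane_convexity.
Context {R : realType}.
Variable f : 'rV[R]_2 -> R.
Hypothesis mf : minkowski_norm f.
Notation e := (energy f).
Implicit Types x y w : 'rV[R]_2.

Let h (i j : 'I_2) x := hessian e x i j.

Lemma quad2 (H : 'M[R]_2) w : (w *m H *m w^T) 0 0 =
  w 0 0 ^+ 2 * H 0 0 + w 0 0 * w 0 1 * (H 0 1 + H 1 0) + w 0 1 ^+ 2 * H 1 1.
Proof.
have o1 : lift ord0 ord0 = 1 :> 'I_2 by apply/val_inj.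
rewrite mxE big_ord_recl big_ord1 !mxE !big_ord_recl !big_ord0 !o1; ring.
Qed.

(** The product of the eigenvalues of the symmetric part of H is det and their
    sum is tr, so the smaller one is at least det / tr. Contrary to an eigenvalue
    this bound is a rational function of H, which makes its continuity in H
    immediate. *)
Lemma quad2_bound (H : 'M[R]_2) : (forall w, w != 0 -> 0 < (w *m H *m w^T) 0 0) ->
  let tr := H 0 0 + H 1 1 in
  let det := H 0 0 * H 1 1 - ((H 0 1 + H 1 0) / 2) ^+ 2 in
  [/\ 0 < tr, 0 < det & forall w, det / tr * dot w w <= (w *m H *m w^T) 0 0].
Proof.
move=> Hpos tr det.
have pos (a b : R) : (a != 0) || (b != 0) ->
    0 < a ^+ 2 * H 0 0 + a * b * (H 0 1 + H 1 0) + b ^+ 2 * H 1 1.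
  move=> ab; pose w : 'rV[R]_2 := \row_j (if j == 0 then a else b).
  have w0 : w != 0.
    apply: contraTneq ab => w0; rewrite negb_or !negbK.
    have := congr1 (fun z : 'rV[R]_2 => z 0 0) w0.
    by have := congr1 (fun z : 'rV[R]_2 => z 0 1) w0; rewrite !mxE /= => -> ->; rewrite eqxx.
  by have := Hpos w w0; rewrite quad2 !mxE /=.
have A0 : 0 < H 0 0 by have := pos 1 0; rewrite oner_eq0 => /(_ isT); lra.
have C0 : 0 < H 1 1 by have := pos 0 1; rewrite oner_eq0 orbT => /(_ isT); lra.
have D0 : 0 < det.
  have := pos (- ((H 0 1 + H 1 0) / 2)) (H 0 0); rewrite (gt_eqF A0) orbT => /(_ isT).
  set b := (H 0 1 + H 1 0).
  have -> : (- (b / 2)) ^+ 2 * H 0 0 + - (b / 2) * H 0 0 * b + H 0 0 ^+ 2 * H 1 1 =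
    H 0 0 * det by rewrite /det -/b; field.
  by rewrite pmulr_rgt0.
have T0 : 0 < tr by rewrite addr_gt0.
split=> // w; rewrite mulrAC ler_pdivrMr// quad2 dot2E /det /tr.
set b := H 0 1 + H 1 0; set A := H 0 0; set C := H 1 1.
rewrite -subr_ge0.
have -> : (w 0 0 ^+ 2 * A + w 0 0 * w 0 1 * b + w 0 1 ^+ 2 * C) * (A + C) -
  (A * C - (b / 2) ^+ 2) * (w 0 0 * w 0 0 + w 0 1 * w 0 1) =
  (A * w 0 0 + b / 2 * w 0 1) ^+ 2 + (b / 2 * w 0 0 + C * w 0 1) ^+ 2 by field.
by rewrite addr_ge0 ?sqr_ge0.
Qed.

(** By homogeneity it is enough to bound below, on the compact unit circle, the
    positive continuous functions det / tr of [quad2_bound] and e. *)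
Lemma uniform_convexity : exists2 c, 0 < c &
  (forall x w, x != 0 -> c *+ 2 * dot w w <= 'D_w ('D_w e) x) /\
  (forall x, c * dot x x <= e x).
Proof.
have cpt := @sphere_compact R 2.
have ne : @sphere R 2 !=set0 by exists (pol 0); exact: pol_sphere.
have hC i j : Ck 0 [set x | x != 0] (h i j).
  move=> x x0; have [_ /(_ (basis_vec j)) [_ /(_ (basis_vec i))]] := energy_Ck mf 2.
  have -> : h i j = 'D_(basis_vec i) ('D_(basis_vec j) e).
    by apply/funext => y; rewrite /h mxE.
  exact.
pose tr x := h 0 0 x + h 1 1 x.
pose det x := h 0 0 x * h 1 1 x - ((h 0 1 x + h 1 0 x) / 2) ^+ 2.
have B x : x != 0 -> [/\ 0 < tr x, 0 < det x &
    forall w, det x / tr x * dot w w <= 'D_w ('D_w e) x].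
  move=> x0; have [_ _ _ _ /(_ x x0) Hpos] := mf.
  have [h1 h2 h3] := quad2_bound Hpos; split=> // w.
  by rewrite -(hessianE _ open_neq0 (energy_Ck mf 2)).
have cm : {within @sphere R 2, continuous (fun x => det x / tr x)}.
  apply: continuous_in_subspaceT => x; rewrite inE => xS; move: (sphere_neq0 xS).
  have oU := @open_neq0 R 2; pose b y := (h 0 1 y + h 1 0 y) * 2^-1.
  have cb : Ck 0 [set y | y != 0] b.
    by apply: (CkM oU); [apply: (CkD oU); exact: hC|exact: Ck_cst].
  suff : Ck 0 [set y : 'rV[R]_2 | y != 0] (fun x => det x / tr x) by exact.
  apply: (CkM oU); last first.
    apply: (CkV oU); last by apply: (CkD oU); exact: hC.
    by move=> y y0; have [t0 _ _] := B y y0; rewrite gt_eqF.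
  apply: (CkD oU); first by apply: (CkM oU); exact: hC.
  by apply: (CkN oU); apply: eq_Ck (CkM oU cb cb) => // y _; rewrite expr2.
have ce : {within @sphere R 2, continuous e}.
  apply: continuous_in_subspaceT => x; rewrite inE => xS.
  by apply: differentiable_continuous; apply: energy_diff => //; exact: sphere_neq0.
have [x1 + m1] := EVT_min_rV ne cpt cm; rewrite inE => x1S.
have [x2 + m2] := EVT_min_rV ne cpt ce; rewrite inE => x2S.
have x10 := sphere_neq0 x1S; have x20 := sphere_neq0 x2S.
have [t1 d1 _] := B x1 x10.
have e2 : 0 < e x2 by exact: energy_gt0.
pose c := Num.min (det x1 / tr x1 / 2) (e x2).
have c0 : 0 < c by rewrite lt_min e2 !divr_gt0.
have c1 : c *+ 2 <= det x1 / tr x1.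
  by rewrite -mulr_natr -ler_pdivlMr// ge_min lexx.
have c2 : c <= e x2 by rewrite ge_min lexx orbT.
have norm x : x != 0 -> exists2 y, sphere y & x = enorm x *: y.
  move=> x0; exists ((enorm x)^-1 *: x); first exact: normalize_sphere.
  by rewrite normalizeK.
exists c => //; split=> [x w x0|x].
  have [y yS ->] := norm x x0; have y0 := sphere_neq0 yS.
  rewrite energy_derive2Z ?enorm_gt0//; have [_ _ By] := B y y0.
  have ym : det x1 / tr x1 <= det y / tr y by apply: m1; rewrite inE.
  have c1y : c *+ 2 <= det y / tr y by exact: le_trans c1 ym.
  have := ler_wpM2r (dot_ge0 w) c1y.
  move=> H; exact: (le_trans H (By w)).
have [->|x0] := eqVneq x 0; first by rewrite dot0l mulr0 energy0.
have [y yS E] := norm x x0; rewrite [in leRHS]E (energyZ mf) ?enorm_ge0// enorm_sqr mulrC.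
rewrite ler_wpM2l ?dot_ge0//; apply: le_trans c2 _.
by apply: m2; rewrite inE.
Qed.

(** Taylor's formula on the segment from x to y. If the segment meets 0, where e
    is not twice differentiable, then y is a nonpositive multiple of x and the
    inequality reduces by homogeneity to c |x|^2 <= e x and the same at - x. *)
Lemma strong_convexity c :
  (forall x w, x != 0 -> c *+ 2 * dot w w <= 'D_w ('D_w e) x) ->
  (forall x, c * dot x x <= e x) ->
  forall x y, x != 0 ->
  e x + dot (legendre f x) (y - x) + c * dot (y - x) (y - x) <= e y.
Proof.
move=> c1 c2 x y x0; set w := y - x.
have [[t /andP[t0 t1] xt]|H] := pselect (exists2 t, 0 <= t <= 1 & x + t *: w = 0).
  have tn0 : t != 0.
    by apply: contraNneq x0 => tz; rewrite -xt tz scale0r addr0.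
  have tp : 0 < t by rewrite lt_neqAle eq_sym tn0.
  pose l := (1 - t) / t.
  have l0 : 0 <= l by rewrite divr_ge0// subr_ge0.
  have wE : w = - (1 + l) *: x.
    have : t *: w = - x by apply/eqP; rewrite -addr_eq0 addrC xt.
    move=> /(congr1 (fun z => t^-1 *: z)); rewrite scalerA mulVf// scale1r => ->.
    rewrite scalerN -scaleNr; congr (_ *: _); rewrite /l; field.
    exact: tn0.
  have yE : y = l *: (- x).
    by rewrite -[y](subrK x) -/w wE scaleNr scalerDl scale1r scalerN opprD addrAC addNr add0r.
  rewrite [in leRHS]yE (energyZ mf) // wE !dotE euler_energy//.
  have := c2 (- x); rewrite dotNl dotNr opprK; have := c2 x.
  set X := dot x x; set ex := e x; set en := e (- x) => h1 h2.
  have h3 : l ^+ 2 * (c * X) <= l ^+ 2 * en by rewrite ler_wpM2l// sqr_ge0.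
  apply: le_trans h3.
  have h4 : (1 + 2 * l) * (c * X) <= (1 + 2 * l) * ex by rewrite ler_wpM2l//; lra.
  rewrite -subr_ge0; apply: le_trans (_ : 0 <= (1 + 2 * l) * ex - (1 + 2 * l) * (c * X)) _.
    by rewrite subr_ge0.
  by rewrite le_eqVlt; apply/orP; left; apply/eqP; ring.
have nz t : 0 <= t <= 1 -> x + t *: w != 0.
  by move=> t1; apply/eqP => xt; apply: H; exists t.
have w1 : x + w = y by rewrite /w addrC subrK.
have := @taylor_convex _ (fun t => e (x + t *: w)) (fun t => 'D_w e (x + t *: w))
  (fun t => 'D_w ('D_w e) (x + t *: w)) (c * dot w w).
rewrite scale0r addr0 scale1r w1 -(dot_legendre mf); apply.
- by move=> t t1; apply: energy_line => //; exact: nz.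
- by move=> t t1; apply: energy_line2 => //; exact: nz.
- by move=> t t1; rewrite -mulrnAl; apply: c1; exact: nz.
Qed.

End plane_convexity.

(** * The gradient of an invariant convex function stays in its chamber *)

Section chamber.
Context {R : realType}.
Variables (d : nat) (f : 'rV[R]_2 -> R).
Hypothesis d_gt0 : (0 < d)%N.
Hypothesis mf : minkowski_norm f.
Hypothesis df : dihedral_invariant d f.
Notation L := (pi / d%:R : R).
Notation e := (energy f).

Let L0 : 0 < L := pi_div_gt0 d_gt0.
Let Lpi : L <= pi := pi_div_le d_gt0.
Let dLpi : d%:R * L = pi := pi_divK d_gt0.

Lemma dihedral_even s : f (pol (- s)) = f (pol s).
Proof.
have [_ _ _ hf _] := mf.
by have [+ _] := (dihedral_invariantP d hf).1 df; exact.
Qed.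

Lemma dihedral_period s : f (pol (s + L *+ 2)) = f (pol s).
Proof.
have [_ _ _ hf _] := mf; have [_ /(_ s) <-] := (dihedral_invariantP d hf).1 df.
by congr (f (pol (s + _))); rewrite -mulrnAl mulr_natl.
Qed.

(** The reflections of the dihedral group fold the angle s into [0, L] without
    changing f or cos (d s), and there acos inverts cos. *)
Lemma dihedral_acos s : f (pol (acos (cos (d%:R * s)) / d%:R)) = f (pol s).
Proof.
have step (k : nat) t : 0 <= t <= k.+1%:R * L -> exists t',
    [/\ 0 <= t' <= L, f (pol t') = f (pol t) & cos (d%:R * t') = cos (d%:R * t)].
  elim: k t => [|k IH] t; first by rewrite mul1r => tL; exists t.
  move=> /andP[t0 tk]; have [tL|tL] := leP t L; first by exists t; rewrite t0 tL.
  have h1 : `|t - L *+ 2| <= k.+1%:R * L.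
    have kL : L <= k.+1%:R * L by rewrite ler_peMl ?(ltW L0)// ler1n.
    have {}tk : t <= k.+1%:R * L + L by rewrite -[X in _ + X]mul1r -mulrDl natr1.
    have arith (X l u : R) : 0 < l -> l <= X -> u <= X + l -> l < u -> - X <= u - (l + l) <= X.
      by move=> h0 h1 h2 h3; apply/andP; split; lra.
    by rewrite ler_norml mulr2n; exact: arith.
  have [|t' [t'L ft' ct']] := IH `|t - L *+ 2|; first by rewrite normr_ge0.
  have E1 : f (pol `|t - L *+ 2|) = f (pol t).
    have : f (pol (t - L *+ 2)) = f (pol t) by rewrite -dihedral_period subrK.
    by case: (ler0P (t - L *+ 2)) => // _; rewrite dihedral_even.
  have E2 : cos (d%:R * `|t - L *+ 2|) = cos (d%:R * t).
    have : cos (d%:R * (t - L *+ 2)) = cos (d%:R * t).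
      by rewrite mulrBr mulrnAr dLpi -[LHS]cosD2pi subrK.
    by case: (ler0P (t - L *+ 2)) => // _; rewrite mulrN cosN.
  by exists t'; rewrite t'L ft' ct'.
have bigs : exists k : nat, `|s| <= k.+1%:R * L.
  exists (Num.bound (`|s| / L)); rewrite -ler_pdivrMr//.
  have := archi_boundP (divr_ge0 (normr_ge0 s) (ltW L0)).
  by move=> /ltW /le_trans; apply; rewrite ler_nat.
have [k hk] := bigs.
have [|t [/andP[t0 tL] ft ct]] := step k `|s|; first by rewrite normr_ge0.
have fs : f (pol `|s|) = f (pol s) by case: (ler0P s) => // _; rewrite dihedral_even.
have cs : cos (d%:R * `|s|) = cos (d%:R * s).
  by case: (ler0P s) => // _; rewrite mulrN cosN.
rewrite -fs -ft -cs -ct cosK; first by rewrite mulrC mulKf// pnatr_eq0 -lt0n.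
by rewrite in_itv /= mulr_ge0//= -dLpi ler_pM2l// ltr0n.
Qed.

(** The vector is the gradient at x = r pol t of e - c |.|^2, a convex function
    invariant under the reflections in the two walls of the chamber, the rays of
    angles 0 and L. At the mirror images of x the function has the same value as
    at x, so the gradient points away from them, that is, into the chamber. *)
Lemma chamber_gradient c :
  (forall x y, x != 0 ->
    e x + dot (legendre f x) (y - x) + c * dot (y - x) (y - x) <= e y) ->
  forall r t, 0 < r -> 0 < t < L -> exists rho tau,
    [/\ 0 <= rho, 0 <= tau <= L &
     legendre f (r *: pol t) - c *+ 2 *: (r *: pol t) = rho *: pol tau].
Proof.
move=> conv r t r0 /andP[t0 tL]; set x := r *: pol t; set xi := _ - _.
have x0 : x != 0 by rewrite scaler_eq0 negb_or gt_eqF//= pol_neq0.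
have refl s : f (pol s) = f (pol t) -> dot xi (pol s - pol t) <= 0.
  move=> fs; have := conv x (r *: pol s) x0.
  have es : e (r *: pol s) = e x.
    by rewrite /x !(energyZ mf) ?ltW// /energy fs.
  have yx : r *: pol s - x = r *: (pol s - pol t) by rewrite scalerBr.
  have nn : dot (pol s - pol t) (pol s - pol t) = - 2 * dot (pol t) (pol s - pol t).
    by rewrite !dotE !dot_pol !subrr cos0 -[cos (s - t)]cosN opprB; ring.
  rewrite es -addrA gerDl yx /xi; move: (pol s - pol t) nn => w nn.
  rewrite /x dotBl !dotZl !dotZr nn mulr2n => H.
  by rewrite -(pmulr_rle0 _ r0); move: H; lra.
clearbody xi.
(* mirror image in the wall of angle 0 *)
have f1 : 0 <= xi 0 1.
  have := refl (- t) (dihedral_even t); rewrite dot2E !mxE /= cosN sinN subrr mulr0 add0r.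
  have st : 0 < sin t by rewrite sin_gt0_pi// t0 (lt_le_trans tL).
  by rewrite -opprD mulrN oppr_le0 pmulr_lge0// addr_gt0.
(* mirror image in the wall of angle L *)
have f2 : 0 <= xi 0 0 * sin L - xi 0 1 * cos L.
  have fl : f (pol (L *+ 2 - t)) = f (pol t) by rewrite addrC dihedral_period dihedral_even.
  have := refl _ fl; rewrite dot2E !mxE /=.
  have sL : 0 < sin (L - t).
    by rewrite sin_gt0_pi// subr_gt0 tL (lt_le_trans _ Lpi)// ltrBlDr ltrDl.
  have cab (a b : R) : cos (a + b) - cos (a - b) = - 2 * sin a * sin b by rewrite cosD cosB; ring.
  have sab (a b : R) : sin (a + b) - sin (a - b) = 2 * cos a * sin b by rewrite sinD sinB; ring.
  have := cab L (L - t); have := sab L (L - t).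
  have -> : L + (L - t) = L *+ 2 - t by rewrite mulr2n addrA.
  have -> : L - (L - t) = t by rewrite opprB addrC subrK.
  move=> -> ->; move: (sin L) (cos L) (sin (L - t)) sL => sl cl b b0 H.
  by rewrite -(pmulr_lge0 _ b0); move: H; lra.
have [rho [tau [rho0 /andP[tau0 taupi] xiE]]] := polar_upper f1.
have [rz|rn0] := eqVneq rho 0.
  by exists 0, 0; rewrite xiE rz !scale0r lexx ltW.
exists rho, tau; split=> //; rewrite tau0 leNgt; apply/negP => Ltau.
have rp : 0 < rho by rewrite lt_neqAle eq_sym rn0.
move: f2; rewrite xiE !mxE /= => H.
have : 0 <= rho * sin (L - tau) by rewrite sinB; move: H; lra.
rewrite pmulr_rge0// leNgt => /negP; apply.
rewrite -oppr_gt0 -sinN opprB sin_gt0_pi// subr_gt0 Ltau (lt_le_trans _ taupi)//.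
by rewrite ltrBlDr ltrDl.
Qed.

End chamber.

(** * Extension of an invariant norm from a normal plane *)

Lemma Ck_coord {R : realType} {n : nat} k i (U : set 'rV[R]_n) : open U ->
  Ck k U (fun x : 'rV[R]_n => x 0 i).
Proof.
move=> oU; case: k => [|k]; first by move=> x _; exact: coord_continuous.
split=> [x _|v]; first exact: differentiable_coord.
have := Ck_cst (V := 'rV[R]_n) k U (v 0 i); apply: eq_Ck => // x _.
by have [_ ->] := is_derive_coord i (is_derive_id x v).
Qed.

Section extension.
Context {R : realType} {n d : nat}.
Variables (M : R -> set 'rV[R]_n) (p : 'rV[R]_n -> R) (a : R -> R).
Hypothesis fd : foliation_data d M p a.
Notation L := (pi / d%:R : R).
Hypothesis leaves : forall t, 0 <= t <= L -> M t = level p (cos (d%:R * t)).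
Variable g : R -> 'rV[R]_n.
Notation u := (g 0).
Notation v := (g (pi / 2)).
Hypothesis uv : orthonormal2 u v.
Hypothesis pg : forall s, p (circle u v s) = cos (d%:R * s).
Variable f : 'rV[R]_2 -> R.
Hypothesis mf : minkowski_norm f.
Hypothesis df : dihedral_invariant d f.

Let d_gt0 : (0 < d)%N. Proof. exact: fd_d fd. Qed.

(** f on the unit circle in the variable t = d * angle = acos p, for which the
    walls of the chamber are at 0 and pi, as [Ck_acos] wants. *)
Definition profile (t : R) : R := f (pol (t / d%:R)).

(** The only candidate: homogeneous, with the value of f at the point of the
    plane that lies on the same leaf. *)
Definition extension (x : 'rV[R]_n) : R :=
  enorm x * profile (acos (radial_ext p x)).

(** The reflections in the two walls of the chamber. *)
Lemma profile_even_per : even_per profile.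
Proof.
have dR : d%:R != 0 :> R by rewrite pnatr_eq0 -lt0n.
split.
- by move=> t _; rewrite /profile mulNr (dihedral_even mf df).
- move=> t _; rewrite /profile mulrBl [(pi + t) / _]mulrDl -[RHS](dihedral_even mf df).
  rewrite -[RHS](dihedral_period mf df); congr (f (pol _)).
  by rewrite opprD mulr2n addrACA addNr add0r addrC.
move=> k; have [_ _ sf _ _] := mf; have cf := smooth_on_Ck k open_neq0 sf.
have oE := @open_evper R.
apply: (@Ck_curve R R 2 k (@evper R) _ f (fun t => pol (t / d%:R)) oE open_neq0 _ cf).
  by move=> t _; exact: pol_neq0.
have cl : Ck k (@evper R) (fun t => t / d%:R).
  by apply: (CkM oE); [exact: Ck_id|exact: Ck_cst].
have [ck sk] := @Ck_trig R k.
move=> i; have [->|->] := ord2P i.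
  have := Ck_comp oE (@openT R) (fun x _ => I) ck cl.
  by apply: eq_Ck => // t _; rewrite !mxE.
have := Ck_comp oE (@openT R) (fun x _ => I) sk cl.
by apply: eq_Ck => // t _; rewrite !mxE.
Qed.

Lemma enorm_Ck k : Ck k [set x : 'rV[R]_n | x != 0] enorm.
Proof.
have oU := @open_neq0 R n.
have cd : Ck k [set x : 'rV[R]_n | x != 0] (fun x => dot x x).
  exact: (Ck_sum oU (fun i => CkM oU (Ck_coord k i oU) (Ck_coord k i oU))).
apply: (Ck_comp oU _ _ (Ck_sqrt k) cd); first exact: open_gt.
by move=> x x0 /=; rewrite dot_gt0.
Qed.

Lemma radial_ext_bound x : x != 0 -> -1 <= radial_ext p x <= 1.
Proof. by move=> x0; apply: (fd_bound fd); exact: normalize_sphere. Qed.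

(** On the focal leaves the angle is not smooth; there [Ck_acos] is
    indispensable. *)
Lemma extension_Ck k : Ck k [set x : 'rV[R]_n | x != 0] extension.
Proof.
have oU := @open_neq0 R n.
apply: (CkM oU); first exact: enorm_Ck.
apply: (Ck_acos oU profile_even_per); last by move=> x; exact: radial_ext_bound.
by apply: smooth_on_Ck => //; exact: (fd_smooth fd).
Qed.

Lemma extensionZ l x : 0 <= l -> extension (l *: x) = l * extension x.
Proof.
rewrite le_eqVlt => /predU1P[<-|l0].
  by rewrite scale0r mul0r /extension /enorm dot0l sqrtr0 mul0r.
by rewrite /extension enormZ ?ltW// radial_extZ// mulrA.
Qed.

Lemma profile_gt0 t : 0 < profile t.
Proof. by have [_ f0 _ _ _] := mf; apply: f0; exact: pol_neq0. Qed.

Lemma extension_sphere x : sphere x -> extension x = f (pol (angle d p x)).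
Proof.
by move=> xS; rewrite /extension (xS : enorm x = 1) mul1r radial_ext_sphere.
Qed.

Lemma extension_induced : induced_by d M extension.
Proof.
move=> t; rewrite in_itv /= => tL x y Mx My.
have xS := leaf_sphere fd tL Mx; have yS := leaf_sphere fd tL My.
move: Mx My; rewrite leaves// => -[_ px] [_ py].
by rewrite !extension_sphere// /angle px py.
Qed.

Lemma extension_plane : extension \o plane_point g = f.
Proof.
have [_ _ _ hf _] := mf.
apply/funext => y /=; have [->|y0] := eqVneq y 0.
  have -> : plane_point g 0 = 0 :> 'rV[R]_n by rewrite -(scale0r 0) plane_pointZ scale0r.
  by rewrite -(scale0r 0) extensionZ// -[in RHS](scale0r 0) hf// !mul0r.
have [r [s [r0 ->]]] := polar2 y0.
rewrite plane_pointZ extensionZ ?ltW// hf ?ltW// plane_point_pol extension_sphere.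
  by rewrite /angle pg (dihedral_acos d_gt0 mf df).
exact: circle_sphere.
Qed.

Lemma extension_energy x : x != 0 -> exists t r,
  [/\ 0 < r, x = r *: ((enorm x)^-1 *: x), r = enorm x,
     t = angle d p ((enorm x)^-1 *: x) & energy extension x = energy f (r *: pol t)].
Proof.
move=> x0; set x' := _ *: x; have xS : sphere x' by exact: normalize_sphere.
have e0 : 0 < enorm x by rewrite enorm_gt0.
have xE : x = enorm x *: x' by rewrite /x' normalizeK.
exists (angle d p x'), (enorm x); split=> //.
have [_ _ _ hf _] := mf.
by rewrite /energy {1}xE extensionZ ?ltW// extension_sphere// hf ?ltW.
Qed.

(** E - c |.|^2 has a supporting linear function at each regular point x. In the
    normal plane through x it is that of e - c |.|^2, with slope rho pol tau, and
    xi is this slope moved to the normal circle. For y out of the plane compare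
    with the point of the plane that has the same length r and the same angle s:
    E has the same value there, whereas <xi, y> can only be smaller, since
    <circle tau, y> <= r cos (tau - s) by [dot_leaves]. This needs tau to be the
    angle of circle tau, hence to lie in the chamber: see [chamber_gradient]. *)
Lemma extension_support c :
  (forall x y, x != 0 ->
    energy f x + dot (legendre f x) (y - x) + c * dot (y - x) (y - x) <= energy f y) ->
  forall x, x != 0 -> -1 < radial_ext p x < 1 -> exists xi, forall y, y != 0 ->
    energy extension x - c * dot x x + dot xi (y - x) <= energy extension y - c * dot y y.
Proof.
move=> conv x x0 /andP[p1 p2].
have [t [r [r0 xE rE tE ex]]] := extension_energy x0.
set x' := _ *: x in xE tE; have xS : sphere x' by exact: normalize_sphere.
have pn1 : p x' != 1 by apply/eqP => px; move: p2; rewrite /radial_ext -/x' px ltxx.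
have [m [w [t' [mw t'L x'E pm]]]] := ex_normal_circle fd leaves xS pn1.
have t'E : t' = t.
  rewrite tE; apply/esym; apply: (angle_cos fd); last by rewrite x'E pm.
  by case/andP: t'L => h1 ->; rewrite ltW.
rewrite t'E in x'E t'L.
have tL : 0 < t < L.
  case/andP: t'L => t0 tL; rewrite t0 lt_neqAle tL andbT; apply/eqP => tLE.
  by move: p1; rewrite /radial_ext -/x' x'E pm tLE (dL fd) cospi ltxx.
have [rho [tau [rho0 tauL xiE]]] := chamber_gradient d_gt0 mf df conv r0 tL.
exists (rho *: circle m w tau) => y y0.
have [ty [ry [ry0 yE ryE tyE ey]]] := extension_energy y0.
set y' := _ *: y in yE tyE; have yS : sphere y' by exact: normalize_sphere.
have X0 : r *: pol t != 0 by rewrite scaler_eq0 negb_or gt_eqF//= pol_neq0.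
have := conv (r *: pol t) (ry *: pol ty) X0.
rewrite -ex -ey.
have Xi : legendre f (r *: pol t) = rho *: pol tau + c *+ 2 *: (r *: pol t).
  by rewrite -xiE subrK.
have h1 : dot (circle m w tau) y' <= cos (tau - ty).
  have cS := circle_sphere tau mw.
  have := dot_leaves fd leaves cS yS.
  by rewrite (angle_cos fd tauL (pm tau)) -tyE.
have h2 : dot (circle m w tau) x' = cos (tau - t) by rewrite x'E dot_circle.
have xx : dot x x = r ^+ 2 by rewrite rE enorm_sqr.
have yy : dot y y = ry ^+ 2 by rewrite ryE enorm_sqr.
rewrite xx yy Xi.
have -> : dot (rho *: pol tau + c *+ 2 *: (r *: pol t)) (ry *: pol ty - r *: pol t) =
    rho * (ry * cos (tau - ty)) - rho * (r * cos (tau - t)) +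
    c *+ 2 * (r * (ry * cos (t - ty)) - r ^+ 2).
  by rewrite !dotE !dot_pol subrr cos0; ring.
have -> : dot (ry *: pol ty - r *: pol t) (ry *: pol ty - r *: pol t) =
    ry ^+ 2 + r ^+ 2 - (r * (ry * cos (t - ty))) *+ 2.
  by rewrite !dotE !dot_pol !subrr cos0 -[cos (ty - t)]cosN opprB; ring.
have h3 : rho * (ry * dot (circle m w tau) y') <= rho * (ry * cos (tau - ty)).
  by rewrite ler_wpM2l// ler_wpM2l// ltW.
have -> : dot (rho *: circle m w tau) (y - x) =
    rho * (ry * dot (circle m w tau) y') - rho * (r * cos (tau - t)).
  by rewrite yE xE -h2; move: (circle m w tau) (y') (x') => C Y X; rewrite !dotE; ring.
move: h3; set A := rho * (ry * dot _ _); set B := rho * (ry * cos _).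
set C := rho * (r * _); set D := r * (ry * _); rewrite !mulr2n; lra.
Qed.

End extension.

Arguments profile {R} d f t.
Arguments extension {R n} d p f x.

(** * Convexity of the extension *)

Lemma second_derivative_min {R : realType} (r r' : R -> R) (l dl : R) : 0 < dl ->
  (forall t : R, `|t| < dl -> is_derive t (1 : R) r (r' t)) ->
  is_derive (0 : R) (1 : R) r' l ->
  (forall t, `|t| < dl -> r 0 <= r t) -> 0 <= l.
Proof.
move=> dl0 dr dr' rmin.
have r'0 : r' 0 = 0.
  have d0 : is_derive (0 : R) (1 : R) r (r' 0) by apply: dr; rewrite normr0.
  have := der_local_max (derN d0); rewrite -[RHS]oppr0 => H.
  apply: oppr_inj; apply: H; apply/near_ballP; exists dl => // s; rewrite subr0 => sd.
  by rewrite lerN2 rmin.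
rewrite leNgt; apply/negP => l0.
move: dr' => /is_derive1_caratheodory[g [gE /cont_ballP cg g0]].
have nl : 0 < - l by rewrite oppr_gt0.
have [d d0 gd] := cg _ nl.
have [m m0 [md mdl]] := ex_lt2 d0 dl0.
have dro (t : R) : 0 < t < m -> is_derive t (1 : R) r (r' t).
  by move=> /andP[t0 tm]; apply: dr; rewrite gtr0_norm// (lt_trans tm).
have cr (t : R) : 0 <= t <= m -> {for t, continuous r}.
  move=> /andP[t0 tm]; apply: (der_cont (dr t _)).
  by rewrite ger0_norm// (le_lt_trans tm).
have [c /andP[c0 cm] E] := MVT_oo m0 dro cr.
have cd : `|c - 0| < d by rewrite subr0 gtr0_norm// (lt_trans cm).
have := gd c cd; rewrite g0 ltr_norml opprK => /andP[_ gl].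
have r'c : r' c < 0.
  have := gE c; rewrite r'0 !subr0 => ->.
  by rewrite pmulr_llt0//; move: gl; lra.
have := rmin m; rewrite gtr0_norm// => /(_ mdl); rewrite -subr_ge0 E subr0.
by rewrite leNgt pmulr_llt0// r'c.
Qed.

Section extension_minkowski.
Context {R : realType} {n d : nat}.
Variables (M : R -> set 'rV[R]_n) (p : 'rV[R]_n -> R) (a : R -> R).
Hypothesis fd : foliation_data d M p a.
Notation L := (pi / d%:R : R).
Hypothesis leaves : forall t, 0 <= t <= L -> M t = level p (cos (d%:R * t)).
Variable f : 'rV[R]_2 -> R.
Hypothesis mf : minkowski_norm f.
Hypothesis df : dihedral_invariant d f.
Notation F := (extension d p f).
Notation E := (energy F).

Lemma extension_energy_Ck k : Ck k [set x : 'rV[R]_n | x != 0] E.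
Proof. exact: (Ck_energy open_neq0 (extension_Ck fd mf df k)). Qed.

Let E_diff x : x != 0 -> differentiable E x.
Proof. by move=> x0; have [+ _] := extension_energy_Ck 1; exact. Qed.

Let DE_diff w x : x != 0 -> differentiable ('D_w E) x.
Proof. by move=> x0; have [_ /(_ w) [+ _]] := extension_energy_Ck 2; exact. Qed.

Variable c : R.
Hypothesis conv : forall x y, x != 0 ->
  energy f x + dot (legendre f x) (y - x) + c * dot (y - x) (y - x) <= energy f y.

(** Along the line through x, E - c |.|^2 minus its supporting function has a
    minimum at x, where its second derivative is therefore nonnegative. *)
Lemma extension_hess_regular x w : x != 0 -> -1 < radial_ext p x < 1 ->
  c *+ 2 * dot w w <= 'D_w ('D_w E) x.
Proof.
move=> x0 px; have [xi supp] := extension_support fd leaves mf df conv x0 px.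
have [d1 d10 H1] : exists2 d1 : R, 0 < d1 & forall t, `|t| < d1 -> x + t *: w != 0.
  have /near_ballP[d1 d10 H1] : \forall y \near x, [set y | y != 0] y.
    by apply: open_nbhs_nbhs; split=> //; exact: open_neq0.
  have w1 : 0 < `|w| + 1 by rewrite ltr_wpDl.
  exists (d1 / (`|w| + 1)); first by rewrite divr_gt0.
  move=> t; rewrite ltr_pdivlMr// => td; apply: H1.
  rewrite [x + _]addrC addrK normrZ; apply: le_lt_trans td.
  by rewrite ler_wpM2l// lerDl.
pose r t := E (x + t *: w) -
  (c * (dot x x + 2 * dot x w * t + dot w w * t ^+ 2) + dot xi w * t).
pose r' t := 'D_w E (x + t *: w) - (c * (2 * dot x w + 2 * dot w w * t) + dot xi w).
rewrite -subr_ge0.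
apply: (@second_derivative_min _ r r' _ d1) => //.
- move=> t td; have xt := H1 t td.
  have l1 : is_derive t (1 : R) (fun s => E (x + s *: w)) ('D_w E (x + t *: w)).
    by apply: is_derive_line; apply: diff_derivable; exact: E_diff.
  apply: derE (derB l1 (derD (derMl c (derD (derD (derC t (dot x x))
    (derMl (2 * dot x w) (derX t))) (derMl (dot w w) (der_exp 2 t)))) (derMl (dot xi w) (derX t)))) _.
  by rewrite /r' /=; ring.
- have x00 : x + (0 : R) *: w != 0 by rewrite scale0r addr0.
  have l2 : is_derive (0 : R) (1 : R) (fun s => 'D_w E (x + s *: w)) ('D_w ('D_w E) (x + (0 : R) *: w)).
    by apply: is_derive_line; apply: diff_derivable; exact: DE_diff.
  apply: derE (derB l2 (derD (derMl c (derD (derC 0 (2 * dot x w))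
    (derMl (2 * dot w w) (derX 0)))) (derC 0 (dot xi w)))) _.
  by rewrite scale0r addr0; ring.
move=> t td; have := supp (x + t *: w) (H1 t td).
have -> : x + t *: w - x = t *: w by rewrite [x + _]addrC addrK.
rewrite /r scale0r addr0 !dotE (dotC w x) -subr_ge0 => H; rewrite -subr_ge0.
by apply: (le_trans H); rewrite le_eqVlt; apply/orP; left; apply/eqP; ring.
Qed.

Hypothesis ex_levels : forall s, s = 1 \/ s = -1 -> exists2 y, sphere y & p y = s.

(** The focal leaves remain. Join x to a point where p has another value by a
    great circle: the derivative of p along it is a nonzero form, so the points
    that follow x are regular, and the bound passes to the limit. *)
Lemma extension_hess x w : x != 0 -> c *+ 2 * dot w w <= 'D_w ('D_w E) x.
Proof.
move=> x0; have := radial_ext_bound fd x0 => /andP[b1 b2].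
have [px|] := boolP (-1 < radial_ext p x < 1); first exact: extension_hess_regular.
rewrite !lt_neqAle b1 b2 !andbT negb_and !negbK => pcr.
set x' := (enorm x)^-1 *: x; have xS : sphere x' by exact: normalize_sphere.
have e0 : 0 < enorm x by rewrite enorm_gt0.
have xE : x = enorm x *: x' by rewrite /x' normalizeK.
have [y yS py] : exists2 y, sphere y & p y != p x'.
  case/orP: pcr => /eqP pe.
    have [|y yS py] := ex_levels (s := 1); first by left.
    by exists y => //; rewrite py -/(radial_ext p x) -pe; apply/eqP; lra.
  have [|y yS py] := ex_levels (s := -1); first by right.
  by exists y => //; rewrite py -/(radial_ext p x) pe; apply/eqP; lra.
have n1 : (1 < n)%N := ltnW (fd_n fd).
have yx1 := dot_itv yS xS.
have a1 : 0 <= acos (dot y x') <= pi by rewrite acos_ge0 ?acos_lepi.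
have a2 : dot y x' = cos (acos (dot y x')) by rewrite acosK ?in_itv.
have [z xz yE] := circle_through n1 xS yS a1 a2.
pose q s := p (circle x' z s).
pose q' s := dot (sgrad p (circle x' z s)) (circle x' z (s + pi / 2)).
have hq : trig_form d q by exact: (fd_trig fd xz).
have dq s : is_derive s (1 : R) q (q' s).
  exact: (is_derive_on_circle (fd_smooth fd) s xz).
have hq' := trig_form_derE hq dq.
have q'n0 : exists s, q' s != 0.
  apply: (der_neq0 dq (a := acos (dot y x')) (b := 0)).
  by rewrite /q -yE circle0.
have [e1 e10 q'e] := trig_form_isolated hq' q'n0.
pose h s := 'D_w ('D_w E) (enorm x *: circle x' z s).
have hreg s : 0 < s < e1 -> c *+ 2 * dot w w <= h s.
  move=> se; have cS := circle_sphere s xz; apply: extension_hess_regular.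
    by rewrite scaler_eq0 negb_or gt_eqF//=; exact: sphere_neq0.
  rewrite radial_extZ// radial_ext_sphere//.
  have /andP[c1 c2] := fd_bound fd cS.
  have crit : ~ (p (circle x' z s) = 1 \/ p (circle x' z s) = -1).
    by move=> /(fd_crit fd cS) g0; have := q'e s se; rewrite /q' g0 dot0l eqxx.
  rewrite !lt_neqAle c1 c2 !andbT; apply/andP; split; apply/eqP => pE; apply: crit; first by right.
  by left.
have -> : 'D_w ('D_w E) x = h 0 by rewrite /h circle0 -xE.
have ch : {for 0, continuous h}.
  have x00 : enorm x *: circle x' z 0 != 0 by rewrite circle0 -xE.
  have [_ /(_ w) [_ /(_ w) cD]] := extension_energy_Ck 2.
  apply: (@continuous_comp _ _ _ (fun t => enorm x *: circle x' z t) ('D_w ('D_w E))); last exact: cD.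
  apply: cvgZl_tmp; apply: differentiable_continuous; apply/derivable1_diffP.
  by have [] := is_derive_circle x' z 0.
rewrite leNgt; apply/negP => hlt.
have gap : 0 < c *+ 2 * dot w w - h 0 by rewrite subr_gt0.
have /cont_ballP/(_ _ gap)[e2 e20 he] := ch.
have [t t0 [t1 t2]] := ex_lt2 e10 e20.
have := he t; rewrite subr0 gtr0_norm// => /(_ t2); rewrite ltr_norml => /andP[_ ht].
have hr : c *+ 2 * dot w w <= h t by apply: hreg; rewrite t0 t1.
by move: hr ht; clear; move: (h t) (h 0) (c *+ 2 * dot w w) => A B C; lra.
Qed.

Lemma extension_minkowski : 0 < c -> minkowski_norm F.
Proof.
move=> c0; split.
- split; last by move=> x; rewrite mulr_ge0 ?enorm_ge0// ltW// profile_gt0.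
  move=> x; have [->|x0] := eqVneq x 0; last first.
    exact: (Ck_cont (extension_Ck fd mf df 0) x0).
  have cpt := @sphere_compact R 2.
  have ne : @sphere R 2 !=set0 by exists (pol 0); exact: pol_sphere.
  have cf : {within @sphere R 2, continuous f}.
    by apply: continuous_subspaceT; have [[]] := mf.
  have [y _ ymax] := EVT_max_rV ne cpt cf.
  have fmax s : f (pol s) <= f y.
    by apply: ymax; rewrite inE; exact: pol_sphere.
  have y0 : 0 < f y.
    by apply: lt_le_trans (fmax 0); have [_ f0 _ _ _] := mf; apply: f0; exact: pol_neq0.
  (* At 0 the extension is at most enorm times the maximum f y of f on the unit
     circle. *)
  have ce : {for 0, continuous (@enorm R n)}.
    apply: (@continuous_comp _ _ _ (fun x : 'rV[R]_n => dot x x) Num.sqrt).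
      exact: dot_self_continuous.
    exact: sqrt_continuous.
  apply/cont_ballP => e e0; have /cont_ballP/(_ _ (divr_gt0 e0 y0))[d1 d10 H] := ce.
  exists d1 => // z zd; have := H z zd.
  have e00 : enorm (0 : 'rV[R]_n) = 0 by rewrite /enorm dot0l sqrtr0.
  rewrite /extension e00 mul0r !subr0 ger0_norm ?enorm_ge0// ltr_pdivlMr// => Hz.
  rewrite ger0_norm; last by rewrite mulr_ge0 ?enorm_ge0// ltW// profile_gt0.
  by apply: le_lt_trans Hz; rewrite ler_wpM2l ?enorm_ge0// fmax.
- by move=> x x0; rewrite mulr_gt0 ?enorm_gt0// profile_gt0.
- by apply: Ck_smooth_on => k; exact: (extension_Ck fd mf df k).
- by move=> l x l0; rewrite extensionZ.
move=> x x0 w w0; rewrite (hessianE _ open_neq0 (extension_energy_Ck 2) x0).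
by apply: lt_le_trans (extension_hess w x0); rewrite mulr_gt0 ?mulrn_wgt0// dot_gt0.
Qed.

End extension_minkowski.

(** * The correspondence *)

Lemma geodesic_circle {R : realType} {n : nat} (g : R -> 'rV[R]_n) : sphere_geodesic g ->
  orthonormal2 (g 0) (g (pi / 2)) /\ g = circle (g 0) (g (pi / 2)).
Proof.
move=> [u [v [uS vS uv gE]]].
have g0 : g 0 = u by rewrite gE cos0 sin0 scale1r scale0r addr0.
have g1 : g (pi / 2) = v by rewrite gE cos_pihalf sin_pihalf scale1r scale0r add0r.
by rewrite g0 g1; split=> //; apply/funext.
Qed.

Lemma derive1_circle {R : realType} {n : nat} (u v : 'rV[R]_n) s :
  derive1 (circle u v) s = circle u v (s + pi / 2).
Proof. by rewrite derive1E; have [_ ->] := is_derive_circle u v s. Qed.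

(** Two great circles with the same image have parallel velocities at a common
    point, so being orthogonal to the leaves does not depend on the
    parametrization. *)
Lemma normal_geodesic_range {R : realType} {n d : nat} (M : R -> set 'rV[R]_n)
    (g g' : R -> 'rV[R]_n) : sphere_geodesic g -> range g = range g' ->
  normal_geodesic d M g' -> normal_geodesic d M g.
Proof.
move=> gg rgg [gg' nor]; split=> // t tL; have [[s0 Ms0] ort] := nor t tL.
have [uv gE] := geodesic_circle gg; have [uv' gE'] := geodesic_circle gg'.
move: (g 0) (g (pi / 2)) uv gE => u v uv gE.
move: (g' 0) (g' (pi / 2)) uv' gE' => u' v' uv' gE'.
have to_g s : exists s', g s = g' s'.
  have : range g (g s) by exists s.
  by rewrite rgg => -[s' _ <-]; exists s'.
split.
  have : range g' (g' s0) by exists s0.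
  by rewrite -rgg => -[s _ gs]; exists s; rewrite gs.
move=> s w Ms wT; have [s1 e1] := to_g s; have [s2 e2] := to_g (s + pi / 2).
have := ort s1 w; rewrite -e1 => /(_ Ms wT).
rewrite gE' derive1_circle => h.
rewrite gE derive1_circle -gE e2 gE'.
have c0 : cos (s2 - s1) = 0.
  rewrite -(dot_circle _ _ uv') -gE' -e2 -e1 gE dot_circle//.
  by rewrite [s + _]addrC addrK cos_pihalf.
have -> : s2 = s1 + (s2 - s1) by rewrite addrC subrK.
by rewrite circleD c0 scale0r add0r dotZl h mulr0.
Qed.

Lemma plane_pointP {R : realType} {n : nat} (V : {vspace 'rV[R]_n})
    (g : R -> 'rV[R]_n) x : parametrizes_great_circle V g ->
  x \in V <-> exists y, x = plane_point g y.
Proof.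
move=> [gg rg]; have [uv gE] := geodesic_circle gg.
have gV s : g s \in V.
  have : range g (g s) by exists s.
  by rewrite rg => -[].
split=> [xV|[y ->]]; last by rewrite /plane_point memvD// memvZ.
have [->|x0] := eqVneq x 0; first by exists 0; rewrite linear0.
have : ([set x | x \in V] `&` sphere) ((enorm x)^-1 *: x).
  by split; [rewrite /= memvZ|exact: normalize_sphere].
rewrite -rg => -[s _ gs]; exists (enorm x *: pol s).
by rewrite plane_pointZ plane_point_pol -gE gs normalizeK.
Qed.

Theorem theorem6p8 (R : realType) (n d : nat) (M : R -> set 'rV[R]_n)
    (V : {vspace 'rV[R]_n}) (g : R -> 'rV[R]_n) :
  (2 < n)%N ->
  isoparametric_foliation d M ->
  normal_plane d M V ->
  parametrizes_great_circle V g ->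
  M 0 (g 0) ->
  (forall Psi, induced_legendre d M Psi ->
     forall x : 'rV[R]_n, x \in V -> x != 0 -> Psi x \in V /\ Psi x != 0) /\
  set_bij (induced_legendre d M) (dihedral_legendre d) (plane_restriction g).
Proof.
move=> n2 isoM [_ [g' [ng' [gg' rg']]]] gV M0g.
have [p [a fd]] := foliation_dataP n2 isoM.
have [gg rg] := gV; have [uv gE] := geodesic_circle gg.
have rgg : range g = range g' by rewrite rg rg'.
have [_ nor] := normal_geodesic_range gg rgg ng'.
have L0 : 0 < pi / d%:R :> R := L_gt0 fd.
have hL : exists s, M (pi / d%:R) (circle (g 0) (g (pi / 2)) s).
  by rewrite -gE; have [|+ _] := nor (pi / d%:R); first by rewrite in_itv/= lexx ltW.
have hnor s t w : 0 <= t <= pi / d%:R -> M t (circle (g 0) (g (pi / 2)) s) ->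
    tangent_vector (M t) (circle (g 0) (g (pi / 2)) s) w ->
    dot (circle (g 0) (g (pi / 2)) (s + pi / 2)) w = 0.
  rewrite -derive1_circle -gE => tL; have [|_ +] := nor t; first by rewrite in_itv.
  exact.
have [pg [leaves aE]] := normal_circle_leaves fd uv M0g hL hnor.
split=> [_ [F [mF iF] <-] x xV x0|].
  split.
    apply/(plane_pointP _ gV); apply: (legendre_plane fd leaves aE uv pg mF iF) => //.
    exact/(plane_pointP _ gV).
  apply/eqP => l0; have := euler_energy mF x; rewrite l0 dot0l => /esym/eqP.
  by rewrite mulf_eq0 pnatr_eq0/= gt_eqF// (energy_gt0 mF).
split.
- move=> _ [F [mF iF] <-]; exists (F \o plane_point g).
    split; first exact: restriction_minkowski.
    exact: (restriction_dihedral fd leaves uv pg mF iF).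
  by rewrite restriction_legendre.
- move=> _ _ /set_mem[F1 [m1 i1] <-] /set_mem[F2 [m2 i2] <-] eqF.
  by rewrite (restriction_injective fd leaves uv pg m1 m2 i1 i2 eqF).
move=> _ [f [mf df] <-].
have [c c0 [hc ec]] := uniform_convexity mf.
have conv := strong_convexity mf hc ec.
have levels s : s = 1 \/ s = -1 -> exists2 y, sphere y & p y = s.
  case=> ->; last by have [y [yS py]] := fd_ML0 fd; exists y.
  by have := M0g; rewrite (fd_M0 fd) => -[gS pg0]; exists (g 0).
have mF := extension_minkowski fd leaves mf df conv levels c0.
exists (legendre (extension d p f)).
  by exists (extension d p f) => //; split=> //; exact: (extension_induced fd leaves).
by rewrite restriction_legendre// (extension_plane fd uv pg mf df).
Qed.
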